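(* Let $U_1=\{\sigma+it\in\mathbb{C}:\alpha_1<\sigma<\beta_1\}$ and $U_2=\{\sigma+it\in\mathbb{C}:\alpha_2<\sigma<\beta_2\}$ with $U_1\cap U_2\neq\emptyset$. Let $\Lambda_1=\{\lambda_1,\lambda_2,\ldots\}$ and $\Lambda_2=\{\mu_1,\mu_2,\ldots\}$ be two countable sets of real numbers, each of which is linearly independent over $\mathbb{Q}$. Let $f_1\in AP(U_1,\mathbb{C})$ and $f_2\in AP(U_2,\mathbb{C})$ be two almost periodic functions whose sets of Fourier exponents are $\Lambda_1\cup\{0\}$ and $\Lambda_2\cup\{0\}$, respectively. Then $f_1$ is $^*$-equivalent to $f_2$ if and only if there exists a nonempty open interval $(\alpha,\beta)\subset(\alpha_1,\beta_1)\cap(\alpha_2,\beta_2)$ such that $$\bigcup_{\sigma\in E}\operatorname{Img}\left(f_1(\sigma+it)\right)=\bigcup_{\sigma\in E}\operatorname{Img}\left(f_2(\sigma+it)\right)$$ for every open set $E\subset(\alpha,\beta)$ of real numbers.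
   Context: Throughout $s=\sigma+it$ with $\sigma,t\in\mathbb{R}$, and $-\infty\le\alpha_k<\beta_k\le\infty$ for $k=1,2$. For an open vertical strip $U=\{\sigma+it:\alpha<\sigma<\beta\}$ ($-\infty\le\alpha<\beta\le\infty$), a reduced strip of $U$ is a set $\{\sigma+it:\sigma_1\le\sigma\le\sigma_2\}$ with $\alpha<\sigma_1\le\sigma_2<\beta$. $AP(U,\mathbb{C})$ is the set of analytic functions $f:U\to\mathbb{C}$ such that for every $\varepsilon>0$ and every reduced strip $K$ of $U$ there is $l>0$ such that every real interval of length $l$ contains a number $\tau$ with $|f(s+i\tau)-f(s)|\le\varepsilon$ for all $s\in K$. Dirichlet series and Fourier exponents: for $f\in AP(U,\mathbb{C})$ and $\lambda\in\mathbb{R}$, the Fourier coefficient is $a(\lambda)=\lim_{T\to\infty}\frac{1}{2T}\int_{-T}^{T}f(\sigma+it)e^{-\lambda(\sigma+it)}\,dt$, which exists and does not depend on $\sigma\in(\alpha,\beta)$. The set of $\lambda$ with $a(\lambda)\ne0$ is countable (finite or infinite); it is the set of Fourier exponents of $f$. The formal series $\sum_\lambda a(\lambda)e^{\lambda s}$ over this set is the Dirichlet series of $f$. $^*$-equivalence: let $\Lambda=\{\lambda_1,\lambda_2,\ldots\}$ be a countable (finite or infinite) set of distinct reals with cardinality $\sharp\Lambda$. Two formal exponential sums $\sum_{j\ge1}a_je^{\lambda_js}$ and $\sum_{j\ge1}b_je^{\lambda_js}$ ($a_j,b_j\in\mathbb{C}$) are $^*$-equivalent if for each integer $n\ge1$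 with $n\le\sharp\Lambda$ there is a $\mathbb{Q}$-linear map $\psi_n:V_n\to\mathbb{R}$, where $V_n$ is the $\mathbb{Q}$-vector space generated by $\{\lambda_1,\ldots,\lambda_n\}$, such that $b_j=a_je^{i\psi_n(\lambda_j)}$ for $j=1,\ldots,n$. (Here $\Lambda$ may contain $0$.) Two almost periodic functions $f_1\in AP(U_1,\mathbb{C})$, $f_2\in AP(U_2,\mathbb{C})$ are $^*$-equivalent if their Dirichlet series are $^*$-equivalent; in particular this requires their sets of Fourier exponents to coincide. Notation: $\operatorname{Img}(f(\sigma+it))=\{f(\sigma+it):t\in\mathbb{R}\}$ for fixed $\sigma$. *)

(* Defs.v *)
From Stdlib Require Export Reals QArith Qreals List.
From Coquelicot Require Export Coquelicot.
Export ListNotations.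
Open Scope R_scope.

(** An open vertical strip is given by its abscissae [al be : Rbar].  A function
    on such a strip is a total [f : C -> C]; every notion below only looks at
    its values on the strip. *)

Definition in_interval (al be : Rbar) (sigma : R) : Prop :=
  Rbar_lt al sigma /\ Rbar_lt sigma be.

Definition in_strip (al be : Rbar) (s : C) : Prop := in_interval al be (Re s).

Definition Cexp (z : C) : C :=
  (exp (Re z) * cos (Im z), exp (Re z) * sin (Im z)).

(** Analytic means complex differentiable at every point of the strip: the
    scalar field of [ex_derive] is [C_AbsRing].  "Interval of length [l]" is read
    as closed; open intervals give the same notion after enlarging [l]. *)
Definition AP (al be : Rbar) (f : C -> C) : Prop :=
  (forall s : C, in_strip al be s ->
     @ex_derive C_AbsRing C_NormedModule f s) /\
  (forall eps : R, 0 < eps ->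
   forall sigma1 sigma2 : R,
     Rbar_lt al sigma1 -> sigma1 <= sigma2 -> Rbar_lt sigma2 be ->
     exists l : R, 0 < l /\
       forall x : R, exists tau : R, x <= tau <= x + l /\
         forall s : C, sigma1 <= Re s <= sigma2 ->
           Cmod (f (s + Ci * RtoC tau) - f s)%C <= eps).

Definition fourier_mean (f : C -> C) (lambda sigma T : R) : C :=
  (RtoC (/ (2 * T)) *
   @RInt C_R_CompleteNormedModule
     (fun t : R =>
        (f (sigma, t) * Cexp (- (RtoC lambda * (sigma, t))))%C)
     (- T) T)%C.

(** [a] is the limit of the means on every vertical line of the strip. *)
Definition is_fourier_coef (al be : Rbar) (f : C -> C) (lambda : R) (a : C)
    : Prop :=
  forall sigma : R, in_interval al be sigma ->
    filterlim (fourier_mean f lambda sigma) (Rbar_locally p_infty) (locally a).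

Definition fourier_exponent (al be : Rbar) (f : C -> C) (lambda : R) : Prop :=
  exists a : C, is_fourier_coef al be f lambda a /\ a <> RtoC 0.

Definition Qcomb (l : list (Q * R)) : R :=
  fold_right Rplus 0 (map (fun p => Q2R (fst p) * snd p) l).

Definition Qspan (L : R -> Prop) (x : R) : Prop :=
  exists l : list (Q * R), (forall p, In p l -> L (snd p)) /\ x = Qcomb l.

Definition Qlin_indep (L : R -> Prop) : Prop :=
  forall l : list (Q * R),
    (forall p, In p l -> L (snd p)) -> NoDup (map snd l) ->
    Qcomb l = 0 -> forall p, In p l -> (fst p == 0)%Q.

(** A [Q]-linear map [V -> R], as a function on [R] constrained only on [V]. *)
Definition Qlinear_on (V : R -> Prop) (psi : R -> R) : Prop :=
  (forall x y : R, V x -> V y -> psi (x + y) = psi x + psi y) /\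
  (forall (q : Q) (x : R), V x -> psi (Q2R q * x) = Q2R q * psi x).

(** Cardinals of countable sets: [Some N] is the finite cardinal [N], [None] is
    the infinite one.  A sequence [lam] of cardinality [card] has the terms
    [lam j] with [S j <= card]; the terms are numbered from [0]. *)
Definition le_card (n : nat) (card : option nat) : Prop :=
  match card with Some N => (n <= N)%nat | None => True end.

Definition enumerates (card : option nat) (lam : nat -> R) (L : R -> Prop)
    : Prop :=
  (forall x : R, L x <-> exists j : nat, le_card (S j) card /\ lam j = x) /\
  (forall i j : nat,
     le_card (S i) card -> le_card (S j) card -> lam i = lam j -> i = j).

Definition countable_set (L : R -> Prop) : Prop :=
  exists (card : option nat) (lam : nat -> R), enumerates card lam L.

Definition first_terms (lam : nat -> R) (n : nat) (x : R) : Prop :=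
  exists j : nat, (j < n)%nat /\ x = lam j.

(** [*]-equivalence of the formal sums [sum_j a_j e^(lam_j s)] and
    [sum_j b_j e^(lam_j s)]. *)
Definition sums_star_equiv (card : option nat) (lam : nat -> R)
    (a b : nat -> C) : Prop :=
  forall n : nat, (1 <= n)%nat -> le_card n card ->
    exists psi : R -> R,
      Qlinear_on (Qspan (first_terms lam n)) psi /\
      forall j : nat, (j < n)%nat ->
        b j = (a j * Cexp (Ci * RtoC (psi (lam j))))%C.

(** The choice of the common enumeration of the exponents is immaterial: every
    finite set of exponents lies in an initial segment of any enumeration. *)
Definition star_equiv (al1 be1 : Rbar) (f1 : C -> C)
    (al2 be2 : Rbar) (f2 : C -> C) : Prop :=
  exists (card : option nat) (lam : nat -> R) (a b : nat -> C),
    enumerates card lam (fourier_exponent al1 be1 f1) /\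
    enumerates card lam (fourier_exponent al2 be2 f2) /\
    (forall j : nat, le_card (S j) card ->
       is_fourier_coef al1 be1 f1 (lam j) (a j) /\
       is_fourier_coef al2 be2 f2 (lam j) (b j)) /\
    sums_star_equiv card lam a b.

Definition Img (f : C -> C) (sigma : R) (w : C) : Prop :=
  exists t : R, w = f (sigma, t).

(* Main.v *)
(** Since the nonzero exponents are independent over [Q], products of Fejer kernels
    show [|a_0| + sum |a_j| e^(lam_j sigma) <= sup |f|] on every vertical line; hence the
    Dirichlet series converges absolutely, and by the uniqueness theorem for almost
    periodic functions it represents [f].  Independence also makes [*]-equivalence the
    same as equality of the constant terms and of the moduli [|a_j|].  If these agree,
    Kronecker's theorem gives vertical translates of [f1] converging to [f2], and
    Hurwitz' theorem transfers values.  Conversely, equal value sets on thin strips give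
    the same suprema of [Re (e^(i phi) f)] on each line, namely
    [Re (e^(i phi) a_0) + sum |a_j| e^(lam_j sigma)]; letting [phi] vary separates the
    constant terms from the sums of moduli, and the identity theorem applied to the
    latter recovers the exponents and the moduli. *)

Require Import Defs.
From Stdlib Require Import Factorial Lra Lia Psatz.
From Stdlib Require Import ClassicalEpsilon Classical FunctionalExtensionality.
Open Scope R_scope.

(** * Complex exponentials and integrals of complex functions *)

(** The obstacle in the uniqueness theorem is that frequencies range over a noncompact line:
    vanishing of every mean gives no rate uniform in the frequency. Sampling with step [delta]
    identifies frequencies modulo [2 * PI / delta]; on the remaining compact set a uniform rate
    exists, and a trilinear sum over samples turns it into a contradiction. Almost periods are
    handled through an abstract relation because several functions and characters must share them.
    Goursat's theorem serves to move means from one vertical line to another. The remaining complex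
    analysis is done on absolutely convergent exponential series: power moments are Taylor data at a
    point, and rotating the coefficients continues the expansion along the vertical line, where
    means isolate single exponents. This yields a finite local order for Hurwitz' argument and the
    comparison of two series that agree on an interval. The exponent 0 lies outside an independent
    set, so the constant term is carried separately; a linear phase vanishes at 0, which is why this
    term must agree exactly. *)

Definition cis (x : R) : C := (cos x, sin x).

Lemma cis_plus x y : cis (x + y) = (cis x * cis y)%C.
Proof.
  unfold cis, Cmult; simpl.
  rewrite cos_plus, sin_plus; f_equal; ring.
Qed.

Lemma cis_0 : cis 0 = RtoC 1.
Proof. unfold cis; now rewrite cos_0, sin_0. Qed.

Lemma Cmod_cis x : Cmod (cis x) = 1.
Proof.
  unfold Cmod, cis; simpl.
  replace (cos x * (cos x * 1) + sin x * (sin x * 1)) with 1.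
  - apply sqrt_1.
  - pose proof (sin2_cos2 x) as H; unfold Rsqr in H; lra.
Qed.

Lemma cis_opp_l x : (cis (- x) * cis x)%C = RtoC 1.
Proof. rewrite <- cis_plus, Rplus_opp_l; apply cis_0. Qed.

Lemma cis_opp_r x : (cis x * cis (- x))%C = RtoC 1.
Proof. rewrite <- cis_plus, Rplus_opp_r; apply cis_0. Qed.

Lemma cis_pow x n : (cis x ^ n)%C = cis (INR n * x).
Proof.
  induction n as [|n IH].
  - simpl; rewrite Rmult_0_l; now rewrite cis_0.
  - rewrite Cpow_S, IH, <- cis_plus, S_INR; f_equal; ring.
Qed.

Lemma Cexp_cis z : Cexp z = (RtoC (exp (Re z)) * cis (Im z))%C.
Proof. unfold Cexp, cis, Cmult, RtoC; simpl; f_equal; ring. Qed.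

Lemma Cexp_Ci x : Cexp (Ci * RtoC x) = cis x.
Proof.
  unfold Cexp, cis, Ci, Cmult, RtoC; simpl.
  replace (0 * x - 1 * 0) with 0 by ring.
  replace (0 * 0 + 1 * x) with x by ring.
  rewrite exp_0; f_equal; ring.
Qed.

Lemma Cexp_plus z w : Cexp (z + w) = (Cexp z * Cexp w)%C.
Proof.
  rewrite !Cexp_cis; unfold Cplus, Re, Im; simpl.
  rewrite exp_plus, cis_plus, RtoC_mult; ring.
Qed.

Lemma Cmod_Cexp z : Cmod (Cexp z) = exp (Re z).
Proof.
  rewrite Cexp_cis, Cmod_mult, Cmod_cis, Cmod_R, Rabs_pos_eq.
  - ring.
  - left; apply exp_pos.
Qed.

Lemma Re_strip lam sigma t : Re (RtoC lam * (sigma, t))%C = lam * sigma.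
Proof. unfold Re, Cmult, RtoC; simpl; ring. Qed.

Lemma Im_strip lam sigma t : Im (RtoC lam * (sigma, t))%C = lam * t.
Proof. unfold Im, Cmult, RtoC; simpl; ring. Qed.

Lemma Cexp_strip lam sigma t :
  Cexp (RtoC lam * (sigma, t)) = (RtoC (exp (lam * sigma)) * cis (lam * t))%C.
Proof. now rewrite Cexp_cis, Re_strip, Im_strip. Qed.

Lemma Cexp_strip_opp lam sigma t :
  Cexp (- (RtoC lam * (sigma, t)))
  = (RtoC (exp (- (lam * sigma))) * cis (- (lam * t)))%C.
Proof.
  rewrite Cexp_cis, <- (Re_strip lam sigma t), <- (Im_strip lam sigma t); reflexivity.
Qed.

Lemma Cmod_minus_sym z w : Cmod (z - w) = Cmod (w - z).
Proof. rewrite <- Cmod_opp; f_equal; ring. Qed.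

Lemma Cmod_triangle_minus z w : Cmod (z - w) <= Cmod z + Cmod w.
Proof.
  unfold Cminus; eapply Rle_trans; [apply Cmod_triangle|].
  rewrite Cmod_opp; lra.
Qed.

Lemma Cmod_dist_triangle x y z : Cmod (x - z) <= Cmod (x - y) + Cmod (y - z).
Proof.
  replace (x - z)%C with ((x - y) + (y - z))%C by ring; apply Cmod_triangle.
Qed.

Lemma Cmod_le_sub x y : Cmod x <= Cmod y + Cmod (x - y).
Proof.
  replace x with (y + (x - y))%C at 1 by ring; apply Cmod_triangle.
Qed.

Lemma im_le_Cmod z : Rabs (Im z) <= Cmod z.
Proof.
  eapply Rle_trans; [apply Rmax_r|apply Rmax_Cmod].
Qed.

Lemma Cmod_le_sum z : Cmod z <= Rabs (Re z) + Rabs (Im z).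
Proof.
  destruct z as [x y]; unfold Re, Im; simpl.
  replace (x, y) with (RtoC x + Ci * RtoC y)%C.
  - eapply Rle_trans; [apply Cmod_triangle|].
    rewrite Cmod_mult, Cmod_Ci, !Cmod_R; lra.
  - unfold Cplus, Cmult, Ci, RtoC; simpl; f_equal; ring.
Qed.

Lemma Rabs_sin_le x : Rabs (sin x) <= Rabs x.
Proof.
  assert (H : forall y, 0 < y -> Rabs (sin y) <= y).
  { intros y Hy.
    destruct (Rle_dec y 1) as [H1|H1].
    - rewrite Rabs_pos_eq; [left; now apply sin_lt_x|].
      apply sin_ge_0; [lra|]. pose proof PI2_1. lra.
    - apply Rle_trans with 1; [|lra].
      pose proof (SIN_bound y); apply Rabs_le; lra. }
  destruct (Rtotal_order x 0) as [Hx|[->|Hx]].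
  - rewrite <- Rabs_Ropp, <- sin_neg, (Rabs_left x) by lra; apply H; lra.
  - rewrite sin_0; lra.
  - rewrite (Rabs_pos_eq x) by lra; now apply H.
Qed.

(** The chord of angle [x] has length [2 * Rabs (sin (x / 2))] by the half-angle formulas. *)
Lemma Cmod_cis_sub1 x : Cmod (cis x - 1) <= Rabs x.
Proof.
  assert (H : Cmod (cis x - 1) = 2 * Rabs (sin (x / 2))).
  { unfold Cmod, cis, Cminus, Cplus, Copp, RtoC; simpl.
    replace (cos x) with (cos (2 * (x / 2))) by (f_equal; field).
    replace (sin x) with (sin (2 * (x / 2))) by (f_equal; field).
    rewrite cos_2a_sin, sin_2a.
    set (a := sin (x / 2)).
    pose proof (sin2_cos2 (x / 2)) as E; unfold Rsqr in E; fold a in E.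
    set (b := cos (x / 2)) in *.
    match goal with |- sqrt ?u = _ => replace u with (Rsqr (2 * a)) end.
    - rewrite sqrt_Rsqr_abs, Rabs_mult, (Rabs_pos_eq 2); lra.
    - unfold Rsqr; replace (b * b) with (1 - a * a) by lra.
      replace ((2 * a * b + - 0) * ((2 * a * b + - 0) * 1))
        with (4 * a * a * (b * b)) by ring.
      replace (b * b) with (1 - a * a) by lra; ring. }
  rewrite H. pose proof (Rabs_sin_le (x / 2)) as E.
  unfold Rdiv in E at 2; rewrite Rabs_mult, (Rabs_pos_eq (/ 2)) in E; lra.
Qed.

Lemma cis_dist x y : Cmod (cis x - cis y) <= Rabs (x - y).
Proof.
  replace (cis x - cis y)%C with (cis y * (cis (x - y) - 1))%C.
  - rewrite Cmod_mult, Cmod_cis, Rmult_1_l; apply Cmod_cis_sub1.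
  - replace (cis x) with (cis (y + (x - y))) by (f_equal; ring).
    rewrite cis_plus; ring.
Qed.

Lemma cis_surj (z : C) : Cmod z = 1 -> exists x, z = cis x.
Proof.
  destruct z as [a b]; unfold Cmod; simpl; intro H.
  assert (E : a * a + b * b = 1).
  { assert (K : 0 <= a * (a * 1) + b * (b * 1)) by nra.
    pose proof (sqrt_sqrt _ K) as E; rewrite H in E; lra. }
  assert (Ha : -1 <= a <= 1) by nra.
  assert (S2 : sin (acos a) = sqrt (1 - Rsqr a)) by (apply sin_acos; lra).
  assert (C2 : cos (acos a) = a) by (apply cos_acos; lra).
  assert (Sb : sqrt (1 - Rsqr a) = Rabs b).
  { rewrite <- sqrt_Rsqr_abs; f_equal; unfold Rsqr; lra. }
  destruct (Rle_dec 0 b) as [Hb|Hb].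
  - exists (acos a); unfold cis; rewrite C2, S2, Sb, Rabs_pos_eq; auto.
  - exists (- acos a); unfold cis; rewrite cos_neg, sin_neg, C2, S2, Sb, Rabs_left by lra.
    f_equal; ring.
Qed.

Lemma polar (z : C) : exists x, z = (RtoC (Cmod z) * cis x)%C.
Proof.
  destruct (Ceq_dec z 0) as [->|Hz].
  - exists 0; rewrite Cmod_0; ring.
  - assert (Hm : 0 < Cmod z) by now apply Cmod_gt_0.
    assert (RtoC (Cmod z) <> 0) by (apply Cmod_gt_0; rewrite Cmod_R, Rabs_pos_eq; lra).
    destruct (cis_surj (z / RtoC (Cmod z))) as [x Hx].
    + rewrite Cmod_div by auto. rewrite Cmod_R, Rabs_pos_eq by lra; field; lra.
    + exists x; rewrite <- Hx; field; auto.
Qed.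

(** Rotates by the opposite argument. This reduces estimates of moduli to estimates of real parts,
    where monotonicity is available. *)
Lemma Re_align z : exists a, Re (cis a * z)%C = Cmod z.
Proof.
  destruct (polar z) as [x Hx]. exists (- x). rewrite Hx at 1.
  replace (cis (- x) * (RtoC (Cmod z) * cis x))%C
    with (RtoC (Cmod z) * (cis (- x) * cis x))%C by ring.
  rewrite cis_opp_l. unfold Re, Cmult, RtoC; simpl. ring.
Qed.

Lemma function_choice {A B : Type} (Rel : A -> B -> Prop) :
  (forall x, exists y, Rel x y) -> exists g : A -> B, forall x, Rel x (g x).
Proof.
  intro H. exists (fun x => proj1_sig (constructive_indefinite_description _ (H x))).
  intro x. exact (proj2_sig (constructive_indefinite_description _ (H x))).
Qed.

Lemma floor_multiple T x : 0 < T -> 0 <= x -> exists n, INR n * T <= x < INR n * T + T.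
Proof.
  intros HT Hx. destruct (nfloor_ex (x / T)) as [n [N1 N2]]; [now apply Rdiv_le_0_compat|].
  exists n. replace x with (x / T * T) by (field; lra). nra.
Qed.

Lemma enough_multiples T d : 0 < d -> exists N0, forall N, (N0 <= N)%nat -> T <= INR N * d.
Proof.
  intro Hd. destruct (Rle_dec 0 T) as [HT|HT].
  - destruct (floor_multiple d T Hd HT) as [n Hn]. exists (S n). intros N HN.
    apply le_INR in HN. rewrite S_INR in HN. nra.
  - exists 0%nat. intros N _. pose proof (pos_INR N). nra.
Qed.

(** * Continuity and integration of complex functions of a real variable *)

Definition ccont (f : R -> C) : Prop :=
  forall t, continuous (fun x => Re (f x)) t /\ continuous (fun x => Im (f x)) t.

Lemma continuous_eps (g : R -> R) t :
  continuous g t <->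
  forall eps, 0 < eps -> exists d, 0 < d /\
    forall s, Rabs (s - t) < d -> Rabs (g s - g t) < eps.
Proof.
  split.
  - intros H eps He.
    apply continuity_pt_filterlim in H.
    destruct (H eps He) as [d [Hd K]]. exists d; split; [exact Hd|].
    intros s Hs.
    destruct (Req_dec s t) as [->|Hst].
    + unfold Rminus; rewrite Rplus_opp_r, Rabs_R0; exact He.
    + apply K; split; [split; [exact I|auto]|exact Hs].
  - intros H. apply continuity_pt_filterlim. intros eps He.
    destruct (H eps He) as [d [Hd K]]. exists d; split; [exact Hd|].
    intros s [_ Hs]; apply K, Hs.
Qed.

Lemma ccont_eps (f : R -> C) :
  ccont f <->
  forall t eps, 0 < eps -> exists d, 0 < d /\
    forall s, Rabs (s - t) < d -> Cmod (f s - f t) < eps.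
Proof.
  split.
  - intros H t eps He. destruct (H t) as [H1 H2].
    rewrite continuous_eps in H1; rewrite continuous_eps in H2.
    destruct (H1 (eps / 2)) as [d1 [D1 K1]]; [lra|].
    destruct (H2 (eps / 2)) as [d2 [D2 K2]]; [lra|].
    exists (Rmin d1 d2); split; [now apply Rmin_pos|].
    intros s Hs. eapply Rle_lt_trans; [apply Cmod_le_sum|].
    assert (Rabs (s - t) < d1) by (eapply Rlt_le_trans; [exact Hs|apply Rmin_l]).
    assert (Rabs (s - t) < d2) by (eapply Rlt_le_trans; [exact Hs|apply Rmin_r]).
    specialize (K1 s H0); specialize (K2 s H3).
    replace (Re (f s - f t)) with (Re (f s) - Re (f t)) by reflexivity.
    replace (Im (f s - f t)) with (Im (f s) - Im (f t)) by reflexivity. lra.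
  - intros H t; split; apply continuous_eps; intros eps He;
      destruct (H t eps He) as [d [Hd K]]; exists d; split; auto; intros s Hs;
      (eapply Rle_lt_trans; [|apply (K s Hs)]).
    + apply (re_le_Cmod (f s - f t)).
    + apply (im_le_Cmod (f s - f t)).
Qed.

Lemma ccont_const c : ccont (fun _ => c).
Proof. intro t; split; apply continuous_const. Qed.

Lemma ccont_plus f g : ccont f -> ccont g -> ccont (fun t => f t + g t)%C.
Proof.
  intros Hf Hg t; destruct (Hf t), (Hg t); split; simpl;
    now apply (continuous_plus (U := R_UniformSpace) (K := R_AbsRing) (V := R_NormedModule)).
Qed.

Lemma ccont_opp f : ccont f -> ccont (fun t => - f t)%C.
Proof.
  intros Hf t; destruct (Hf t); split; simpl;
    now apply (continuous_opp (U := R_UniformSpace) (K := R_AbsRing) (V := R_NormedModule)).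
Qed.

Lemma ccont_minus f g : ccont f -> ccont g -> ccont (fun t => f t - g t)%C.
Proof. intros; apply ccont_plus; auto; now apply ccont_opp. Qed.

Lemma ccont_mult f g : ccont f -> ccont g -> ccont (fun t => f t * g t)%C.
Proof.
  intros Hf Hg t; destruct (Hf t), (Hg t); split; simpl.
  - apply (continuous_minus (U := R_UniformSpace) (K := R_AbsRing) (V := R_NormedModule));
    now apply (continuous_mult (U := R_UniformSpace) (K := R_AbsRing)).
  - apply (continuous_plus (U := R_UniformSpace) (K := R_AbsRing) (V := R_NormedModule));
    now apply (continuous_mult (U := R_UniformSpace) (K := R_AbsRing)).
Qed.

Lemma ccont_lip f k : 0 < k ->
  (forall s t, Cmod (f s - f t) <= k * Rabs (s - t)) -> ccont f.
Proof.
  intros Hk H; apply ccont_eps; intros t eps He. exists (eps / k); split.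
  - now apply Rdiv_lt_0_compat.
  - intros s Hs; eapply Rle_lt_trans; [apply H|].
    apply Rmult_lt_reg_r with (/ k); [now apply Rinv_0_lt_compat|].
    replace (k * Rabs (s - t) * / k) with (Rabs (s - t)) by (field; lra); exact Hs.
Qed.

Lemma ccont_cis nu : ccont (fun t => cis (nu * t)).
Proof.
  apply ccont_lip with (Rabs nu + 1).
  - pose proof (Rabs_pos nu); lra.
  - intros s t; eapply Rle_trans; [apply cis_dist|].
    replace (nu * s - nu * t) with (nu * (s - t)) by ring.
    rewrite Rabs_mult; apply Rmult_le_compat_r; [apply Rabs_pos|lra].
Qed.

Lemma ccont_shift f a : ccont f -> ccont (fun t => f (t + a)).
Proof.
  rewrite !ccont_eps; intros H t eps He.
  destruct (H (t + a) eps He) as [d [Hd K]]; exists d; split; auto.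
  intros s Hs; apply K; replace (s + a - (t + a)) with (s - t) by ring; auto.
Qed.

Definition CI (f : R -> C) (a b : R) : C := @RInt C_R_CompleteNormedModule f a b.

Lemma ccont_ex_RInt f a b : ccont f -> @ex_RInt C_R_NormedModule f a b.
Proof.
  intro H; apply (@ex_RInt_fct_extend_pair R_NormedModule R_NormedModule);
    apply (@ex_RInt_continuous R_CompleteNormedModule); intros t _; apply (H t).
Qed.

(** Integrals are taken in [C] as a real product space, whose norm is built from the two components;
    this makes its integral inequality one about [Cmod]. *)
Lemma norm_C_R z : @norm R_AbsRing C_R_NormedModule z = Cmod z.
Proof.
  destruct z as [x y]; unfold Cmod, norm; simpl; unfold prod_norm; simpl.
  unfold norm; simpl; unfold abs; simpl. f_equal.
  rewrite !Rmult_1_r, <- !Rabs_mult, !Rabs_pos_eq; auto; apply Rle_0_sqr.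
Qed.

Lemma CI_correct f a b : ccont f -> @is_RInt C_R_NormedModule f a b (CI f a b).
Proof. intro H; apply (@RInt_correct C_R_CompleteNormedModule), ccont_ex_RInt, H. Qed.

Lemma CI_unique f a b l : @is_RInt C_R_NormedModule f a b l -> CI f a b = l.
Proof. apply (@is_RInt_unique C_R_CompleteNormedModule). Qed.

Lemma CI_ext f g a b : (forall t, f t = g t) -> CI f a b = CI g a b.
Proof. intros H; f_equal; extensionality t; apply H. Qed.

Lemma CI_plus f g a b : ccont f -> ccont g ->
  CI (fun t => f t + g t)%C a b = (CI f a b + CI g a b)%C.
Proof.
  intros Hf Hg; apply CI_unique.
  apply (@is_RInt_plus C_R_NormedModule); now apply CI_correct.
Qed.

Lemma Re_CI f a b : ccont f -> Re (CI f a b) = RInt (fun t => Re (f t)) a b.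
Proof.
  intro H; symmetry; apply is_RInt_unique.
  apply (@is_RInt_fct_extend_fst R_NormedModule R_NormedModule f a b (CI f a b)).
  now apply CI_correct.
Qed.

(** A complex factor is not a scalar of the real space in which the integral lives, so the two
    components are integrated separately. *)
Lemma CI_scal c f a b : ccont f -> CI (fun t => c * f t)%C a b = (c * CI f a b)%C.
Proof.
  intros Hf.
  assert (H1 : is_RInt (fun t => Re (f t)) a b (Re (CI f a b))).
  { apply (@is_RInt_fct_extend_fst R_NormedModule R_NormedModule f a b (CI f a b)).
    now apply CI_correct. }
  assert (H2 : is_RInt (fun t => Im (f t)) a b (Im (CI f a b))).
  { apply (@is_RInt_fct_extend_snd R_NormedModule R_NormedModule f a b (CI f a b)).
    now apply CI_correct. }
  apply CI_unique.
  apply (@is_RInt_fct_extend_pair R_NormedModule R_NormedModule (fun t => (c * f t)%C) a b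
    (Re c * Re (CI f a b) - Im c * Im (CI f a b))
    (Re c * Im (CI f a b) + Im c * Re (CI f a b))); simpl.
  - apply (@is_RInt_minus R_NormedModule); apply (@is_RInt_scal R_NormedModule); auto.
  - apply (@is_RInt_plus R_NormedModule); apply (@is_RInt_scal R_NormedModule); auto.
Qed.

Lemma CI_opp f a b : ccont f -> CI (fun t => - f t)%C a b = (- CI f a b)%C.
Proof.
  intros H; rewrite (CI_ext _ (fun t => (- (1)) * f t)%C) by (intro; ring).
  rewrite CI_scal by auto; ring.
Qed.

Lemma CI_minus f g a b : ccont f -> ccont g ->
  CI (fun t => f t - g t)%C a b = (CI f a b - CI g a b)%C.
Proof.
  intros Hf Hg; unfold Cminus; rewrite CI_plus, CI_opp; auto; now apply ccont_opp.
Qed.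

Lemma CI_Chasles f a b c : ccont f -> (CI f a b + CI f b c)%C = CI f a c.
Proof.
  intro H; apply (@RInt_Chasles C_R_CompleteNormedModule); now apply ccont_ex_RInt.
Qed.

Lemma CI_const c a b : CI (fun _ => c) a b = (RtoC (b - a) * c)%C.
Proof.
  unfold CI; rewrite (@RInt_const C_R_CompleteNormedModule).
  destruct c as [x y]; unfold scal; simpl; unfold prod_scal, scal, Cmult, RtoC; simpl.
  unfold mult; simpl. f_equal; ring.
Qed.

Lemma CI_point f a : CI f a a = RtoC 0.
Proof. apply (@RInt_point C_R_CompleteNormedModule). Qed.

Lemma CI_bound f a b M : ccont f -> a <= b ->
  (forall t, a <= t <= b -> Cmod (f t) <= M) -> Cmod (CI f a b) <= (b - a) * M.
Proof.
  intros Hf Hab H; rewrite <- norm_C_R.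
  apply (@norm_RInt_le_const C_R_NormedModule f a b).
  - exact Hab.
  - intros t Ht; rewrite norm_C_R; auto.
  - now apply CI_correct.
Qed.

Lemma CI_shift f a b c : ccont f -> CI (fun t => f (t + c)) a b = CI f (a + c) (b + c).
Proof.
  intros Hf; apply CI_unique.
  apply (@is_RInt_ext C_R_NormedModule (fun t => scal 1 (f (1 * t + c)))).
  - intros t _. rewrite Rmult_1_l. apply (@scal_one R_Ring C_R_NormedModule).
  - apply (@is_RInt_comp_lin C_R_NormedModule).
    rewrite !Rmult_1_l; now apply CI_correct.
Qed.

(** * Mean values of almost periodic functions *)

Definition cbounded (B : R) (F : R -> C) : Prop := forall t, Cmod (F t) <= B.

(** [D eps tau] stands for a notion of [tau] being an [eps]-almost period. Keeping the notion
    abstract lets one relation serve several functions at once, as sums and products require. The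
    factor 2 for differences is the triangle inequality. *)
Definition ap_system (D : R -> R -> Prop) : Prop :=
  (forall eps, 0 < eps -> exists l, 0 < l /\
     forall x, exists tau, x <= tau <= x + l /\ D eps tau) /\
  (forall eps t1 t2, D eps t1 -> D eps t2 -> D (2 * eps) (t1 - t2)) /\
  (forall e1 e2 tau, e1 <= e2 -> D e1 tau -> D e2 tau).

(** Almost periodicity of [F] relative to [D]: sufficiently fine members of [D] are almost periods
    of [F]. *)
Definition controls (D : R -> R -> Prop) (F : R -> C) : Prop :=
  forall eps, 0 < eps -> exists eta, 0 < eta /\
    forall tau, D eta tau -> forall t, Cmod (F (t + tau) - F t) <= eps.

Definition periods_of (F : R -> C) (eps tau : R) : Prop :=
  forall t, Cmod (F (t + tau) - F t) <= eps.

Definition add_freq (D : R -> R -> Prop) (nu eps tau : R) : Prop :=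
  D eps tau /\ Cmod (cis (nu * tau) - 1) <= eps.

Lemma periods_of_system F :
  (forall eps, 0 < eps -> exists l, 0 < l /\
     forall x, exists tau, x <= tau <= x + l /\ periods_of F eps tau) ->
  ap_system (periods_of F).
Proof.
  intro H; split; [exact H|]; split.
  2:{ intros e1 e2 tau He Ht t; eapply Rle_trans; [apply Ht|exact He]. }
  intros eps t1 t2 H1 H2 t.
  specialize (H1 (t - t2)); specialize (H2 (t - t2)).
  replace (t - t2 + t1) with (t + (t1 - t2)) in H1 by ring.
  replace (t - t2 + t2) with t in H2 by ring.
  rewrite Cmod_minus_sym in H2.
  pose proof (Cmod_dist_triangle (F (t + (t1 - t2))) (F (t - t2)) (F t)); lra.
Qed.

Lemma controls_periods_of F : controls (periods_of F) F.
Proof. intros eps He; exists eps; split; auto. Qed.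

Lemma grid_cover (a h y : R) (n : nat) : a <= y <= a + INR n * h ->
  exists k, (k <= n)%nat /\ Rabs (y - (a + INR k * h)) <= Rabs h.
Proof.
  induction n as [|n IH]; intros [H1 H2].
  - exists 0%nat; split; auto. simpl in *.
    replace (y - (a + 0 * h)) with 0 by lra. rewrite Rabs_R0; apply Rabs_pos.
  - rewrite S_INR in H2.
    destruct (Rle_dec y (a + INR n * h)) as [H|H].
    + destruct IH as [k [Hk E]]; [lra|]. exists k; split; auto.
    + exists (S n); split; auto. rewrite S_INR.
      unfold Rabs; destruct (Rcase_abs _), (Rcase_abs _); nra.
Qed.

Lemma cis_bounded_arg x : exists y, - PI <= y <= PI /\ cis x = cis y.
Proof.
  assert (S2 : sin (acos (cos x)) = sqrt (1 - Rsqr (cos x)))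
    by (apply sin_acos; apply COS_bound).
  assert (C2 : cos (acos (cos x)) = cos x) by (apply cos_acos; apply COS_bound).
  assert (Sb : sqrt (1 - Rsqr (cos x)) = Rabs (sin x)).
  { rewrite <- sqrt_Rsqr_abs; f_equal. pose proof (sin2_cos2 x); lra. }
  pose proof (acos_bound (cos x)) as Hb.
  destruct (Rle_dec 0 (sin x)) as [Hs|Hs].
  - exists (acos (cos x)); split; [lra|]. unfold cis.
    rewrite C2, S2, Sb, Rabs_pos_eq; auto.
  - exists (- acos (cos x)); split; [lra|]. unfold cis.
    rewrite cos_neg, sin_neg, C2, S2, Sb, Rabs_left by lra. f_equal; ring.
Qed.

Lemma circle_net eps : 0 < eps ->
  exists (n : nat) (c : nat -> C), forall x, exists k, (k <= n)%nat /\
    Cmod (cis x - c k) <= eps.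
Proof.
  intro He. pose proof PI_RGT_0 as Hpi.
  (* [n + 1] exceeds [2 * PI / eps], so the step [h] below is less than [eps]. *)
  destruct (nfloor_ex (2 * PI / eps)) as [n [_ Hn]].
  { apply Rlt_le, Rdiv_lt_0_compat; lra. }
  set (h := 2 * PI / (INR n + 1)).
  assert (Hn0 : 0 <= INR n) by apply pos_INR.
  exists (S n), (fun k => cis (- PI + INR k * h)). intro x.
  destruct (cis_bounded_arg x) as [y [Hy ->]].
  destruct (grid_cover (- PI) h y (S n)) as [k [Hk E]].
  { rewrite S_INR; unfold h; split; [lra|].
    replace (- PI + (INR n + 1) * (2 * PI / (INR n + 1))) with PI by (field; lra); lra. }
  exists k; split; auto. eapply Rle_trans; [apply cis_dist|].
  eapply Rle_trans; [exact E|]. unfold h.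
  rewrite Rabs_pos_eq by (apply Rlt_le, Rdiv_lt_0_compat; lra).
  apply Rmult_le_reg_r with (INR n + 1); [lra|].
  unfold Rdiv; rewrite Rmult_assoc, Rinv_l, Rmult_1_r by lra.
  apply Rmult_le_reg_r with (/ eps); [now apply Rinv_0_lt_compat|].
  replace (eps * (INR n + 1) * / eps) with (INR n + 1) by (field; lra).
  unfold Rdiv in Hn; lra.
Qed.

(** Only finitely many cells occur, so one representative from each nonempty cell can be fixed, and
    these are bounded together. *)
Lemma bounded_witnesses (P : nat -> R -> Prop) (n : nat) :
  exists B, 0 <= B /\ forall k, (k <= n)%nat -> (exists tau, P k tau) ->
    exists tau, P k tau /\ Rabs tau <= B.
Proof.
  assert (Step : forall k, exists B, 0 <= B /\ ((exists tau, P k tau) ->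
    exists tau, P k tau /\ Rabs tau <= B)).
  { intro k. destruct (classic (exists tau, P k tau)) as [[tau H]|H].
    - exists (Rabs tau); split; [apply Rabs_pos|]. intros _; exists tau; split; auto; lra.
    - exists 0; split; [lra|]; tauto. }
  induction n as [|n [B [HB IH]]].
  - destruct (Step 0%nat) as [B [HB H]]; exists B; split; auto.
    intros k Hk; replace k with 0%nat by lia; auto.
  - destruct (Step (S n)) as [B' [HB' H']]. exists (Rmax B B'); split.
    + eapply Rle_trans; [exact HB|apply Rmax_l].
    + intros k Hk Hex. destruct (Nat.eq_dec k (S n)) as [->|Hn].
      * destruct (H' Hex) as [tau [H1 H2]]; exists tau; split; auto.
        eapply Rle_trans; [exact H2|apply Rmax_r].
      * destruct (IH k ltac:(lia) Hex) as [tau [H1 H2]]; exists tau; split; auto.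
        eapply Rle_trans; [exact H2|apply Rmax_l].
Qed.

(* Two almost periods whose characters lie in the same cell of a finite net of the
   circle differ by a common almost period of both. *)
Lemma add_freq_system D nu : ap_system D -> ap_system (add_freq D nu).
Proof.
  intros [HD1 [HD2 HD3]].
  assert (Sub : forall a b, Cmod (cis (nu * (a - b)) - 1)
    = Cmod (cis (nu * a) - cis (nu * b))).
  { intros a b. replace (nu * a) with (nu * b + nu * (a - b)) by ring.
    rewrite (cis_plus (nu * b)).
    replace (cis (nu * b) * cis (nu * (a - b)) - cis (nu * b))%C
      with (cis (nu * b) * (cis (nu * (a - b)) - 1))%C by ring.
    rewrite Cmod_mult, Cmod_cis; ring. }
  split; [|split].
  3:{ intros e1 e2 tau He [H1 H2]; split; [now apply (HD3 e1)|lra]. }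
  - intros eps He.
    destruct (HD1 (eps / 2)) as [l [Hl Hl2]]; [lra|].
    destruct (circle_net (eps / 2)) as [n [c Hc]]; [lra|].
    destruct (bounded_witnesses
      (fun k tau => D (eps / 2) tau /\ Cmod (cis (nu * tau) - c k) <= eps / 2) n)
      as [B [HB HB2]].
    exists (l + 2 * B); split; [lra|]. intro x.
    (* Starting at [x + B] leaves room to subtract a representative of absolute value at most [B]
       and stay inside [[x, x + l + 2 * B]]. *)
    destruct (Hl2 (x + B)) as [tau [Ht Dt]].
    destruct (Hc (nu * tau)) as [k [Hk Ek]].
    destruct (HB2 k Hk) as [tau' [[Dt' Ek'] Ht']]; [now exists tau|].
    apply Rabs_le_between in Ht'.
    exists (tau - tau'); split; [lra|]. split.
    + replace eps with (2 * (eps / 2)) by field; now apply HD2.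
    + rewrite Sub. rewrite Cmod_minus_sym in Ek'.
      pose proof (Cmod_dist_triangle (cis (nu * tau)) (c k) (cis (nu * tau'))); lra.
  - intros eps a b [Ha Ea] [Hb Eb]; split; [auto|].
    rewrite Sub. rewrite Cmod_minus_sym in Eb.
    pose proof (Cmod_dist_triangle (cis (nu * a)) 1 (cis (nu * b))); lra.
Qed.

Lemma controls_add_freq D nu F : controls D F -> controls (add_freq D nu) F.
Proof.
  intros H eps He; destruct (H eps He) as [eta [H1 H2]]; exists eta; split; auto.
  intros tau [Ht _]; auto.
Qed.

Lemma controls_freq D nu : controls (add_freq D nu) (fun t => cis (nu * t)).
Proof.
  intros eps He; exists eps; split; auto. intros tau [_ Ht] t.
  replace (nu * (t + tau)) with (nu * t + nu * tau) by ring. rewrite cis_plus.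
  replace (cis (nu * t) * cis (nu * tau) - cis (nu * t))%C
    with (cis (nu * t) * (cis (nu * tau) - 1))%C by ring.
  rewrite Cmod_mult, Cmod_cis; lra.
Qed.

Lemma controls_mult D A B F G : 
  ap_system D -> cbounded A F -> cbounded B G -> controls D F -> controls D G ->
  controls D (fun t => F t * G t)%C.
Proof.
  intros [_ [_ Hm]] HA HB HF HG eps He.
  assert (A0 : 0 <= A) by (eapply Rle_trans; [apply Cmod_ge_0|apply (HA 0)]).
  assert (B0 : 0 <= B) by (eapply Rle_trans; [apply Cmod_ge_0|apply (HB 0)]).
  set (e := eps / (A + B + 1)).
  assert (He' : 0 < e) by (apply Rdiv_lt_0_compat; lra).
  destruct (HF e He') as [d1 [P1 K1]]; destruct (HG e He') as [d2 [P2 K2]].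
  exists (Rmin d1 d2); split; [now apply Rmin_pos|]. intros tau Ht t.
  assert (E1 := K1 tau (Hm _ _ _ (Rmin_l _ _) Ht) t).
  assert (E2 := K2 tau (Hm _ _ _ (Rmin_r _ _) Ht) t).
  replace (F (t + tau)%R * G (t + tau)%R - F t * G t)%C
    with ((F (t + tau)%R - F t) * G (t + tau)%R + F t * (G (t + tau)%R - G t))%C by ring.
  eapply Rle_trans; [apply Cmod_triangle|]. rewrite !Cmod_mult.
  assert (Cmod (F (t + tau) - F t) * Cmod (G (t + tau)) <= e * B)
    by (apply Rmult_le_compat; auto; apply Cmod_ge_0).
  assert (Cmod (F t) * Cmod (G (t + tau) - G t) <= A * e)
    by (apply Rmult_le_compat; auto; apply Cmod_ge_0).
  assert (eps = e * (A + B + 1)) by (unfold e; field; lra). nra.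
Qed.

Definition win (F : R -> C) (a S : R) : C := CI F a (a + S).
Definition avg (F : R -> C) (a S : R) : C := (RtoC (/ S) * win F a S)%C.

Lemma CI_bound_abs F B a b : ccont F -> cbounded B F -> Cmod (CI F a b) <= B * Rabs (b - a).
Proof.
  intros HF HB. destruct (Rle_dec a b) as [H|H].
  - rewrite Rabs_pos_eq by lra. rewrite Rmult_comm; apply CI_bound; auto.
  - rewrite Rabs_left by lra.
    replace (CI F a b) with (- CI F b a)%C.
    + rewrite Cmod_opp. replace (B * - (b - a)) with ((a - b) * B) by ring.
      apply CI_bound; auto; lra.
    + pose proof (CI_Chasles F a b a HF) as E. rewrite CI_point in E.
      replace (CI F a b) with (CI F a b + CI F b a - CI F b a)%C by ring.
      rewrite E; ring.
Qed.

Section Mean.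
Variables (D : R -> R -> Prop) (F : R -> C) (B : R).
Hypotheses (HD : ap_system D) (Hctl : controls D F) (Hc : ccont F) (HB : cbounded B F).

Lemma bound_nonneg : 0 <= B.
Proof. eapply Rle_trans; [apply Cmod_ge_0|apply (HB 0)]. Qed.

(** An almost period carries the window at [a] to within [l] of the window at [b]. The translation
    costs [eps * S]; the two end pieces cost a constant that does not grow with [S]. *)
Lemma win_shift_close eps : 0 < eps -> exists K, 0 <= K /\
  forall a b S, 0 <= S -> Cmod (win F a S - win F b S) <= eps * S + K.
Proof.
  intro He. destruct (Hctl eps He) as [eta [He' Hp]].
  destruct HD as [HD1 _]. destruct (HD1 eta He') as [l [Hl Hl2]].
  pose proof bound_nonneg as B0.
  exists (2 * (l * B)); split; [nra|]. intros a b S HS.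
  destruct (Hl2 (b - a)) as [tau [Ht Dt]].
  set (c := a + tau).
  assert (E1 : Cmod (win F c S - win F a S) <= S * eps).
  { unfold win, c. replace (a + tau + S) with (a + S + tau) by ring.
    rewrite <- CI_shift by auto. rewrite <- CI_minus by (auto; now apply ccont_shift).
    eapply Rle_trans; [apply CI_bound with (M := eps)|].
    - apply ccont_minus; auto; now apply ccont_shift.
    - lra.
    - intros t _; apply Hp; auto.
    - right; ring. }
  assert (E2 : Cmod (win F c S - win F b S) <= 2 * (l * B)).
  { replace (win F c S - win F b S)%C with (CI F (b + S) (c + S) - CI F b c)%C.
    - eapply Rle_trans; [apply Cmod_triangle_minus|].
      assert (X1 := CI_bound_abs F B (b + S) (c + S) Hc HB).
      assert (X2 := CI_bound_abs F B b c Hc HB).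
      rewrite Rabs_pos_eq in X1 by (unfold c; lra).
      rewrite Rabs_pos_eq in X2 by (unfold c; lra). unfold c in *. nra.
    - unfold win. pose proof (CI_Chasles F b (b + S) (c + S) Hc) as X1.
      pose proof (CI_Chasles F b c (c + S) Hc) as X2. rewrite <- X2 in X1.
      replace (CI F (b + S) (c + S)) with
        (CI F b c + CI F c (c + S) - CI F b (b + S))%C by (rewrite <- X1; ring). ring. }
  pose proof (Cmod_dist_triangle (win F a S) (win F c S) (win F b S)) as E.
  rewrite (Cmod_minus_sym (win F a S) (win F c S)) in E. lra.
Qed.

Lemma win_multiple eps K S : 0 <= S ->
  (forall a b, Cmod (win F a S - win F b S) <= eps * S + K) ->
  forall n a b, Cmod (win F a (INR n * S) - RtoC (INR n) * win F b S)
    <= INR n * (eps * S + K).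
Proof.
  intros HS H n a b. induction n as [|n IH].
  - simpl. unfold win. replace (a + 0 * S) with a by ring. rewrite CI_point.
    replace (0 - 0 * CI F b (b + S))%C with (RtoC 0) by ring. rewrite Cmod_0; lra.
  - rewrite S_INR. unfold win at 1.
    rewrite <- (CI_Chasles F a (a + INR n * S)) by auto.
    replace (a + (INR n + 1) * S) with ((a + INR n * S) + S) by ring.
    change (CI F (a + INR n * S) (a + INR n * S + S)) with (win F (a + INR n * S) S).
    change (CI F a (a + INR n * S)) with (win F a (INR n * S)).
    rewrite RtoC_plus.
    replace (win F a (INR n * S) + win F (a + INR n * S) S - (RtoC (INR n) + 1) * win F b S)%C
      with ((win F a (INR n * S) - RtoC (INR n) * win F b S)
            + (win F (a + INR n * S) S - win F b S))%C by ring.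
    eapply Rle_trans; [apply Cmod_triangle|].
    specialize (H (a + INR n * S) b). lra.
Qed.

(** The long window is tiled by windows of length [S]. The term [2 * S * B / S'] pays for the
    incomplete last tile and for replacing the number of tiles by [S' / S]. *)
Lemma avg_step eps K S S' a b : 0 < S -> S <= S' -> 0 <= eps -> 0 <= K ->
  (forall a b, Cmod (win F a S - win F b S) <= eps * S + K) ->
  Cmod (avg F a S' - avg F b S) <= eps + K / S + 2 * S * B / S'.
Proof.
  intros HS HSS He HK H. pose proof bound_nonneg as B0.
  destruct (floor_multiple S S') as [n [M1 M2]]; [lra|lra|].
  assert (Hn := pos_INR n).
  assert (E1 := win_multiple eps K S (Rlt_le _ _ HS) H n a b).
  assert (E2 : Cmod (win F a S' - win F a (INR n * S)) <= S * B).
  { unfold win. rewrite <- (CI_Chasles F a (a + INR n * S) (a + S')) by auto.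
    replace (CI F a (a + INR n * S) + CI F (a + INR n * S) (a + S')
      - CI F a (a + INR n * S))%C with (CI F (a + INR n * S) (a + S')) by ring.
    eapply Rle_trans; [apply (CI_bound_abs F B); auto|].
    rewrite Rabs_pos_eq by lra. nra. }
  assert (E3 : Cmod (win F b S) <= S * B).
  { unfold win. eapply Rle_trans; [apply (CI_bound_abs F B); auto|].
    rewrite Rabs_pos_eq by lra. right; ring. }
  unfold avg.
  replace (RtoC (/ S') * win F a S' - RtoC (/ S) * win F b S)%C with
    (RtoC (/ S') * ((win F a S' - win F a (INR n * S))
      + (win F a (INR n * S) - RtoC (INR n) * win F b S)
      + RtoC (INR n - S' / S) * win F b S))%C.
  2:{ replace (RtoC (/ S)) with (RtoC (/ S') * RtoC (S' / S))%C
       by (rewrite <- RtoC_mult; f_equal; field; lra).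
      rewrite RtoC_minus. ring. }
  rewrite Cmod_mult, Cmod_R, Rabs_pos_eq by (apply Rlt_le, Rinv_0_lt_compat; lra).
  assert (E4 : Cmod (RtoC (INR n - S' / S) * win F b S) <= S * B).
  { rewrite Cmod_mult, Cmod_R.
    assert (Q : S' / S * S = S') by (field; lra).
    assert (Rabs (INR n - S' / S) <= 1) by (apply Rabs_le; split; nra).
    pose proof (Cmod_ge_0 (win F b S)). pose proof (Rabs_pos (INR n - S' / S)). nra. }
  assert (E5 : Cmod ((win F a S' - win F a (INR n * S))
      + (win F a (INR n * S) - RtoC (INR n) * win F b S)
      + RtoC (INR n - S' / S) * win F b S) <= S * B + INR n * (eps * S + K) + S * B).
  { eapply Rle_trans; [apply Cmod_triangle|]. apply Rplus_le_compat; [|exact E4].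
    eapply Rle_trans; [apply Cmod_triangle|]. lra. }
  apply Rle_trans with (/ S' * (S * B + INR n * (eps * S + K) + S * B)).
  - apply Rmult_le_compat_l; [apply Rlt_le, Rinv_0_lt_compat; lra|exact E5].
  - apply Rmult_le_reg_l with S'; [lra|].
    rewrite <- Rmult_assoc, Rinv_r, Rmult_1_l by lra.
    replace (S' * (eps + K / S + 2 * S * B / S'))
      with (S' * (eps + K / S) + 2 * S * B) by (field; lra).
    assert (INR n * (eps * S + K) <= S' * (eps + K / S)); [|lra].
    replace (INR n * (eps * S + K)) with (INR n * S * (eps + K / S)) by (field; lra).
    apply Rmult_le_compat_r; [|exact M1].
    assert (0 <= K / S) by (apply Rmult_le_pos; [lra|apply Rlt_le, Rinv_0_lt_compat; lra]).
    lra.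
Qed.

Lemma avg_cauchy eps : 0 < eps -> exists S0, 0 < S0 /\
  forall a b S S', S0 <= S -> S0 <= S' -> Cmod (avg F a S - avg F b S') <= eps.
Proof.
  intro He. pose proof bound_nonneg as B0.
  set (e := eps / 6). assert (He' : 0 < e) by (unfold e; lra).
  destruct (win_shift_close e He') as [K [HK H]].
  (* [T] makes [K / T] at most [e], and [S0] below makes [2 * T * B / S] at most [e]. Every long
     average is then within [3 * e] of the reference average [avg F 0 T], and two of them differ by
     at most [6 * e]. *)
  set (T := (K + 1) / e).
  assert (HT : 0 < T) by (apply Rdiv_lt_0_compat; lra).
  assert (KT : K / T <= e).
  { unfold T. replace (K / ((K + 1) / e)) with (e * (K / (K + 1))) by (field; lra).
    assert (K / (K + 1) <= 1); [|nra].
    apply Rmult_le_reg_r with (K + 1); [lra|].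
    unfold Rdiv; rewrite Rmult_assoc, Rinv_l by lra; lra. }
  set (S0 := T + 2 * T * B / e).
  assert (P : 0 <= 2 * T * B / e).
  { apply Rmult_le_pos; [nra|apply Rlt_le, Rinv_0_lt_compat; lra]. }
  exists S0; split; [unfold S0; lra|].
  assert (Key : forall a S, S0 <= S -> Cmod (avg F a S - avg F 0 T) <= 3 * e).
  { intros a S HS.
    assert (HTS : T <= S) by (unfold S0 in HS; lra).
    eapply Rle_trans; [apply avg_step with (eps := e) (K := K); auto; try lra|].
    - intros a' b'. apply H; lra.
    - assert (2 * T * B / S <= e); [|lra].
      apply Rmult_le_reg_r with S; [lra|].
      unfold Rdiv; rewrite Rmult_assoc, Rinv_l, Rmult_1_r by lra.
      assert (2 * T * B = e * (2 * T * B / e)) by (field; lra).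
      unfold S0 in HS. nra. }
  intros a b S S' HS HS'.
  pose proof (Key a S HS). pose proof (Key b S' HS').
  rewrite (Cmod_minus_sym (avg F b S')) in H1.
  pose proof (Cmod_dist_triangle (avg F a S) (avg F 0 T) (avg F b S')).
  unfold e in *; lra.
Qed.

End Mean.

(** The rate is uniform in the position of the window. Symmetric means are the special case
    [a = - T], while recurrence and tiling arguments use arbitrary positions. *)
Definition is_umean (F : R -> C) (m : C) : Prop :=
  forall eps, 0 < eps -> exists S0, 0 < S0 /\
    forall a S, S0 <= S -> Cmod (avg F a S - m) <= eps.

Lemma C_seq_cauchy (u : nat -> C) :
  (forall eps, 0 < eps -> exists N, forall n m, (N <= n)%nat -> (N <= m)%nat ->
     Cmod (u n - u m) <= eps) ->
  exists l, forall eps, 0 < eps -> exists N, forall n, (N <= n)%nat -> Cmod (u n - l) <= eps.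
Proof.
  intro H.
  assert (K : forall g : C -> R, (forall z w, Rabs (g z - g w) <= Cmod (z - w)) ->
    exists l : R, is_lim_seq (fun n => g (u n)) l).
  { intros g Hg.
    apply ex_lim_seq_cauchy_corr. intros [eps He]. 
    destruct (H (eps / 2)) as [N HN]; [lra|]. exists N. intros n m Hn Hm.
    eapply Rle_lt_trans; [apply Hg|]. simpl. specialize (HN n m Hn Hm); lra. }
  destruct (K Re) as [l1 H1].
  { intros z w; apply (re_le_Cmod (z - w)). }
  destruct (K Im) as [l2 H2].
  { intros z w; apply (im_le_Cmod (z - w)). }
  exists (l1, l2). intros eps He.
  apply is_lim_seq_spec in H1; apply is_lim_seq_spec in H2.
  assert (He2 : 0 < eps / 2) by lra.
  destruct (H1 (mkposreal _ He2)) as [N1 K1]; destruct (H2 (mkposreal _ He2)) as [N2 K2].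
  exists (N1 + N2)%nat. intros n Hn.
  specialize (K1 n ltac:(lia)); specialize (K2 n ltac:(lia)). simpl in K1, K2.
  eapply Rle_trans; [apply Cmod_le_sum|].
  replace (Re (u n - (l1, l2))) with (Re (u n) - l1) by reflexivity.
  replace (Im (u n - (l1, l2))) with (Im (u n) - l2) by reflexivity. lra.
Qed.

Lemma umean_exists D F B : ap_system D -> controls D F -> ccont F -> cbounded B F ->
  exists m, is_umean F m.
Proof.
  intros HD Hctl Hc HB.
  destruct (C_seq_cauchy (fun n => avg F 0 (INR n))) as [m Hm].
  - intros eps He. destruct (avg_cauchy D F B HD Hctl Hc HB eps He) as [S0 [HS H]].
    destruct (nfloor_ex S0) as [N [_ HN]]; [lra|].
    exists (S N). intros n p Hn Hp; apply H.
    + apply le_INR in Hn; rewrite S_INR in Hn; lra.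
    + apply le_INR in Hp; rewrite S_INR in Hp; lra.
  - exists m. intros eps He.
    destruct (avg_cauchy D F B HD Hctl Hc HB (eps / 2)) as [S0 [HS H]]; [lra|].
    destruct (Hm (eps / 2)) as [N HN]; [lra|].
    exists S0; split; auto. intros a S HSS.
    destruct (nfloor_ex S0) as [N' [_ HN']]; [lra|].
    specialize (HN (N + Datatypes.S N')%nat ltac:(lia)).
    specialize (H a 0 S (INR (N + Datatypes.S N')) HSS).
    assert (X : S0 <= INR (N + Datatypes.S N')).
    { rewrite plus_INR, S_INR. pose proof (pos_INR N); lra. }
    specialize (H X).
    pose proof (Cmod_dist_triangle (avg F a S) (avg F 0 (INR (N + Datatypes.S N'))) m).
    lra.
Qed.

Lemma umean_ext F G m : (forall t, F t = G t) -> is_umean F m -> is_umean G m.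
Proof. intros H; replace G with F; auto. extensionality t; apply H. Qed.

Lemma Cmod_small_eq (z : C) : (forall eps, 0 < eps -> Cmod z <= eps) -> z = RtoC 0.
Proof.
  intro H. apply Cmod_eq_0. apply Rle_antisym; [|apply Cmod_ge_0].
  apply Rnot_lt_le; intro K. specialize (H (Cmod z / 2) ltac:(lra)); lra.
Qed.

Lemma Cmod_close_eq (z w : C) : (forall eps, 0 < eps -> Cmod (z - w) <= eps) -> z = w.
Proof.
  intro H. apply Cmod_small_eq in H.
  replace z with ((z - w) + w)%C by ring. rewrite H; ring.
Qed.

Lemma umean_unique F m m' : is_umean F m -> is_umean F m' -> m = m'.
Proof.
  intros H H'. apply Cmod_close_eq. intros eps He.
  destruct (H (eps / 2)) as [S1 [P1 K1]]; [lra|].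
  destruct (H' (eps / 2)) as [S2 [P2 K2]]; [lra|].
  specialize (K1 0 (S1 + S2) ltac:(lra)); specialize (K2 0 (S1 + S2) ltac:(lra)).
  rewrite Cmod_minus_sym in K1.
  pose proof (Cmod_dist_triangle m (avg F 0 (S1 + S2)) m'); lra.
Qed.

Lemma avg_plus F G a S : ccont F -> ccont G ->
  avg (fun t => F t + G t)%C a S = (avg F a S + avg G a S)%C.
Proof. intros; unfold avg, win; rewrite CI_plus by auto; ring. Qed.

Lemma avg_scal c F a S : ccont F -> avg (fun t => c * F t)%C a S = (c * avg F a S)%C.
Proof. intros; unfold avg, win; rewrite CI_scal by auto; ring. Qed.

Lemma umean_plus F G m m' : ccont F -> ccont G -> is_umean F m -> is_umean G m' ->
  is_umean (fun t => F t + G t)%C (m + m').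
Proof.
  intros HF HG H H' eps He.
  destruct (H (eps / 2)) as [S1 [P1 K1]]; [lra|].
  destruct (H' (eps / 2)) as [S2 [P2 K2]]; [lra|].
  exists (S1 + S2); split; [lra|]. intros a S HS.
  specialize (K1 a S ltac:(lra)); specialize (K2 a S ltac:(lra)).
  rewrite avg_plus by auto.
  replace (avg F a S + avg G a S - (m + m'))%C with ((avg F a S - m) + (avg G a S - m'))%C by ring.
  eapply Rle_trans; [apply Cmod_triangle|]. lra.
Qed.

Lemma umean_scal c F m : ccont F -> is_umean F m -> is_umean (fun t => c * F t)%C (c * m).
Proof.
  intros HF H eps He. pose proof (Cmod_ge_0 c) as Hc.
  destruct (H (eps / (Cmod c + 1))) as [S0 [P K]]; [apply Rdiv_lt_0_compat; lra|].
  exists S0; split; auto. intros a S HS. specialize (K a S HS).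
  rewrite avg_scal by auto.
  replace (c * avg F a S - c * m)%C with (c * (avg F a S - m))%C by ring. rewrite Cmod_mult.
  assert (E : eps = (Cmod c + 1) * (eps / (Cmod c + 1))) by (field; lra).
  pose proof (Cmod_ge_0 (avg F a S - m)). nra.
Qed.

Lemma avg_bound F B a S : ccont F -> cbounded B F -> 0 < S -> Cmod (avg F a S) <= B.
Proof.
  intros HF HB HS. unfold avg, win.
  rewrite Cmod_mult, Cmod_R, Rabs_pos_eq by (apply Rlt_le, Rinv_0_lt_compat; lra).
  pose proof (CI_bound_abs F B a (a + S) HF HB) as H.
  replace (a + S - a) with S in H by ring. rewrite Rabs_pos_eq in H by lra.
  apply Rmult_le_reg_l with S; [lra|]. rewrite <- Rmult_assoc, Rinv_r by lra. lra.
Qed.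

Lemma umean_const c : is_umean (fun _ => c) c.
Proof.
  intros eps He; exists 1; split; [lra|]. intros a S HS.
  unfold avg, win. rewrite CI_const. replace (a + S - a) with S by ring.
  rewrite Cmult_assoc, <- RtoC_mult, Rinv_l, Cmult_1_l by lra.
  replace (c - c)%C with (RtoC 0) by ring. rewrite Cmod_0; lra.
Qed.

(* A half-period shift changes the sign of [cis (nu t)], so its integrals are bounded. *)
Lemma umean_cis nu : nu <> 0 -> is_umean (fun t => cis (nu * t)) 0.
Proof.
  intros Hnu. set (F := fun t => cis (nu * t)). set (c := PI / nu).
  assert (Hc : ccont F) by apply ccont_cis.
  assert (HB : cbounded 1 F) by (intro t; unfold F; rewrite Cmod_cis; lra).
  assert (Hs : forall t, F (t + c) = (- F t)%C).
  { intro t. unfold F, c. replace (nu * (t + PI / nu)) with (nu * t + PI) by (field; auto).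
    unfold cis, Copp; simpl. now rewrite neg_cos, neg_sin. }
  assert (E : forall a b, Cmod (CI F a b) <= Rabs c).
  { intros a b.
    assert (E1 : CI F (a + c) (b + c) = (- CI F a b)%C).
    { rewrite <- CI_shift by auto. rewrite <- CI_opp by auto. apply CI_ext, Hs. }
    pose proof (CI_Chasles F a (a + c) (b + c) Hc) as X1.
    pose proof (CI_Chasles F a b (b + c) Hc) as X2.
    rewrite <- X2, E1 in X1.
    assert (X : (2 * CI F a b)%C = (CI F a (a + c) - CI F b (b + c))%C).
    { replace (CI F a (a + c)) with ((CI F a (a + c) + - CI F a b) + CI F a b)%C by ring.
      rewrite X1; ring. }
    apply Rmult_le_reg_l with 2; [lra|].
    replace (2 * Cmod (CI F a b)) with (Cmod (2 * CI F a b)).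
    - rewrite X. eapply Rle_trans; [apply Cmod_triangle_minus|].
      pose proof (CI_bound_abs F 1 a (a + c) Hc HB) as Y1.
      pose proof (CI_bound_abs F 1 b (b + c) Hc HB) as Y2.
      replace (a + c - a) with c in Y1 by ring. replace (b + c - b) with c in Y2 by ring. lra.
    - rewrite Cmod_mult, Cmod_R, Rabs_pos_eq; lra. }
  intros eps He. pose proof (Rabs_pos c) as Pc.
  exists ((Rabs c + 1) / eps); split; [apply Rdiv_lt_0_compat; lra|].
  intros a S HS.
  assert (HS0 : 0 < S) by (eapply Rlt_le_trans; [|exact HS]; apply Rdiv_lt_0_compat; lra).
  replace (avg F a S - 0)%C with (avg F a S) by ring. unfold avg.
  rewrite Cmod_mult, Cmod_R, Rabs_pos_eq by (apply Rlt_le, Rinv_0_lt_compat; lra).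
  apply Rmult_le_reg_l with S; [lra|]. rewrite <- Rmult_assoc, Rinv_r, Rmult_1_l by lra.
  eapply Rle_trans; [apply E|].
  assert (Rabs c + 1 = (Rabs c + 1) / eps * eps) by (field; lra). nra.
Qed.

(** * Taylor estimate for the exponential and complex differentiability *)

(** [n] counts the terms, so the degree is below [n] and the remainder has order [n]. *)
Fixpoint exp_poly (n : nat) (w : C) : C :=
  match n with
  | O => RtoC 0
  | S m => (exp_poly m w + RtoC (/ INR (fact m)) * w ^ m)%C
  end.

Lemma is_derive_Re_exp c w t :
  is_derive (fun t => Re (c * Cexp (RtoC t * w))%C) t (Re (c * w * Cexp (RtoC t * w))%C).
Proof.
  destruct c as [a b], w as [x y]. unfold Re, Cmult, Cexp, RtoC, Im, Re; simpl.
  auto_derive; auto.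
  replace (t * x - 0 * y) with (t * x + - (0 * y)) by ring. ring.
Qed.

Lemma is_derive_Re_pow c n t :
  is_derive (fun t => Re (c * RtoC (t ^ n))%C) t (Re (c * RtoC (INR n * t ^ pred n))%C).
Proof.
  destruct c as [a b]. unfold Re, Cmult, RtoC; simpl. auto_derive; auto. ring.
Qed.

Lemma exp_poly_scal n w t :
  exp_poly (S n) (RtoC t * w) =
  (exp_poly n (RtoC t * w) + RtoC (/ INR (fact n)) * w ^ n * RtoC (t ^ n))%C.
Proof. simpl. rewrite Cpow_mult_l, <- RtoC_pow. ring. Qed.

Lemma is_derive_Re_exp_poly c w n t :
  is_derive (fun t => Re (c * exp_poly (S n) (RtoC t * w))%C) t
    (Re (c * w * exp_poly n (RtoC t * w))%C).
Proof.
  induction n as [|n IH].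
  - apply is_derive_ext with (fun _ => Re (c * (0 + RtoC (/ INR (fact 0)) * 1))%C).
    + intro s; simpl; reflexivity.
    + replace (Re (c * w * exp_poly 0 (RtoC t * w))%C) with 0.
      * apply @is_derive_const.
      * change (exp_poly 0 (RtoC t * w)) with (RtoC 0). now rewrite Cmult_0_r.
  - apply is_derive_ext with (fun t => Re (c * exp_poly (S n) (RtoC t * w))%C
      + Re (c * (RtoC (/ INR (fact (S n))) * w ^ (S n)) * RtoC (t ^ (S n)))%C).
    + intro s. rewrite (exp_poly_scal (S n)).
      match goal with |- _ = Re ?z => replace z with
       (c * exp_poly (S n) (RtoC s * w) + c * (RtoC (/ INR (fact (S n))) * w ^ S n) * RtoC (s ^ S n))%C by ring end.
      reflexivity.
    + replace (Re (c * w * exp_poly (S n) (RtoC t * w))%C) with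
       (Re (c * w * exp_poly n (RtoC t * w))%C
        + Re (c * (RtoC (/ INR (fact (S n))) * w ^ S n) * RtoC (INR (S n) * t ^ pred (S n)))%C).
      * apply @is_derive_plus; [exact IH|apply is_derive_Re_pow].
      * rewrite (exp_poly_scal n).
        match goal with |- Re ?u + Re ?v = Re ?z => replace z with (u + v)%C; [reflexivity|] end.
        rewrite Cpow_S, RtoC_mult. simpl pred.
        replace (RtoC (/ INR (fact n))) with (RtoC (/ INR (fact (S n))) * RtoC (INR (S n)))%C.
        -- ring.
        -- rewrite <- RtoC_mult. f_equal. rewrite fact_simpl, mult_INR. field.
           split; [apply INR_fact_neq_0|apply not_0_INR; lia].
Qed.

Lemma nonincreasing_01 (h h' : R -> R) :
  (forall t, is_derive h t (h' t)) -> (forall t, 0 <= t <= 1 -> h' t <= 0) -> h 1 <= h 0.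
Proof.
  intros Hd Hn.
  destruct (MVT_gen h 0 1 h') as [c [Hc E]].
  - intros; apply Hd.
  - intros x _. apply continuity_pt_filterlim. 
    apply (@ex_derive_continuous R_AbsRing R_NormedModule). now exists (h' x).
  - rewrite Rmin_left, Rmax_right in Hc by lra. specialize (Hn c Hc). lra.
Qed.

Lemma Re_mult_le c z : Cmod c = 1 -> Re (c * z)%C <= Cmod z.
Proof.
  intro H. eapply Rle_trans; [apply Rle_abs|]. eapply Rle_trans; [apply re_le_Cmod|].
  rewrite Cmod_mult, H; lra.
Qed.

(** Induction on [n] along the segment from 0 to [w]. After a rotation that makes the remainder at
    [w] real, its difference with [t ^ S n * M] vanishes at 0 and has nonpositive derivative, by the
    bound for [n]. *)
Lemma exp_taylor n w : Cmod (Cexp w - exp_poly n w)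
  <= Cmod w ^ n / INR (fact n) * exp (Cmod w).
Proof.
  revert w. induction n as [|n IH]; intro w.
  - simpl. replace (Cexp w - 0)%C with (Cexp w) by ring. rewrite Cmod_Cexp.
    replace (1 / 1 * exp (Cmod w)) with (exp (Cmod w)) by field.
    destruct (Rle_lt_or_eq_dec (Re w) (Cmod w)) as [H|H].
    + eapply Rle_trans; [apply Rle_abs|apply re_le_Cmod].
    + left; now apply exp_increasing.
    + rewrite H; lra.
  - destruct (Re_align (Cexp w - exp_poly (S n) w)) as [a Ha]. rewrite <- Ha.
    set (M := Cmod w ^ S n / INR (fact (S n)) * exp (Cmod w)).
    pose (h := fun t => Re (cis a * Cexp (RtoC t * w))%C
      - Re (cis a * exp_poly (S n) (RtoC t * w))%C - t ^ S n * M).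
    pose (h' := fun t => Re (cis a * w * Cexp (RtoC t * w))%C
      - Re (cis a * w * exp_poly n (RtoC t * w))%C - INR (S n) * t ^ n * M).
    assert (K : h 1 <= h 0).
    { apply nonincreasing_01 with h'.
      - intro t. unfold h, h'. apply @is_derive_minus; [apply @is_derive_minus|].
        + apply is_derive_Re_exp.
        + apply is_derive_Re_exp_poly.
        + auto_derive; auto. change (match n with O => 1 | S _ => INR n + 1 end) with (INR (S n)). ring.
      - intros t Ht. unfold h'.
        match goal with |- Re ?u - Re ?v - _ <= 0 => replace (Re u - Re v) with
          (Re (cis a * (w * (Cexp (RtoC t * w) - exp_poly n (RtoC t * w))))%C) end.
        2:{ match goal with |- _ = Re ?u - Re ?v => change (Re u - Re v) with (Re (u - v)%C) end.
            f_equal. ring. }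
        pose proof (Re_mult_le (cis a) (w * (Cexp (RtoC t * w) - exp_poly n (RtoC t * w))) (Cmod_cis a)) as E.
        rewrite Cmod_mult in E. specialize (IH (RtoC t * w)%C).
        rewrite Cmod_mult, Cmod_R, Rabs_pos_eq in IH by lra.
        assert (E2 : Cmod w * Cmod (Cexp (RtoC t * w) - exp_poly n (RtoC t * w))
          <= Cmod w * ((t * Cmod w) ^ n / INR (fact n) * exp (Cmod w))).
        { apply Rmult_le_compat_l; [apply Cmod_ge_0|]. eapply Rle_trans; [exact IH|].
          apply Rmult_le_compat_l.
          - apply Rmult_le_pos; [|apply Rlt_le, Rinv_0_lt_compat, INR_fact_lt_0].
            apply pow_le. pose proof (Cmod_ge_0 w); nra.
          - pose proof (Cmod_ge_0 w). destruct (Rle_lt_or_eq_dec (t * Cmod w) (Cmod w)) as [H1|H1].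
            + nra.
            + left; now apply exp_increasing.
            + rewrite H1; lra. }
        assert (E3 : Cmod w * ((t * Cmod w) ^ n / INR (fact n) * exp (Cmod w)) = INR (S n) * t ^ n * M).
        { unfold M. rewrite fact_simpl, mult_INR, Rpow_mult_distr. simpl (Cmod w ^ S n). field.
          split; [apply INR_fact_neq_0|apply not_0_INR; lia]. }
        lra. }
    assert (H0 : h 0 = 0).
    { unfold h.
      assert (X : exp_poly (S n) (RtoC 0 * w) = RtoC 1).
      { replace (RtoC 0 * w)%C with (RtoC 0) by ring. clear.
        induction n as [|n IH].
        - simpl. rewrite Rinv_1. ring.
        - change (exp_poly (S (S n)) 0) with
            (exp_poly (S n) 0 + RtoC (/ INR (fact (S n))) * 0 ^ (S n))%C.
          rewrite IH, Cpow_S. ring. }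
      rewrite X. replace (RtoC 0 * w)%C with (RtoC 0) by ring.
      replace (Cexp 0) with (RtoC 1).
      - simpl. ring.
      - unfold Cexp, RtoC, Re, Im; simpl. rewrite exp_0, cos_0, sin_0. f_equal; ring. }
    assert (H1 : h 1 = Re (cis a * (Cexp w - exp_poly (S n) w))%C - M).
    { unfold h. rewrite pow1, !Cmult_1_l.
      match goal with |- Re ?u - Re ?v - _ = Re ?z - _ => replace z with (u - v)%C by ring end.
      unfold Re; simpl. ring. }
    lra.
Qed.

(** Differentiability relative to [A], so that it also applies on a closed strip to functions that
    have been cut off outside it. *)
Definition cdiff (A : C -> Prop) (g : C -> C) (p : C) : Prop :=
  exists d, forall eps, 0 < eps -> exists delta, 0 < delta /\
    forall s, A s -> Cmod (s - p) < delta ->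
      Cmod (g s - g p - d * (s - p)) <= eps * Cmod (s - p).

Lemma cdiff_of_ex_derive A g p : @ex_derive C_AbsRing C_NormedModule g p -> cdiff A g p.
Proof.
  intros [d [_ H]]. exists d. intros eps He.
  specialize (H p (fun P H => H)). specialize (H (mkposreal _ He)).
  destruct H as [delta H]. exists delta. split; [apply cond_pos|].
  intros s _ Hs.
  assert (E : Cmod (minus (minus (g s) (g p)) (scal (minus s p) d)) <= eps * Cmod (minus s p)).
  { apply H. exact Hs. }
  replace (g s - g p - d * (s - p))%C with (minus (minus (g s) (g p)) (scal (minus s p) d)).
  - exact E.
  - unfold minus, plus, opp, scal, mult; simpl. unfold mult; simpl. ring.
Qed.

Lemma cdiff_continuous A g p : cdiff A g p -> forall eps, 0 < eps -> exists delta, 0 < delta /\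
  forall s, A s -> Cmod (s - p) < delta -> Cmod (g s - g p) < eps.
Proof.
  intros [d H] eps He. destruct (H 1 Rlt_0_1) as [d1 [D1 K]].
  pose proof (Cmod_ge_0 d) as Pd.
  assert (Hq : 0 < eps / (Cmod d + 1)) by (apply Rdiv_lt_0_compat; lra).
  exists (Rmin d1 (eps / (Cmod d + 1))). split; [now apply Rmin_pos|].
  intros s As Hs.
  assert (H1 : Cmod (s - p) < d1) by (eapply Rlt_le_trans; [exact Hs|apply Rmin_l]).
  assert (H2 : Cmod (s - p) < eps / (Cmod d + 1)) by (eapply Rlt_le_trans; [exact Hs|apply Rmin_r]).
  specialize (K s As H1).
  replace (g s - g p)%C with ((g s - g p - d * (s - p)) + d * (s - p))%C by ring.
  eapply Rle_lt_trans; [apply Cmod_triangle|]. rewrite Cmod_mult.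
  assert (E : (Cmod d + 1) * (eps / (Cmod d + 1)) = eps) by (field; lra). nra.
Qed.

Lemma cdiff_mult A g h p : cdiff A g p -> cdiff A h p -> cdiff A (fun s => g s * h s)%C p.
Proof.
  intros Hg Hh. pose proof (cdiff_continuous A h p Hh) as Ch.
  destruct Hg as [d Hg]. destruct Hh as [e Hh].
  exists (d * h p + g p * e)%C. intros eps He.
  set (K := Cmod (h p) + 1 + Cmod (g p) + Cmod d).
  assert (HK : 0 < K) by (unfold K; pose proof (Cmod_ge_0 (h p)); pose proof (Cmod_ge_0 (g p)); pose proof (Cmod_ge_0 d); lra).
  set (q := eps / K). assert (Hq : 0 < q) by (now apply Rdiv_lt_0_compat).
  set (q1 := Rmin q 1). assert (Hq1 : 0 < q1) by (apply Rmin_pos; lra).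
  destruct (Hg q Hq) as [d1 [P1 K1]]. destruct (Hh q Hq) as [d2 [P2 K2]].
  destruct (Ch q1 Hq1) as [d3 [P3 K3]].
  exists (Rmin d1 (Rmin d2 d3)). split; [now repeat apply Rmin_pos|].
  intros s As Hs.
  assert (H1 : Cmod (s - p) < d1) by (eapply Rlt_le_trans; [exact Hs|apply Rmin_l]).
  assert (H2 : Cmod (s - p) < d2) by (eapply Rlt_le_trans; [exact Hs|eapply Rle_trans; [apply Rmin_r|apply Rmin_l]]).
  assert (H3 : Cmod (s - p) < d3) by (eapply Rlt_le_trans; [exact Hs|eapply Rle_trans; [apply Rmin_r|apply Rmin_r]]).
  specialize (K1 s As H1). specialize (K2 s As H2). specialize (K3 s As H3).
  assert (Q1 : Cmod (h s - h p) <= q) by (eapply Rle_trans; [left; exact K3|apply Rmin_l]).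
  assert (Q2 : Cmod (h s) <= Cmod (h p) + 1).
  { eapply Rle_trans; [apply (Cmod_le_sub _ (h p))|].
    assert (q1 <= 1) by apply Rmin_r. lra. }
  replace (g s * h s - g p * h p - (d * h p + g p * e) * (s - p))%C with
    ((g s - g p - d * (s - p)) * h s + g p * (h s - h p - e * (s - p))
     + d * (s - p) * (h s - h p))%C by ring.
  set (r := Cmod (s - p)) in *. assert (Pr : 0 <= r) by apply Cmod_ge_0.
  eapply Rle_trans; [apply Cmod_triangle|].
  eapply Rle_trans; [apply Rplus_le_compat_r, Cmod_triangle|]. rewrite !Cmod_mult. fold r.
  assert (Cmod (g s - g p - d * (s - p)) * Cmod (h s) <= (q * r) * (Cmod (h p) + 1))
    by (apply Rmult_le_compat; auto; apply Cmod_ge_0).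
  assert (Cmod (g p) * Cmod (h s - h p - e * (s - p)) <= Cmod (g p) * (q * r))
    by (apply Rmult_le_compat_l; auto; apply Cmod_ge_0).
  assert (Cmod d * r * Cmod (h s - h p) <= Cmod d * r * q)
    by (apply Rmult_le_compat_l; auto; apply Rmult_le_pos; auto; apply Cmod_ge_0).
  replace eps with (q * K) by (unfold q; field; lra). unfold K. nra.
Qed.

Lemma cdiff_Cexp_scal A c p : cdiff A (fun s => Cexp (c * s)) p.
Proof.
  exists (Cexp (c * p) * c)%C. intros eps He.
  set (M := exp (Re (c * p)%C) * (Cmod c * Cmod c) * exp (Cmod c) + 1).
  assert (HM0 : 0 <= exp (Re (c * p)%C) * (Cmod c * Cmod c) * exp (Cmod c)).
  { pose proof (exp_pos (Re (c * p)%C)). pose proof (exp_pos (Cmod c)). pose proof (Cmod_ge_0 c).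
    apply Rmult_le_pos; [apply Rmult_le_pos; nra|lra]. }
  (* [Cmod w < 1] bounds [exp (Cmod c * Cmod w)] by [exp (Cmod c)], so the second-order remainder is
     at most [M * Cmod w ^ 2]; the other bound turns one factor into [eps]. *)
  exists (Rmin 1 (eps / M)). split.
  { apply Rmin_pos; [lra|apply Rdiv_lt_0_compat; unfold M; lra]. }
  intros s _ Hs. set (w := (s - p)%C) in *.
  assert (H1 : Cmod w < 1) by (eapply Rlt_le_trans; [exact Hs|apply Rmin_l]).
  assert (H2 : Cmod w < eps / M) by (eapply Rlt_le_trans; [exact Hs|apply Rmin_r]).
  replace (c * s)%C with (c * p + c * w)%C by (unfold w; ring). rewrite Cexp_plus.
  replace (Cexp (c * p) * Cexp (c * w) - Cexp (c * p) - Cexp (c * p) * c * w)%C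
    with (Cexp (c * p) * (Cexp (c * w) - exp_poly 2 (c * w)))%C.
  2:{ simpl. rewrite Rinv_1. ring. }
  rewrite Cmod_mult, Cmod_Cexp.
  pose proof (exp_taylor 2 (c * w)) as T. rewrite Cmod_mult in T.
  pose proof (Cmod_ge_0 c) as Pc. pose proof (Cmod_ge_0 w) as Pw.
  assert (Ex : exp (Cmod c * Cmod w) <= exp (Cmod c)).
  { destruct (Rle_lt_or_eq_dec (Cmod c * Cmod w) (Cmod c)) as [X|X]; [nra| |rewrite X; lra].
    left; now apply exp_increasing. }
  assert (T2 : Cmod (Cexp (c * w) - exp_poly 2 (c * w)) <= (Cmod c * Cmod c) * exp (Cmod c) * (Cmod w * Cmod w)).
  { eapply Rle_trans; [exact T|]. simpl.
    replace (Cmod c * Cmod w * (Cmod c * Cmod w * 1) / (1 + 1) * exp (Cmod c * Cmod w))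
      with ((Cmod c * Cmod c * (Cmod w * Cmod w)) * (/ 2 * exp (Cmod c * Cmod w))) by field.
    replace (Cmod c * Cmod c * exp (Cmod c) * (Cmod w * Cmod w))
      with ((Cmod c * Cmod c * (Cmod w * Cmod w)) * exp (Cmod c)) by ring.
    apply Rmult_le_compat_l; [apply Rmult_le_pos; nra|].
    pose proof (exp_pos (Cmod c * Cmod w)). lra. }
  assert (T3 : exp (Re (c * p)%C) * Cmod (Cexp (c * w) - exp_poly 2 (c * w)) <= M * (Cmod w * Cmod w)).
  { pose proof (exp_pos (Re (c * p)%C)).
    apply Rle_trans with (exp (Re (c * p)%C) * ((Cmod c * Cmod c) * exp (Cmod c) * (Cmod w * Cmod w))).
    - apply Rmult_le_compat_l; lra.
    - unfold M. nra. }
  eapply Rle_trans; [exact T3|].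
  assert (M * Cmod w <= eps); [|nra].
  assert (Y : M * (eps / M) = eps) by (field; unfold M; lra).
  assert (0 < M) by (unfold M; lra). nra.
Qed.

(** * Goursat's theorem on rectangles *)

(** Continuity along horizontals and verticals is what the side integrals of rectangles use. *)
Definition lines_cont (G : C -> C) : Prop :=
  (forall b, ccont (fun x => G (x, b))) /\ (forall a, ccont (fun y => G (a, y))).

(** The contour integral of [G] counterclockwise around the rectangle with lower left corner
    [(a, b)] and sides [h] and [k]. *)
Definition rect (G : C -> C) (a b h k : R) : C :=
  (CI (fun x => G (x, b)) a (a + h) + Ci * CI (fun y => G (a + h, y)%R) b (b + k)
   - CI (fun x => G (x, b + k)%R) a (a + h) - Ci * CI (fun y => G (a, y)) b (b + k))%C.

Lemma rect_split G a b h k : lines_cont G ->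
  rect G a b (2 * h) (2 * k) =
  (rect G a b h k + rect G (a + h) b h k + rect G a (b + k) h k
   + rect G (a + h) (b + k) h k)%C.
Proof.
  intros [HX HY]. unfold rect.
  replace (a + 2 * h) with (a + h + h) by ring. replace (b + 2 * k) with (b + k + k) by ring.
  rewrite <- (CI_Chasles (fun x => G (x, b)) a (a + h) (a + h + h)) by apply HX.
  rewrite <- (CI_Chasles (fun x => G (x, b + k + k)) a (a + h) (a + h + h)) by apply HX.
  rewrite <- (CI_Chasles (fun y => G (a, y)) b (b + k) (b + k + k)) by apply HY.
  rewrite <- (CI_Chasles (fun y => G (a + h + h, y)) b (b + k) (b + k + k)) by apply HY.
  ring.
Qed.

Lemma rect_bound G a b h k M : lines_cont G -> 0 <= h -> 0 <= k ->
  (forall x y, a <= x <= a + h -> b <= y <= b + k -> Cmod (G (x, y)) <= M) ->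
  Cmod (rect G a b h k) <= 2 * (h + k) * M.
Proof.
  intros [HX HY] Hh Hk H. unfold rect.
  assert (E1 : Cmod (CI (fun x => G (x, b)) a (a + h)) <= (a + h - a) * M)
    by (apply CI_bound; auto; try lra; intros; apply H; lra).
  assert (E2 : Cmod (CI (fun y => G (a + h, y)) b (b + k)) <= (b + k - b) * M)
    by (apply CI_bound; auto; try lra; intros; apply H; lra).
  assert (E3 : Cmod (CI (fun x => G (x, b + k)) a (a + h)) <= (a + h - a) * M)
    by (apply CI_bound; auto; try lra; intros; apply H; lra).
  assert (E4 : Cmod (CI (fun y => G (a, y)) b (b + k)) <= (b + k - b) * M)
    by (apply CI_bound; auto; try lra; intros; apply H; lra).
  eapply Rle_trans; [apply Cmod_triangle_minus|].
  eapply Rle_trans; [apply Rplus_le_compat_r, Cmod_triangle_minus|].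
  eapply Rle_trans; [apply Rplus_le_compat_r, Rplus_le_compat_r, Cmod_triangle|].
  rewrite !Cmod_mult, Cmod_Ci. lra.
Qed.

Lemma ccont_id : ccont (fun t => RtoC t).
Proof.
  apply ccont_lip with 1; [lra|]. intros s t.
  rewrite <- RtoC_minus, Cmod_R; lra.
Qed.

Lemma CI_id a b : CI (fun t => RtoC t) a b = RtoC ((b * b - a * a) / 2).
Proof.
  assert (H : is_RInt (fun t => t) a b ((b * b - a * a) / 2)).
  { replace ((b * b - a * a) / 2) with (minus (b * b / 2) (a * a / 2))
      by (unfold minus, plus, opp; simpl; field).
    apply (@is_RInt_derive R_CompleteNormedModule (fun t => t * t / 2) (fun t => t)).
    - intros x _. auto_derive; auto. field.
    - intros x _. apply continuous_id. }
  apply CI_unique.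
  apply (@is_RInt_fct_extend_pair R_NormedModule R_NormedModule (fun t => RtoC t)).
  - exact H.
  - pose proof (@is_RInt_const R_NormedModule a b 0) as K.
    replace (scal (b - a) (0 : R_NormedModule)) with 0 in K; [exact K|].
    unfold scal; simpl; unfold mult; simpl; ring.
Qed.

Lemma CI_affine c d a b :
  CI (fun t => c + d * RtoC t)%C a b = (RtoC (b - a) * c + d * RtoC ((b * b - a * a) / 2))%C.
Proof.
  rewrite CI_plus, CI_const, CI_scal, CI_id; auto using ccont_id, ccont_const.
  apply ccont_mult; auto using ccont_id, ccont_const.
Qed.

Lemma affine_x c d p y x : (c + d * ((x, y) - p))%C = (c + d * (Ci * RtoC y - p) + d * RtoC x)%C.
Proof.
  replace ((x, y) : C) with (RtoC x + Ci * RtoC y)%C; [ring|].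
  unfold Cplus, Cmult, Ci, RtoC; simpl; f_equal; ring.
Qed.

Lemma affine_y c d p y x : (c + d * ((x, y) - p))%C = (c + d * (RtoC x - p) + d * Ci * RtoC y)%C.
Proof.
  replace ((x, y) : C) with (RtoC x + Ci * RtoC y)%C; [ring|].
  unfold Cplus, Cmult, Ci, RtoC; simpl; f_equal; ring.
Qed.

Lemma affine_lines c d p : lines_cont (fun s => c + d * (s - p))%C.
Proof.
  split; intro u.
  - replace (fun x => c + d * ((x, u) - p))%C with (fun x => c + d * (Ci * RtoC u - p) + d * RtoC x)%C
      by (extensionality x; symmetry; apply affine_x).
    apply ccont_plus; [apply ccont_const|apply ccont_mult; [apply ccont_const|apply ccont_id]].
  - replace (fun y => c + d * ((u, y) - p))%C with (fun y => c + d * (RtoC u - p) + d * Ci * RtoC y)%C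
      by (extensionality y; symmetry; apply affine_y).
    apply ccont_plus; [apply ccont_const|apply ccont_mult; [apply ccont_const|apply ccont_id]].
Qed.

(** Cauchy's theorem for affine functions, by explicit integration. It allows the first-order part
    of [G] at a point to be removed from a contour integral. *)
Lemma rect_affine c d p a b h k : rect (fun s => c + d * (s - p))%C a b h k = RtoC 0.
Proof.
  unfold rect.
  rewrite (CI_ext (fun x => c + d * ((x, b) - p))%C _ a (a + h) (affine_x c d p b)).
  rewrite (CI_ext (fun x => c + d * ((x, b + k)%R - p))%C _ a (a + h) (affine_x c d p (b + k))).
  rewrite (CI_ext (fun y => c + d * ((a, y) - p))%C _ b (b + k) (fun y => affine_y c d p y a)).
  rewrite (CI_ext (fun y => c + d * ((a + h, y)%R - p))%C _ b (b + k) (fun y => affine_y c d p y (a + h))).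
  rewrite !CI_affine.
  replace (a + h - a) with h by ring. replace (b + k - b) with k by ring.
  rewrite !RtoC_plus.
  ring.
Qed.

Lemma rect_minus F G a b h k : lines_cont F -> lines_cont G ->
  rect (fun s => F s - G s)%C a b h k = (rect F a b h k - rect G a b h k)%C.
Proof.
  intros [F1 F2] [G1 G2]. unfold rect.
  rewrite (CI_minus (fun x => F (x, b)) (fun x => G (x, b))) by auto.
  rewrite (CI_minus (fun x => F (x, b + k)) (fun x => G (x, b + k))) by auto.
  rewrite (CI_minus (fun y => F (a, y)) (fun y => G (a, y))) by auto.
  rewrite (CI_minus (fun y => F (a + h, y)) (fun y => G (a + h, y))) by auto.
  ring.
Qed.

Lemma dependent_choice {A : Type} (P : nat -> A -> Prop) (Rel : nat -> A -> A -> Prop) (x0 : A) :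
  P O x0 -> (forall n x, P n x -> exists y, P (S n) y /\ Rel n x y) ->
  exists u : nat -> A, u O = x0 /\ forall n, P n (u n) /\ Rel n (u n) (u (S n)).
Proof.
  intros H0 HS.
  pose (next := fun n x => epsilon (inhabits x0) (fun y => P (S n) y /\ Rel n x y)).
  pose (u := fix u n := match n with O => x0 | S m => next m (u m) end).
  assert (K : forall n, P n (u n)).
  { induction n as [|n IH]; [exact H0|].
    apply (epsilon_spec (inhabits x0) (fun y => P (S n) y /\ Rel n (u n) y) (HS n _ IH)). }
  exists u; split; auto. intro n; split; auto.
  apply (epsilon_spec (inhabits x0) (fun y => P (S n) y /\ Rel n (u n) y) (HS n _ (K n))).
Qed.

Lemma nested_limit (a : nat -> R) (h : R) : 0 < h ->
  (forall n, a n <= a (S n) /\ a (S n) + h / 2 ^ (S n) <= a n + h / 2 ^ n) ->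
  exists p, forall n, a n <= p <= a n + h / 2 ^ n.
Proof.
  intros Hh H.
  assert (Pos : forall n, 0 < h / 2 ^ n).
  { intro n. apply Rdiv_lt_0_compat; auto. apply pow_lt; lra. }
  assert (Inc : forall n k, a n <= a (n + k)%nat).
  { intros n k; induction k as [|k IH]; [rewrite Nat.add_0_r; lra|].
    rewrite Nat.add_succ_r. destruct (H (n + k)%nat); lra. }
  assert (Dec : forall n k, a (n + k)%nat + h / 2 ^ (n + k) <= a n + h / 2 ^ n).
  { intros n k; induction k as [|k IH]; [rewrite Nat.add_0_r; lra|].
    rewrite Nat.add_succ_r. destruct (H (n + k)%nat); lra. }
  assert (Cross : forall n m, a m <= a n + h / 2 ^ n).
  { intros n m. destruct (Nat.le_ge_cases n m) as [L|L].
    - replace m with (n + (m - n))%nat by lia.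
      specialize (Dec n (m - n)%nat). specialize (Pos (n + (m - n))%nat). lra.
    - specialize (Inc m (n - m)%nat). replace (m + (n - m))%nat with n in Inc by lia.
      specialize (Pos n). lra. }
  destruct (completeness (fun x => exists n, x = a n)) as [p [U L]].
  - exists (a 0%nat + h / 2 ^ 0). intros x [n ->]. apply Cross.
  - exists (a 0%nat), 0%nat; auto.
  - exists p. intro n; split.
    + apply U; now exists n.
    + apply L. intros x [m ->]. apply Cross.
Qed.

Section Goursat.
Variables (G : C -> C) (s1 s2 : R).
Hypothesis HG : lines_cont G.
Hypothesis HD : forall p, s1 <= Re p <= s2 -> cdiff (fun s => s1 <= Re s <= s2) G p.

(** Repeated quartering: some quarter keeps at least a fourth of the integral. At the common point
    of the nested rectangles differentiability makes the [n]-th integral small compared with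
    [4 ^ n]. *)
Lemma goursat a b h k : 0 < h -> 0 < k -> s1 <= a -> a + h <= s2 -> rect G a b h k = RtoC 0.
Proof.
  intros Hh Hk Ha Hb.
  pose (hh := fun n => h / 2 ^ n). pose (kk := fun n => k / 2 ^ n).
  assert (P2 : forall n, 0 < 2 ^ n) by (intro; apply pow_lt; lra).
  assert (Hhh : forall n, hh n = 2 * hh (S n)).
  { intro n; unfold hh; simpl. specialize (P2 n). field. lra. }
  assert (Hkk : forall n, kk n = 2 * kk (S n)).
  { intro n; unfold kk; simpl. specialize (P2 n). field. lra. }
  assert (Ph : forall n, 0 < hh n) by (intro; now apply Rdiv_lt_0_compat).
  assert (Pk : forall n, 0 < kk n) by (intro; now apply Rdiv_lt_0_compat).
  set (I0 := Cmod (rect G a b h k)).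
  (* The state is the lower left corner of the current rectangle; its sides are determined by the
     number of halvings. *)
  destruct (dependent_choice (A := R * R)
    (fun n q => I0 <= 4 ^ n * Cmod (rect G (fst q) (snd q) (hh n) (kk n)))
    (fun n q q' => (fst q <= fst q' /\ fst q' + hh (S n) <= fst q + hh n)
       /\ (snd q <= snd q' /\ snd q' + kk (S n) <= snd q + kk n)) (a, b))
    as [u [U0 U]].
  - simpl. unfold hh, kk. simpl. unfold Rdiv. rewrite Rinv_1, !Rmult_1_r. unfold I0; lra.
  - intros n [x y] Hn. simpl in Hn.
    set (h' := hh (S n)) in *. set (k' := kk (S n)) in *.
    assert (E : Cmod (rect G x y (hh n) (kk n)) <= Cmod (rect G x y h' k')
      + Cmod (rect G (x + h') y h' k') + Cmod (rect G x (y + k') h' k')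
      + Cmod (rect G (x + h') (y + k') h' k')).
    { rewrite Hhh, Hkk. fold h' k'. rewrite rect_split by exact HG.
      eapply Rle_trans; [apply Cmod_triangle|]. apply Rplus_le_compat_r.
      eapply Rle_trans; [apply Cmod_triangle|]. apply Rplus_le_compat_r. apply Cmod_triangle. }
    assert (P4 : 0 < 4 ^ n) by (apply pow_lt; lra).
    assert (Ehh : hh n = 2 * h') by apply Hhh. assert (Ekk : kk n = 2 * k') by apply Hkk.
    assert (Qh : 0 < h') by apply Ph. assert (Qk : 0 < k') by apply Pk.
    set (r := Cmod (rect G x y (hh n) (kk n))) in *.
    assert (Pick : forall q : R * R, r <= 4 * Cmod (rect G (fst q) (snd q) h' k') ->
      I0 <= 4 ^ S n * Cmod (rect G (fst q) (snd q) h' k')).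
    { intros q Hq. simpl. nra. }
    destruct (Rle_dec r (4 * Cmod (rect G x y h' k'))) as [C1|C1].
    { exists (x, y); split; [now apply (Pick (x, y))|simpl; lra]. }
    destruct (Rle_dec r (4 * Cmod (rect G (x + h') y h' k'))) as [C2|C2].
    { exists (x + h', y); split; [now apply (Pick (x + h', y))|simpl; lra]. }
    destruct (Rle_dec r (4 * Cmod (rect G x (y + k') h' k'))) as [C3|C3].
    { exists (x, y + k'); split; [now apply (Pick (x, y + k'))|simpl; lra]. }
    exists (x + h', y + k'); split; [apply (Pick (x + h', y + k')); simpl; lra|simpl; lra].
  - destruct (nested_limit (fun n => fst (u n)) h Hh) as [px Hx]; [intro n; apply (U n)|].
    destruct (nested_limit (fun n => snd (u n)) k Hk) as [py Hy]; [intro n; apply (U n)|].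
    assert (A0 : a <= px <= a + h).
    { specialize (Hx 0%nat). rewrite U0 in Hx. simpl in Hx. unfold Rdiv in Hx.
      rewrite Rinv_1, Rmult_1_r in Hx. exact Hx. }
    assert (An : forall n, a <= fst (u n) /\ fst (u n) + hh n <= a + h).
    { induction n as [|n [I1 I2]].
      - rewrite U0. unfold hh; simpl. unfold Rdiv; rewrite Rinv_1; lra.
      - destruct (U n) as [_ [[V1 V2] _]]. lra. }
    destruct (HD (px, py)) as [d Hd]; [unfold Re; simpl; lra|].
    apply Cmod_small_eq. intros eps He.
    set (L := h + k). assert (HL : 0 < L) by (unfold L; lra).
    (* With sides summing to [L / 2 ^ n], this tolerance makes the final product of [4 ^ n],
       perimeter and remainder equal to [eps]. *)
    destruct (Hd (eps / (2 * L * L))) as [delta [Dp Dd]].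
    { apply Rdiv_lt_0_compat; auto. nra. }
    destruct (pow_lt_1_zero (/ 2) ltac:(rewrite Rabs_pos_eq; lra) (delta / L)
      ltac:(now apply Rdiv_lt_0_compat)) as [n Hn].
    specialize (Hn n (Nat.le_refl _)).
    rewrite Rabs_pos_eq in Hn by (apply pow_le; lra). rewrite pow_inv in Hn.
    assert (Small : hh n + kk n < delta).
    { unfold hh, kk. replace (h / 2 ^ n + k / 2 ^ n) with (L * / 2 ^ n) by (unfold L; field; specialize (P2 n); lra).
      replace delta with (L * (delta / L)) by (field; lra). now apply Rmult_lt_compat_l. }
    set (T := fun s => (G (px, py) + d * (s - (px, py)))%C).
    destruct (U n) as [V _]. set (x := fst (u n)) in *. set (y := snd (u n)) in *.
    assert (R1 : rect G x y (hh n) (kk n) = rect (fun s => G s - T s)%C x y (hh n) (kk n)).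
    { rewrite rect_minus; auto; [|apply affine_lines].
      unfold T; rewrite rect_affine. ring. }
    assert (R2 : Cmod (rect G x y (hh n) (kk n))
      <= 2 * (hh n + kk n) * (eps / (2 * L * L) * (hh n + kk n))).
    { rewrite R1. apply rect_bound.
      - destruct HG as [G1 G2]. destruct (affine_lines (G (px, py)) d (px, py)) as [T1 T2].
        split; intro; apply ccont_minus; auto; [apply T1|apply T2].
      - left; apply Ph.
      - left; apply Pk.
      - intros x' y' Hx' Hy'.
        specialize (Hx n). specialize (Hy n). specialize (An n). fold x in Hx, An. fold y in Hy.
        fold (hh n) in Hx. fold (kk n) in Hy.
        assert (Dist : Cmod ((x', y') - (px, py)) <= hh n + kk n).
        { eapply Rle_trans; [apply Cmod_le_sum|].
          replace (Re ((x', y') - (px, py))) with (x' - px) by reflexivity.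
          replace (Im ((x', y') - (px, py))) with (y' - py) by reflexivity.
          apply Rplus_le_compat; apply Rabs_le; lra. }
        unfold T.
        replace (G (x', y') - (G (px, py) + d * ((x', y') - (px, py))))%C
          with (G (x', y') - G (px, py) - d * ((x', y') - (px, py)))%C by ring.
        eapply Rle_trans; [apply Dd|].
        + unfold Re; simpl; lra.
        + eapply Rle_lt_trans; [exact Dist|exact Small].
        + apply Rmult_le_compat_l; [|exact Dist].
          apply Rlt_le, Rdiv_lt_0_compat; nra. }
    fold I0. eapply Rle_trans; [exact V|].
    apply Rle_trans with (4 ^ n * (2 * (hh n + kk n) * (eps / (2 * L * L) * (hh n + kk n)))).
    + apply Rmult_le_compat_l; [apply pow_le; lra|exact R2].
    + right. unfold hh, kk. replace (h / 2 ^ n + k / 2 ^ n) with (L / 2 ^ n)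
        by (unfold L; field; specialize (P2 n); lra).
      replace 4 with (2 * 2) by ring. rewrite Rpow_mult_distr. specialize (P2 n). field. split; lra.
Qed.

End Goursat.

(** The compactness principle only provides a positive lower bound for a gauge. The gauge is
    therefore chosen with [d * (Rabs (g x y) + 1) <= 1], so that this lower bound also bounds the
    values of [g]. *)
Lemma bounded_on_rectangle (g : R -> R -> R) a b a' b' :
  (forall x y, a <= x <= b -> a' <= y <= b' -> exists d, 0 < d /\ forall x' y',
     a <= x' <= b -> Rabs (x' - x) < d -> Rabs (y' - y) < d -> g x' y' <= g x y + 1) ->
  exists M, forall x y, a <= x <= b -> a' <= y <= b' -> g x y <= M.
Proof.
  intro H.
  assert (Ex : forall x y, exists d : posreal, (a <= x <= b -> a' <= y <= b' ->
     d * (Rabs (g x y) + 1) <= 1 /\ forall x' y',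
     a <= x' <= b -> Rabs (x' - x) < d -> Rabs (y' - y) < d -> g x' y' <= g x y + 1)).
  { intros x y. destruct (classic (a <= x <= b /\ a' <= y <= b')) as [[H1 H2]|Hn].
    - destruct (H x y H1 H2) as [d [Hd Hd2]]. pose proof (Rabs_pos (g x y)) as Pg.
      assert (Hm : 0 < Rmin d (/ (Rabs (g x y) + 1))).
      { apply Rmin_pos; auto. apply Rinv_0_lt_compat; lra. }
      exists (mkposreal _ Hm). intros _ _; simpl; split.
      + replace 1 with (/ (Rabs (g x y) + 1) * (Rabs (g x y) + 1)) at 3 by (field; lra).
        apply Rmult_le_compat_r; [lra|apply Rmin_r].
      + intros x' y' Hx E1 E2; apply Hd2; auto; (eapply Rlt_le_trans; [eassumption|apply Rmin_l]).
    - exists (mkposreal 1 Rlt_0_1). tauto. }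
  destruct (function_choice _ (fun x => function_choice _ (Ex x))) as [delta Hdelta].
  destruct (compactness_value_2d a b a' b' delta) as [d Hd].
  exists (/ d + 1). intros x y Hx Hy.
  apply Rnot_lt_le. intro K. apply (Hd x y Hx Hy). intros [u [v [Hu [Hv [E1 [E2 E3]]]]]].
  destruct (Hdelta u v Hu Hv) as [F1 F2].
  specialize (F2 x y Hx E1 E2).
  pose proof (cond_pos d) as Pd. pose proof (Rabs_pos (g u v)) as Pg. pose proof (Rle_abs (g u v)).
  assert (d * (Rabs (g u v) + 1) <= 1) by nra.
  assert (Rabs (g u v) + 1 <= / d).
  { apply Rmult_le_reg_l with d; auto. rewrite Rinv_r; lra. }
  lra.
Qed.

(** * Fourier coefficients on vertical strips *)

Lemma in_interval_between al be s1 s2 x :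
  in_interval al be s1 -> in_interval al be s2 -> s1 <= x <= s2 -> in_interval al be x.
Proof.
  intros [H1 _] [_ H2] [L U]; split.
  - apply Rbar_lt_le_trans with s1; auto.
  - apply Rbar_le_lt_trans with s2; auto.
Qed.

Lemma in_interval_nbhd al be s : in_interval al be s ->
  exists d, 0 < d /\ forall x, Rabs (x - s) <= d -> in_interval al be x.
Proof.
  intros [H1 H2].
  assert (E1 : exists d, 0 < d /\ forall x, s - d <= x -> Rbar_lt al x).
  { destruct al as [r| |]; simpl in H1.
    - exists ((s - r) / 2); split; [lra|]. intros x Hx; simpl; lra.
    - tauto.
    - exists 1; split; [lra|]. intros; exact I. }
  assert (E2 : exists d, 0 < d /\ forall x, x <= s + d -> Rbar_lt x be).
  { destruct be as [r| |]; simpl in H2.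
    - exists ((r - s) / 2); split; [lra|]. intros x Hx; simpl; lra.
    - exists 1; split; [lra|]. intros; exact I.
    - tauto. }
  destruct E1 as [d1 [P1 K1]], E2 as [d2 [P2 K2]].
  exists (Rmin d1 d2); split; [now apply Rmin_pos|].
  intros x Hx. apply Rabs_le_between in Hx.
  pose proof (Rmin_l d1 d2). pose proof (Rmin_r d1 d2).
  split; [apply K1; lra|apply K2; lra].
Qed.

Lemma in_interval_nonempty al be : Rbar_lt al be -> exists s, in_interval al be s.
Proof.
  intro H. unfold in_interval. destruct al as [x| |], be as [y| |]; simpl in *; try tauto.
  - exists ((x + y) / 2); lra.
  - exists (x + 1); split; auto; lra.
  - exists (y - 1); split; auto; lra.
  - exists 0; auto.
Qed.

(** Freezing the abscissa outside a closed strip extends a function known on the strip to one that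
    is continuous on whole lines. *)
Definition clamp (s1 s2 x : R) : R := Rmax s1 (Rmin x s2).

Lemma clamp_id s1 s2 x : s1 <= x <= s2 -> clamp s1 s2 x = x.
Proof. intros [H1 H2]; unfold clamp; rewrite Rmin_left by lra; now apply Rmax_right. Qed.

Lemma clamp_in s1 s2 x : s1 <= s2 -> s1 <= clamp s1 s2 x <= s2.
Proof.
  intro H; unfold clamp; split; [apply Rmax_l|].
  apply Rmax_lub; [lra|apply Rmin_r].
Qed.

Lemma clamp_lip s1 s2 x y : Rabs (clamp s1 s2 x - clamp s1 s2 y) <= Rabs (x - y).
Proof.
  unfold clamp, Rmax, Rmin, Rabs. repeat destruct (Rle_dec _ _); repeat destruct (Rcase_abs _); lra.
Qed.

Definition twist (f : C -> C) (nu sigma t : R) : C :=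
  (f (sigma, t) * Cexp (- (RtoC nu * (sigma, t))))%C.

Section Strip.
Variables (al be : Rbar) (f : C -> C).
Hypothesis Hf : AP al be f.

Lemma AP_cdiff A p : in_strip al be p -> cdiff A f p.
Proof. intro H; apply cdiff_of_ex_derive; now apply Hf. Qed.

Lemma AP_continuous p : in_strip al be p -> forall eps, 0 < eps -> exists d, 0 < d /\
  forall s, Cmod (s - p) < d -> Cmod (f s - f p) < eps.
Proof.
  intros H eps He.
  destruct (cdiff_continuous (fun _ => True) f p (AP_cdiff _ p H) eps He) as [d [Hd K]].
  exists d; split; auto.
Qed.

Lemma AP_line_cont sigma : in_interval al be sigma -> ccont (fun t => f (sigma, t)).
Proof.
  intro H. apply ccont_eps. intros t eps He.
  destruct (AP_continuous (sigma, t) H eps He) as [d [Hd K]].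
  exists d; split; auto. intros s Hs. apply K.
  replace ((sigma, s) - (sigma, t))%C with (Ci * RtoC (s - t))%C.
  - now rewrite Cmod_mult, Cmod_Ci, Cmod_R, Rmult_1_l.
  - unfold Cmult, Cminus, Cplus, Copp, Ci, RtoC; simpl; f_equal; ring.
Qed.

Lemma AP_periods eps s1 s2 : 0 < eps -> in_interval al be s1 -> in_interval al be s2 ->
  s1 <= s2 -> exists l, 0 < l /\ forall x, exists tau, x <= tau <= x + l /\
    forall sigma t, s1 <= sigma <= s2 -> Cmod (f (sigma, t + tau)%R - f (sigma, t)) <= eps.
Proof.
  intros He H1 H2 H12. destruct Hf as [_ Hp].
  destruct (Hp eps He s1 s2) as [l [Hl K]]; [apply H1|auto|apply H2|].
  exists l; split; auto. intro x. destruct (K x) as [tau [Ht E]]. exists tau; split; auto.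
  intros sigma t Hs. specialize (E (sigma, t) Hs).
  replace ((sigma, t) + Ci * RtoC tau)%C with ((sigma, t + tau)%R : C) in E; auto.
  unfold Cmult, Cplus, Ci, RtoC; simpl; f_equal; ring.
Qed.

Lemma AP_line_system sigma : in_interval al be sigma ->
  ap_system (periods_of (fun t => f (sigma, t))).
Proof.
  intro H. apply periods_of_system. intros eps He.
  destruct (AP_periods eps sigma sigma He H H (Rle_refl _)) as [l [Hl K]].
  exists l; split; auto. intro x. destruct (K x) as [tau [Ht E]]. exists tau; split; auto.
  intro t; apply E; lra.
Qed.

(** A 1-almost period moves any ordinate into [[0, l]], where the rectangle is compact. *)
Lemma AP_bounded s1 s2 : in_interval al be s1 -> in_interval al be s2 -> s1 <= s2 ->
  exists M, forall sigma t, s1 <= sigma <= s2 -> Cmod (f (sigma, t)) <= M.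
Proof.
  intros H1 H2 H12.
  destruct (AP_periods 1 s1 s2 Rlt_0_1 H1 H2 H12) as [l [Hl K]].
  destruct (bounded_on_rectangle (fun x y => Cmod (f (x, y))) s1 s2 0 l) as [M HM].
  - intros x y Hx Hy.
    destruct (AP_continuous (x, y) (in_interval_between _ _ _ _ _ H1 H2 Hx) 1 Rlt_0_1)
      as [d [Hd Kd]].
    exists (d / 2); split; [lra|]. intros x' y' _ E1 E2.
    eapply Rle_trans; [apply (Cmod_le_sub _ (f (x, y)))|]. apply Rplus_le_compat_l. left.
    apply Kd. eapply Rle_lt_trans; [apply Cmod_le_sum|].
    replace (Re ((x', y') - (x, y))) with (x' - x) by reflexivity.
    replace (Im ((x', y') - (x, y))) with (y' - y) by reflexivity. lra.
  - exists (M + 1). intros sigma t Hs. destruct (K (- t)) as [tau [Ht E]].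
    specialize (E sigma t Hs). specialize (HM sigma (t + tau) Hs ltac:(lra)).
    rewrite Cmod_minus_sym in E.
    pose proof (Cmod_le_sub (f (sigma, t)) (f (sigma, t + tau)%R)). simpl in HM. lra.
Qed.

Lemma twist_eq nu sigma t :
  twist f nu sigma t = (RtoC (exp (- (nu * sigma))) * (f (sigma, t) * cis (- nu * t)))%C.
Proof.
  unfold twist. rewrite Cexp_strip_opp. replace (- (nu * t)) with (- nu * t) by ring. ring.
Qed.

Lemma twist_line_cont nu sigma : in_interval al be sigma -> ccont (twist f nu sigma).
Proof.
  intro H. replace (twist f nu sigma) with
    (fun t => RtoC (exp (- (nu * sigma))) * (f (sigma, t) * cis (- nu * t)))%C
    by (extensionality t; symmetry; apply twist_eq).
  apply ccont_mult; [apply ccont_const|].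
  apply ccont_mult; [now apply AP_line_cont|apply ccont_cis].
Qed.

Lemma twist_umean_exists nu sigma : in_interval al be sigma ->
  exists m, is_umean (twist f nu sigma) m.
Proof.
  intro H. destruct (AP_bounded sigma sigma H H (Rle_refl _)) as [M HM].
  pose proof (AP_line_system sigma H) as HS.
  set (D := periods_of (fun t => f (sigma, t))) in *.
  destruct (umean_exists (add_freq D (- nu)) (fun t => f (sigma, t) * cis (- nu * t))%C M)
    as [m Hm].
  - now apply add_freq_system.
  - apply (controls_mult _ M 1).
    + now apply add_freq_system.
    + intro t; apply HM; lra.
    + intro t; rewrite Cmod_cis; lra.
    + apply controls_add_freq, controls_periods_of.
    + apply controls_freq.
  - apply ccont_mult; [now apply AP_line_cont|apply ccont_cis].
  - intro t. rewrite Cmod_mult, Cmod_cis, Rmult_1_r. apply HM; lra.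
  - exists (RtoC (exp (- (nu * sigma))) * m)%C.
    eapply umean_ext; [intro t; symmetry; apply twist_eq|].
    apply umean_scal; auto.
    apply ccont_mult; [now apply AP_line_cont|apply ccont_cis].
Qed.

(* Cauchy's theorem on long rectangles: the horizontal sides are bounded, so the
   averages over two vertical lines have the same limit. *)
Lemma twist_umean_indep nu s1 s2 m : in_interval al be s1 -> in_interval al be s2 ->
  s1 < s2 -> is_umean (twist f nu s1) m -> is_umean (twist f nu s2) m.
Proof.
  intros H1 H2 H12 Hm.
  destruct (AP_bounded s1 s2 H1 H2 (Rlt_le _ _ H12)) as [M0 HM0].
  assert (M0pos : 0 <= M0).
  { eapply Rle_trans; [apply Cmod_ge_0|apply (HM0 s1 0); lra]. }
  set (Q := exp (Rabs nu * (Rabs s1 + Rabs s2))).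
  assert (HQ : forall x, s1 <= x <= s2 -> exp (- (nu * x)) <= Q).
  { intros x Hx. unfold Q.
    assert (L : - (nu * x) <= Rabs nu * (Rabs s1 + Rabs s2)).
    { eapply Rle_trans; [apply Rle_abs|]. rewrite Rabs_Ropp, Rabs_mult.
      apply Rmult_le_compat_l; [apply Rabs_pos|].
      unfold Rabs; repeat destruct (Rcase_abs _); lra. }
    destruct L as [L|L]; [left; now apply exp_increasing|rewrite L; lra]. }
  set (M := Q * M0).
  pose (g := fun s : C => (f s * Cexp (- RtoC nu * s))%C).
  assert (gtw : forall x t, g (x, t) = twist f nu x t).
  { intros x t. unfold g, twist. do 2 f_equal. ring. }
  (* [g] is controlled on the strip only, while [goursat] asks for continuity on entire lines. [G]
     agrees with [g] on the strip, where the derivative is taken. *)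
  pose (G := fun s : C => g (clamp s1 s2 (Re s), Im s)).
  assert (Strip : forall p, s1 <= Re p <= s2 -> in_strip al be p)
    by (intros p Hp; now apply (in_interval_between _ _ s1 s2)).
  assert (GD : forall p, s1 <= Re p <= s2 -> cdiff (fun _ => True) g p).
  { intros p Hp. apply cdiff_mult; [apply AP_cdiff, Strip, Hp|apply cdiff_Cexp_scal]. }
  assert (Gg : forall s, s1 <= Re s <= s2 -> G s = g s).
  { intros [x y] Hs. unfold G, Re, Im in *; simpl in *. now rewrite clamp_id. }
  assert (GC : forall x0 y0 x y, Cmod ((clamp s1 s2 x, y) - (clamp s1 s2 x0, y0))%C
     <= Rabs (x - x0) + Rabs (y - y0)).
  { intros. eapply Rle_trans; [apply Cmod_le_sum|].
    apply Rplus_le_compat; [apply clamp_lip|]. right; reflexivity. }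
  assert (GL : lines_cont G).
  { split; intro u; apply ccont_eps; intros t eps He.
    - destruct (cdiff_continuous _ g (clamp s1 s2 t, u) (GD (clamp s1 s2 t, u) (clamp_in s1 s2 t (Rlt_le _ _ H12))) eps He)
        as [d [Hd K]].
      exists d; split; auto. intros s Hs. apply K; auto.
      eapply Rle_lt_trans; [apply GC|]. unfold Re, Im; simpl. replace (u - u) with 0 by ring. rewrite Rabs_R0; lra.
    - destruct (cdiff_continuous _ g (clamp s1 s2 u, t) (GD (clamp s1 s2 u, t) (clamp_in s1 s2 u (Rlt_le _ _ H12))) eps He)
        as [d [Hd K]].
      exists d; split; auto. intros s Hs. apply K; auto.
      eapply Rle_lt_trans; [apply GC|]. unfold Re, Im; simpl. replace (u - u) with 0 by ring. rewrite Rabs_R0; lra. }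
  assert (Gdiff : forall p, s1 <= Re p <= s2 -> cdiff (fun s => s1 <= Re s <= s2) G p).
  { intros p Hp. destruct (GD p Hp) as [d Hd]. exists d. intros eps He.
    destruct (Hd eps He) as [dl [P1 P2]]. exists dl; split; auto. intros s As Hs.
    rewrite !Gg by auto. apply P2; auto. }
  assert (GM : forall x y, s1 <= x <= s2 -> Cmod (G (x, y)) <= M).
  { intros x y Hx. rewrite Gg by exact Hx. rewrite gtw, twist_eq, !Cmod_mult, Cmod_cis, Cmod_R, Rmult_1_r.
    rewrite Rabs_pos_eq by (left; apply exp_pos). unfold M.
    apply Rmult_le_compat; auto; [left; apply exp_pos|apply Cmod_ge_0]. }
  assert (Close : forall a S, 0 < S ->
     Cmod (win (twist f nu s2) a S - win (twist f nu s1) a S) <= 2 * ((s2 - s1) * M)).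
  { intros a S HS. unfold win.
    pose proof (goursat G s1 s2 GL Gdiff s1 a (s2 - s1) S ltac:(lra) HS ltac:(lra) ltac:(lra)) as E.
    unfold rect in E. replace (s1 + (s2 - s1)) with s2 in E by ring.
    destruct GL as [GL1 GL2].
    assert (X1 : Cmod (CI (fun x => G (x, a)) s1 s2) <= (s2 - s1) * M)
      by (apply CI_bound; auto; lra).
    assert (X2 : Cmod (CI (fun x => G (x, a + S)) s1 s2) <= (s2 - s1) * M)
      by (apply CI_bound; auto; lra).
    rewrite (CI_ext (fun y => G (s2, y)) (twist f nu s2)) in E
      by (intro y; rewrite Gg, gtw; auto; unfold Re; simpl; lra).
    rewrite (CI_ext (fun y => G (s1, y)) (twist f nu s1)) in E
      by (intro y; rewrite Gg, gtw; auto; unfold Re; simpl; lra).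
    set (A := CI (fun x => G (x, a)) s1 s2) in *. set (B := CI (fun x => G (x, a + S)) s1 s2) in *.
    set (U := CI (twist f nu s2) a (a + S)) in *. set (V := CI (twist f nu s1) a (a + S)) in *.
    assert (Y : (Ci * (U - V))%C = (B - A)%C).
    { replace (Ci * (U - V))%C with ((A + Ci * U - B - Ci * V) + (B - A))%C by ring.
      rewrite E; ring. }
    replace (Cmod (U - V)) with (Cmod (Ci * (U - V))) by (rewrite Cmod_mult, Cmod_Ci; ring).
    rewrite Y. eapply Rle_trans; [apply Cmod_triangle_minus|]. lra. }
  intros eps He. destruct (Hm (eps / 2)) as [S0 [HS0 K]]; [lra|].
  assert (Mpos : 0 <= M) by (unfold M; apply Rmult_le_pos; auto; left; apply exp_pos).
  (* Once [S >= q], the two horizontal sides contribute at most [2 * ((s2 - s1) * M) / S <= eps / 2]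
     to the difference of averages. *)
  set (q := 4 * ((s2 - s1) * M) / eps).
  assert (Hq : 0 <= q).
  { unfold q; apply Rmult_le_pos; [nra|]. apply Rlt_le, Rinv_0_lt_compat; auto. }
  exists (S0 + q); split; [lra|]. intros a S HS.
  specialize (K a S ltac:(lra)). specialize (Close a S ltac:(lra)).
  pose proof (Cmod_dist_triangle (avg (twist f nu s2) a S) (avg (twist f nu s1) a S) m) as T.
  assert (Cmod (avg (twist f nu s2) a S - avg (twist f nu s1) a S) <= eps / 2); [|lra].
  unfold avg. replace (RtoC (/ S) * win (twist f nu s2) a S - RtoC (/ S) * win (twist f nu s1) a S)%C
    with (RtoC (/ S) * (win (twist f nu s2) a S - win (twist f nu s1) a S))%C by ring.
  rewrite Cmod_mult, Cmod_R, Rabs_pos_eq by (apply Rlt_le, Rinv_0_lt_compat; lra).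
  apply Rmult_le_reg_l with S; [lra|]. rewrite <- Rmult_assoc, Rinv_r, Rmult_1_l by lra.
  eapply Rle_trans; [exact Close|].
  replace (2 * ((s2 - s1) * M)) with (q * (eps / 2)) by (unfold q; field; lra).
  apply Rmult_le_compat_r; lra.
Qed.

Lemma fourier_mean_avg nu sigma T :
  fourier_mean f nu sigma T = avg (twist f nu sigma) (- T) (2 * T).
Proof.
  unfold fourier_mean, avg, win, CI, twist. replace (- T + 2 * T) with T by ring. reflexivity.
Qed.

Lemma umean_fourier_lim nu sigma m : is_umean (twist f nu sigma) m ->
  filterlim (fourier_mean f nu sigma) (Rbar_locally p_infty) (locally m).
Proof.
  intro H. apply filterlim_locally. intros [eps He].
  destruct (H (eps / 2)) as [S0 [HS K]]; [lra|].
  exists S0. intros T HT. rewrite fourier_mean_avg.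
  apply C_NormedModule_mixin_compat1. simpl.
  specialize (K (- T) (2 * T) ltac:(lra)).
  eapply Rle_lt_trans; [exact K|]. lra.
Qed.

Lemma fourier_lim_unique nu sigma m a : is_umean (twist f nu sigma) m ->
  filterlim (fourier_mean f nu sigma) (Rbar_locally p_infty) (locally a) -> a = m.
Proof.
  intros Hm Ha. apply umean_fourier_lim in Hm.
  apply (@filterlim_locally_unique R R_AbsRing C_R_NormedModule (Rbar_locally p_infty) _
    (fourier_mean f nu sigma)); auto.
Qed.

(** One vertical line determines the coefficient on all of them; lines to the left are reached by
    comparing with the mean that exists there. *)
Lemma fourier_coef_of_umean nu sigma m : in_interval al be sigma ->
  is_umean (twist f nu sigma) m -> is_fourier_coef al be f nu m.
Proof.
  intros Hs Hm s Hs'. apply umean_fourier_lim.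
  destruct (Rtotal_order sigma s) as [L|[->|L]]; auto.
  - now apply (twist_umean_indep nu sigma s).
  - destruct (twist_umean_exists nu s Hs') as [m' Hm'].
    replace m with m'; auto. apply (umean_unique (twist f nu sigma)); auto.
    now apply (twist_umean_indep nu s sigma).
Qed.

Lemma fourier_coef_umean nu sigma a : in_interval al be sigma ->
  is_fourier_coef al be f nu a -> is_umean (twist f nu sigma) a.
Proof.
  intros Hs Ha. destruct (twist_umean_exists nu sigma Hs) as [m Hm].
  replace a with m; auto. symmetry. eapply fourier_lim_unique; eauto.
Qed.

Lemma fourier_coef_exists nu : Rbar_lt al be -> exists a, is_fourier_coef al be f nu a.
Proof.
  intro H. destruct (in_interval_nonempty al be H) as [s Hs].
  destruct (twist_umean_exists nu s Hs) as [m Hm].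
  exists m. now apply (fourier_coef_of_umean nu s).
Qed.

Lemma fourier_coef_unique nu a b : Rbar_lt al be ->
  is_fourier_coef al be f nu a -> is_fourier_coef al be f nu b -> a = b.
Proof.
  intros H Ha Hb. destruct (in_interval_nonempty al be H) as [s Hs].
  apply (umean_unique (twist f nu s)); now apply fourier_coef_umean.
Qed.

End Strip.

(** * Trigonometric sums *)

Fixpoint csum (n : nat) (f : nat -> C) : C :=
  match n with O => RtoC 0 | S m => (csum m f + f m)%C end.

Fixpoint rsum (n : nat) (f : nat -> R) : R :=
  match n with O => 0 | S m => rsum m f + f m end.

Lemma csum_ext n f g : (forall k, (k < n)%nat -> f k = g k) -> csum n f = csum n g.
Proof.
  induction n as [|n IH]; intro H; simpl; auto. rewrite IH, H; auto.
Qed.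

Lemma csum_plus n f g : csum n (fun k => f k + g k)%C = (csum n f + csum n g)%C.
Proof. induction n as [|n IH]; simpl; [ring|rewrite IH; ring]. Qed.

Lemma csum_scal n c f : csum n (fun k => c * f k)%C = (c * csum n f)%C.
Proof. induction n as [|n IH]; simpl; [ring|rewrite IH; ring]. Qed.

Lemma csum_scal_r n c f : csum n (fun k => f k * c)%C = (csum n f * c)%C.
Proof. induction n as [|n IH]; simpl; [ring|rewrite IH; ring]. Qed.

Lemma csum_mult n m f g :
  (csum n f * csum m g)%C = csum n (fun i => csum m (fun j => f i * g j)%C).
Proof.
  rewrite <- csum_scal_r. apply csum_ext; intros i _. now rewrite csum_scal.
Qed.

Lemma csum_zero n f : (forall k, (k < n)%nat -> f k = RtoC 0) -> csum n f = RtoC 0.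
Proof.
  induction n as [|n IH]; intro H; simpl; auto. rewrite IH, H; auto. ring.
Qed.

Lemma csum_single n f k : (k < n)%nat -> (forall j, (j < n)%nat -> j <> k -> f j = RtoC 0) ->
  csum n f = f k.
Proof.
  induction n as [|n IH]; intros Hk H; [lia|]. simpl.
  destruct (Nat.eq_dec k n) as [->|Hn].
  - rewrite csum_zero; [ring|]. intros j Hj; apply H; lia.
  - rewrite IH, (H n) by (try lia; intros; apply H; lia). ring.
Qed.

Lemma Re_csum n f : Re (csum n f) = rsum n (fun k => Re (f k)).
Proof. induction n as [|n IH]; simpl; auto. rewrite <- IH; reflexivity. Qed.

Lemma Cmod_csum n f : Cmod (csum n f) <= rsum n (fun k => Cmod (f k)).
Proof.
  induction n as [|n IH]; simpl; [rewrite Cmod_0; lra|].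
  eapply Rle_trans; [apply Cmod_triangle|]; lra.
Qed.

Lemma rsum_le n f g : (forall k, (k < n)%nat -> f k <= g k) -> rsum n f <= rsum n g.
Proof.
  induction n as [|n IH]; intro H; simpl; [lra|].
  specialize (IH (fun k Hk => H k (Nat.lt_lt_succ_r _ _ Hk))). specialize (H n ltac:(lia)). lra.
Qed.

Lemma rsum_ext n f g : (forall k, (k < n)%nat -> f k = g k) -> rsum n f = rsum n g.
Proof. induction n as [|n IH]; intro H; simpl; auto. rewrite IH, H; auto. Qed.

Lemma rsum_scal n c f : rsum n (fun k => c * f k) = c * rsum n f.
Proof. induction n as [|n IH]; simpl; [ring|rewrite IH; ring]. Qed.

Lemma rsum_plus n f g : rsum n (fun k => f k + g k) = rsum n f + rsum n g.
Proof. induction n as [|n IH]; simpl; [ring|rewrite IH; ring]. Qed.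

Lemma rsum_const n c : rsum n (fun _ => c) = INR n * c.
Proof. induction n as [|n IH]; simpl rsum; [simpl; ring|rewrite IH, S_INR; ring]. Qed.

Lemma ccont_csum n (F : nat -> R -> C) :
  (forall k, (k < n)%nat -> ccont (F k)) -> ccont (fun t => csum n (fun k => F k t)).
Proof.
  induction n as [|n IH]; intro H; simpl; [apply ccont_const|].
  apply ccont_plus; auto.
Qed.

Lemma umean_csum n (F : nat -> R -> C) m :
  (forall k, (k < n)%nat -> ccont (F k)) -> (forall k, (k < n)%nat -> is_umean (F k) (m k)) ->
  is_umean (fun t => csum n (fun k => F k t)) (csum n m).
Proof.
  induction n as [|n IH]; intros HC H; simpl; [apply umean_const|].
  apply umean_plus; auto. apply ccont_csum; auto.
Qed.

Lemma Re_CI_le F G a b : ccont F -> ccont G -> a <= b ->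
  (forall t, Re (F t) <= Re (G t)) -> Re (CI F a b) <= Re (CI G a b).
Proof.
  intros HF HG Hab H. rewrite !Re_CI by auto. apply RInt_le; auto.
  - apply (@ex_RInt_continuous R_CompleteNormedModule); intros t _; apply (HF t).
  - apply (@ex_RInt_continuous R_CompleteNormedModule); intros t _; apply (HG t).
Qed.

Lemma Re_scal r z : Re (RtoC r * z)%C = r * Re z.
Proof. unfold Re, Cmult, RtoC; simpl; ring. Qed.

Lemma umean_Re_le F G m m' : ccont F -> ccont G -> is_umean F m -> is_umean G m' ->
  (forall t, Re (F t) <= Re (G t)) -> Re m <= Re m'.
Proof.
  intros HF HG Hm Hm' H. apply Rnot_lt_le. intro K.
  set (e := (Re m - Re m') / 3). assert (He : 0 < e) by (unfold e; lra).
  destruct (Hm e He) as [S1 [P1 K1]]. destruct (Hm' e He) as [S2 [P2 K2]].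
  specialize (K1 0 (S1 + S2) ltac:(lra)). specialize (K2 0 (S1 + S2) ltac:(lra)).
  assert (E : Re (avg F 0 (S1 + S2)) <= Re (avg G 0 (S1 + S2))).
  { unfold avg, win. rewrite !Re_scal. apply Rmult_le_compat_l.
    - apply Rlt_le, Rinv_0_lt_compat; lra.
    - apply Re_CI_le; auto; lra. }
  apply (Rle_trans _ _ _ (re_le_Cmod _)) in K1. apply (Rle_trans _ _ _ (re_le_Cmod _)) in K2.
  change (Re (avg F 0 (S1 + S2) - m)) with (Re (avg F 0 (S1 + S2)) - Re m) in K1.
  change (Re (avg G 0 (S1 + S2) - m')) with (Re (avg G 0 (S1 + S2)) - Re m') in K2.
  apply Rabs_le_between in K1. apply Rabs_le_between in K2. unfold e in *. lra.
Qed.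

Lemma umean_Cmod_le F G m m' : ccont F -> ccont G -> is_umean F m -> is_umean G m' ->
  (forall t, Cmod (F t) <= Re (G t)) -> Cmod m <= Re m'.
Proof.
  intros HF HG Hm Hm' H. destruct (Re_align m) as [a Ha]. rewrite <- Ha.
  apply (umean_Re_le (fun t => cis a * F t)%C G); auto.
  - apply ccont_mult; auto; apply ccont_const.
  - now apply umean_scal.
  - intro t. eapply Rle_trans; [|apply H].
    eapply Rle_trans; [apply Rle_abs|]. eapply Rle_trans; [apply re_le_Cmod|].
    rewrite Cmod_mult, Cmod_cis; lra.
Qed.

Lemma umean_character nu : is_umean (fun t => cis (nu * t)) (if Req_EM_T nu 0 then 1 else 0).
Proof.
  destruct (Req_EM_T nu 0) as [->|H].
  - eapply umean_ext; [|apply (umean_const 1)]. intro t; simpl. rewrite Rmult_0_l, cis_0; auto.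
  - now apply umean_cis.
Qed.

Lemma umean_term c nu : is_umean (fun t => c * cis (nu * t))%C (if Req_EM_T nu 0 then c else 0).
Proof.
  replace (if Req_EM_T nu 0 then c else 0) with (c * (if Req_EM_T nu 0 then 1 else 0))%C.
  - apply umean_scal; [apply ccont_cis|apply umean_character].
  - destruct (Req_EM_T nu 0); ring.
Qed.

Lemma ccont_term c nu : ccont (fun t => c * cis (nu * t))%C.
Proof. apply ccont_mult; [apply ccont_const|apply ccont_cis]. Qed.

(** * Integer frequencies: Parseval's identity and a trilinear estimate *)

Definition trig (n : nat) (v : nat -> C) (theta : R) : C :=
  csum n (fun k => v k * cis (INR k * theta))%C.

Lemma ccont_trig n v : ccont (trig n v).
Proof. apply ccont_csum; intros k _; apply ccont_term. Qed.

Lemma Cconj_cis x : Cconj (cis x) = cis (- x).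
Proof. unfold Cconj, cis; simpl. now rewrite cos_neg, sin_neg. Qed.

Lemma Cconj_csum n f : Cconj (csum n f) = csum n (fun k => Cconj (f k)).
Proof.
  induction n as [|n IH]; simpl.
  - unfold Cconj, RtoC; simpl; f_equal; ring.
  - rewrite <- IH. unfold Cconj, Cplus; simpl; f_equal; ring.
Qed.

Lemma Cconj_mult z w : Cconj (z * w) = (Cconj z * Cconj w)%C.
Proof. unfold Cconj, Cmult; simpl; f_equal; ring. Qed.

Lemma Cmult_conj_mod z : (z * Cconj z)%C = RtoC (Cmod z * Cmod z).
Proof. rewrite <- Cmod2_conj; f_equal; ring. Qed.

Lemma ccont_conj f : ccont f -> ccont (fun t => Cconj (f t)).
Proof.
  intros H. apply ccont_eps. rewrite ccont_eps in H. intros t eps He.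
  destruct (H t eps He) as [d [Hd K]]. exists d; split; auto. intros s Hs.
  replace (Cconj (f s) - Cconj (f t))%C with (Cconj (f s - f t))%C.
  - rewrite Cmod_conj; auto.
  - unfold Cconj, Cminus, Cplus, Copp; simpl; f_equal; ring.
Qed.

Lemma parseval n v :
  is_umean (fun t => trig n v t * Cconj (trig n v t))%C (csum n (fun k => v k * Cconj (v k))%C).
Proof.
  apply umean_ext with (fun t => csum n (fun i => csum n (fun j =>
    (v i * Cconj (v j)) * cis ((INR i - INR j) * t))))%C.
  - intro t. unfold trig. rewrite Cconj_csum, csum_mult.
    apply csum_ext; intros i _. apply csum_ext; intros j _.
    rewrite Cconj_mult, Cconj_cis.
    replace ((INR i - INR j) * t) with (INR i * t + - (INR j * t)) by ring. rewrite cis_plus. ring.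
  - replace (csum n (fun k => v k * Cconj (v k))%C) with
      (csum n (fun i => csum n (fun j => if Req_EM_T (INR i - INR j) 0 then v i * Cconj (v j) else 0)))%C.
    + apply umean_csum; intros i _; [apply ccont_csum; intros; apply ccont_term|].
      apply umean_csum; intros j _; [apply ccont_term|apply umean_term].
    + apply csum_ext; intros i Hi. rewrite (csum_single n _ i Hi).
      * destruct (Req_EM_T _ _) as [E|E]; auto. exfalso; apply E; ring.
      * intros j _ Hj. destruct (Req_EM_T _ _) as [E|E]; auto.
        exfalso; apply Hj. apply INR_eq. lra.
Qed.

(** The mean keeps the frequencies with [y = x + t]. Such [y] stay below [2 * n], which is why the
    third polynomial is longer. *)
Lemma trilinear_mean n (v w u : nat -> C) :
  is_umean (fun t => trig n v t * trig n w t * trig (2 * n) u (- t))%C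
    (csum n (fun x => csum n (fun t => v x * w t * u (x + t)%nat)))%C.
Proof.
  apply umean_ext with (fun th => csum n (fun x => csum n (fun t => csum (2 * n) (fun y =>
    (v x * w t * u y) * cis ((INR x + INR t - INR y) * th)))))%C.
  - intro th. unfold trig. rewrite (csum_mult n n), <- csum_scal_r.
    apply csum_ext; intros x _. rewrite csum_mult.
    apply csum_ext; intros t _. apply csum_ext; intros y _.
    replace ((INR x + INR t - INR y) * th) with (INR x * th + INR t * th + INR y * - th) by ring.
    rewrite !cis_plus. ring.
  - replace (csum n (fun x => csum n (fun t => v x * w t * u (x + t)%nat))%C) with
      (csum n (fun x => csum n (fun t => csum (2 * n) (fun y =>
        if Req_EM_T (INR x + INR t - INR y) 0 then v x * w t * u y else 0))))%C.
    + apply umean_csum; intros x _;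
        [apply ccont_csum; intros; apply ccont_csum; intros; apply ccont_term|].
      apply umean_csum; intros t _; [apply ccont_csum; intros; apply ccont_term|].
      apply umean_csum; intros y _; [apply ccont_term|apply umean_term].
    + apply csum_ext; intros x Hx. apply csum_ext; intros t Ht.
      rewrite (csum_single (2 * n) _ (x + t)%nat) by (try lia;
        intros y _ Hy; destruct (Req_EM_T _ _) as [E|E]; auto;
        exfalso; apply Hy; apply INR_eq; rewrite plus_INR; lra).
      destruct (Req_EM_T _ _) as [E|E]; auto. exfalso; apply E; rewrite plus_INR; ring.
Qed.

(** Take the supremum of the third factor, bound the product of the other two by half the sum of
    their squares, and use Parseval. A uniform bound on the trigonometric sums of [u] thus limits
    its correlation with all shifts. *)
Lemma trilinear_bound n (v w u : nat -> C) M : 0 <= M ->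
  (forall th, Cmod (trig (2 * n) u th) <= M) ->
  Cmod (csum n (fun x => csum n (fun t => v x * w t * u (x + t)%nat)))%C
  <= M * (rsum n (fun k => Cmod (v k) * Cmod (v k)) + rsum n (fun k => Cmod (w k) * Cmod (w k))) / 2.
Proof.
  intros HM H.
  assert (CU : ccont (fun t => trig (2 * n) u (- t))).
  { replace (fun t => trig (2 * n) u (- t)) with
      (fun t => csum (2 * n) (fun k => u k * cis ((- INR k) * t)))%C.
    - apply ccont_csum; intros; apply ccont_term.
    - extensionality t. unfold trig. apply csum_ext; intros k _. do 2 f_equal; ring. }
  assert (CVV : forall v, ccont (fun t => trig n v t * Cconj (trig n v t))%C).
  { intro; apply ccont_mult; [apply ccont_trig|apply ccont_conj, ccont_trig]. }
  assert (Sq : forall v, csum n (fun k => v k * Cconj (v k))%C = RtoC (rsum n (fun k => Cmod (v k) * Cmod (v k)))).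
  { clear. intro v. induction n as [|n IH]; simpl; auto. rewrite IH, Cmult_conj_mod, RtoC_plus. auto. }
  assert (E := umean_Cmod_le _ (fun t => RtoC (M / 2) * (trig n v t * Cconj (trig n v t)
      + trig n w t * Cconj (trig n w t)))%C _ _
    (ccont_mult _ _ (ccont_mult _ _ (ccont_trig n v) (ccont_trig n w)) CU)
    (ccont_mult _ _ (ccont_const _) (ccont_plus _ _ (CVV v) (CVV w)))
    (trilinear_mean n v w u)
    (umean_scal (RtoC (M / 2)) _ _ (ccont_plus _ _ (CVV v) (CVV w))
      (umean_plus _ _ _ _ (CVV v) (CVV w) (parseval n v) (parseval n w)))).
  rewrite !Sq, <- RtoC_plus, <- RtoC_mult in E.
  eapply Rle_trans; [apply E|].
  - intro t. rewrite !Cmult_conj_mod, <- RtoC_plus, <- RtoC_mult, !Cmod_mult.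
    unfold RtoC, Re; simpl.
    set (p := Cmod (trig n v t)). set (q := Cmod (trig n w t)).
    specialize (H (- t)). set (r := Cmod (trig (2 * n) u (- t))) in *.
    assert (0 <= p) by apply Cmod_ge_0. assert (0 <= q) by apply Cmod_ge_0. assert (0 <= r) by apply Cmod_ge_0.
    assert (p * q <= (p * p + q * q) / 2) by (pose proof (Rle_0_sqr (p - q)); unfold Rsqr in *; lra).
    assert (0 <= p * q) by nra.
    apply Rle_trans with (p * q * M); [now apply Rmult_le_compat_l|]. nra.
  - unfold RtoC, Re; simpl. right; field.
Qed.

(** * Sampling of almost periodic functions *)

Lemma unif_cont_compact u a b eps : ccont u -> 0 < eps -> exists d, 0 < d /\
  forall s t, a <= s <= b -> a <= t <= b -> Rabs (s - t) < d -> Cmod (u s - u t) <= eps.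
Proof.
  intros Hu He. assert (He2 : 0 < eps / 2) by lra.
  destruct (@Heine_cor2 (fun x => Re (u x)) a b (fun x _ => proj2 (continuity_pt_filterlim _ x) (proj1 (Hu x)))
    (mkposreal _ He2)) as [d1 K1].
  destruct (@Heine_cor2 (fun x => Im (u x)) a b (fun x _ => proj2 (continuity_pt_filterlim _ x) (proj2 (Hu x)))
    (mkposreal _ He2)) as [d2 K2].
  exists (Rmin d1 d2); split; [apply Rmin_pos; apply cond_pos|].
  intros s t Hs Ht H.
  specialize (K1 s t Hs Ht (Rlt_le_trans _ _ _ H (Rmin_l _ _))).
  specialize (K2 s t Hs Ht (Rlt_le_trans _ _ _ H (Rmin_r _ _))). simpl in K1, K2.
  eapply Rle_trans; [apply Cmod_le_sum|].
  change (Re (u s - u t)) with (Re (u s) - Re (u t)).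
  change (Im (u s - u t)) with (Im (u s) - Im (u t)). lra.
Qed.

(** An almost period moves both points into [[-1, l + 1]]. The margin 1 accommodates the second
    point, which is at distance at most 1 from the first. *)
Lemma ap_unif_cont D u : ap_system D -> controls D u -> ccont u ->
  forall eps, 0 < eps -> exists rho, 0 < rho /\
    forall s t, Rabs (s - t) <= rho -> Cmod (u s - u t) <= eps.
Proof.
  intros [HD _] Hc Hu eps He.
  destruct (Hc (eps / 3)) as [eta [Pe Ke]]; [lra|].
  destruct (HD eta Pe) as [l [Hl Kl]].
  destruct (unif_cont_compact u (-1) (l + 1) (eps / 3) Hu) as [d [Hd K]]; [lra|].
  exists (Rmin (d / 2) 1); split; [apply Rmin_pos; lra|].
  intros s t H.
  assert (H1 : Rabs (s - t) <= d / 2) by (eapply Rle_trans; [exact H|apply Rmin_l]).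
  assert (H2 : Rabs (s - t) <= 1) by (eapply Rle_trans; [exact H|apply Rmin_r]).
  destruct (Kl (- s)) as [tau [Ht Dt]].
  assert (E1 := Ke tau Dt s). assert (E2 := Ke tau Dt t).
  apply Rabs_le_between in H2.
  assert (E3 : Cmod (u (s + tau)%R - u (t + tau)%R) <= eps / 3).
  { apply K; try lra. replace (s + tau - (t + tau)) with (s - t) by ring. lra. }
  rewrite Cmod_minus_sym in E1.
  pose proof (Cmod_dist_triangle (u s) (u (s + tau)%R) (u t)).
  pose proof (Cmod_dist_triangle (u (s + tau)%R) (u (t + tau)%R) (u t)). lra.
Qed.

Lemma cbounded_mult_cis B u nu : cbounded B u -> cbounded B (fun t => u t * cis (nu * t))%C.
Proof. intros H t. rewrite Cmod_mult, Cmod_cis, Rmult_1_r; apply H. Qed.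

Lemma win_long F B T e : 0 < T -> ccont F -> cbounded B F ->
  (forall a, Cmod (win F a T) <= e * T) -> 0 <= e ->
  forall a S, 0 <= S -> Cmod (win F a S) <= e * S + B * T.
Proof.
  intros HT HF HB H He a S HS.
  assert (B0 : 0 <= B) by (eapply Rle_trans; [apply Cmod_ge_0|apply (HB 0)]).
  assert (Mult : forall n, Cmod (win F a (INR n * T)) <= INR n * (e * T)).
  { induction n as [|n IH].
    - unfold win; simpl. replace (a + 0 * T) with a by ring. rewrite CI_point, Cmod_0; lra.
    - rewrite S_INR. unfold win. rewrite <- (CI_Chasles F a (a + INR n * T)) by auto.
      replace (a + (INR n + 1) * T) with (a + INR n * T + T) by ring.
      eapply Rle_trans; [apply Cmod_triangle|]. specialize (H (a + INR n * T)).
      unfold win in *. lra. }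
  destruct (floor_multiple T S) as [n [M1 M2]]; [lra|lra|].
  unfold win. rewrite <- (CI_Chasles F a (a + INR n * T)) by auto.
  eapply Rle_trans; [apply Cmod_triangle|]. apply Rplus_le_compat.
  - eapply Rle_trans; [apply Mult|]. nra.
  - eapply Rle_trans; [apply (CI_bound_abs F B); auto|]. rewrite Rabs_pos_eq by lra. nra.
Qed.

(** The constant phase at the left end [a] is factored out, so the error depends on the length of
    the window but not on its position. *)
Lemma win_freq_close u B nu nu' a T : ccont u -> cbounded B u -> 0 <= T ->
  Cmod (win (fun t => u t * cis (nu' * t))%C a T) <=
  Cmod (win (fun t => u t * cis (nu * t))%C a T) + T * (B * (Rabs (nu' - nu) * T)).
Proof.
  intros Hu HB HT.
  assert (B0 : 0 <= B) by (eapply Rle_trans; [apply Cmod_ge_0|apply (HB 0)]).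
  assert (CC : forall m, ccont (fun t => u t * cis (m * t))%C)
    by (intro; apply ccont_mult; [auto|apply ccont_cis]).
  assert (E : win (fun t => u t * cis (nu' * t))%C a T =
     (cis ((nu' - nu) * a) * win (fun t => u t * cis (nu * t))%C a T +
     CI (fun t => u t * cis (nu' * t) - cis ((nu' - nu) * a) * (u t * cis (nu * t)))%C a (a + T))%C).
  { unfold win. rewrite CI_minus, CI_scal; auto.
    - ring.
    - apply ccont_mult; auto; apply ccont_const. }
  rewrite E. eapply Rle_trans; [apply Cmod_triangle|]. rewrite Cmod_mult, Cmod_cis, Rmult_1_l.
  apply Rplus_le_compat_l.
  eapply Rle_trans; [apply CI_bound with (M := B * (Rabs (nu' - nu) * T))|].
  - apply ccont_minus; auto. apply ccont_mult; auto; apply ccont_const.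
  - lra.
  - intros t Ht.
    replace (u t * cis (nu' * t) - cis ((nu' - nu) * a) * (u t * cis (nu * t)))%C with
      (u t * (cis (nu' * t) - cis ((nu' - nu) * a + nu * t)))%C by (rewrite cis_plus; ring).
    rewrite Cmod_mult. apply Rmult_le_compat; try apply Cmod_ge_0; [apply HB|].
    eapply Rle_trans; [apply cis_dist|].
    replace (nu' * t - ((nu' - nu) * a + nu * t)) with ((nu' - nu) * (t - a)) by ring.
    rewrite Rabs_mult. apply Rmult_le_compat_l; [apply Rabs_pos|]. apply Rabs_le; lra.
  - right; ring.
Qed.

Section ZeroSpectrum.
Variables (u : R -> C) (B : R).
Hypotheses (Hu : ccont u) (HB : cbounded B u)
  (H0 : forall nu, is_umean (fun t => u t * cis (nu * t))%C 0).

Lemma windows_small_local e nu : 0 < e -> exists d T : R, 0 < d /\ 0 < T /\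
  forall nu', Rabs (nu' - nu) <= d -> forall a S, T <= S ->
    Cmod (win (fun t => u t * cis (nu' * t))%C a S) <= e * S.
Proof.
  intro He.
  assert (B0 : 0 <= B) by (eapply Rle_trans; [apply Cmod_ge_0|apply (HB 0)]).
  destruct (H0 nu (e / 4)) as [T [HT K]]; [lra|].
  set (d := (e / 4) / (T * (B + 1))).
  assert (Pd : 0 < d) by (apply Rdiv_lt_0_compat; nra).
  assert (Pq : 0 <= 2 * (B * T) / e).
  { apply Rmult_le_pos; [nra|apply Rlt_le, Rinv_0_lt_compat; lra]. }
  exists d, (1 + 2 * (B * T) / e). split; auto. split; [lra|].
  intros nu' Hn a S HS.
  assert (Wn : forall a, Cmod (win (fun t => u t * cis (nu' * t))%C a T) <= e / 2 * T).
  { intro b. eapply Rle_trans; [apply (win_freq_close u B nu nu'); auto; lra|].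
    specialize (K b T (Rle_refl _)).
    replace (avg (fun t => u t * cis (nu * t))%C b T - 0)%C
      with (avg (fun t => u t * cis (nu * t))%C b T) in K by ring.
    unfold avg in K. rewrite Cmod_mult, Cmod_R, Rabs_pos_eq in K by (apply Rlt_le, Rinv_0_lt_compat; lra).
    assert (K' : Cmod (win (fun t => u t * cis (nu * t))%C b T) <= e / 4 * T).
    { apply Rmult_le_reg_l with (/ T); [now apply Rinv_0_lt_compat|].
      replace (/ T * (e / 4 * T)) with (e / 4) by (field; lra). exact K. }
    assert (B * (Rabs (nu' - nu) * T) <= e / 4).
    { apply Rle_trans with (B * (d * T)).
      - apply Rmult_le_compat_l; auto. apply Rmult_le_compat_r; lra.
      - unfold d. replace (B * (e / 4 / (T * (B + 1)) * T)) with (e / 4 * (B / (B + 1))) by (field; lra).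
        assert (B / (B + 1) <= 1); [|nra].
        apply Rmult_le_reg_r with (B + 1); [lra|]. unfold Rdiv; rewrite Rmult_assoc, Rinv_l by lra. lra. }
    nra. }
  eapply Rle_trans; [apply (win_long _ B T (e / 2)); auto; try lra|].
  - apply ccont_mult; auto. apply ccont_cis.
  - now apply cbounded_mult_cis.
  - assert (B * T <= e / 2 * S); [|lra].
    replace (B * T) with (e / 2 * (2 * (B * T) / e)) by (field; lra).
    apply Rmult_le_compat_l; lra.
Qed.

(** Near each frequency a common window length works; compactness of [[-L, L]] makes the length
    independent of the frequency. *)
Lemma windows_small L e : 0 < e -> exists T, 0 < T /\ forall nu, - L <= nu <= L ->
  forall a S, T <= S -> Cmod (win (fun t => u t * cis (nu * t))%C a S) <= e * S.
Proof.
  intro He.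
  (* A single number encodes both data: [d] is the radius in frequency and [/ d] a sufficient window
     length. A lower bound on [d] then controls both. *)
  assert (Ex : forall nu, exists d : posreal, forall nu', Rabs (nu' - nu) < d ->
    forall a S, / d <= S -> Cmod (win (fun t => u t * cis (nu' * t))%C a S) <= e * S).
  { intro nu. destruct (windows_small_local e nu He) as [d [T [Pd [PT K]]]].
    assert (Pm : 0 < Rmin d (/ T)) by (apply Rmin_pos; auto; now apply Rinv_0_lt_compat).
    exists (mkposreal _ Pm). intros nu' Hn a S HS. simpl in *. apply K.
    - left; eapply Rlt_le_trans; [exact Hn|apply Rmin_l].
    - eapply Rle_trans; [|exact HS]. rewrite <- (Rinv_inv T) at 1.
      apply Rinv_le_contravar; auto. apply Rmin_r. }
  destruct (function_choice _ Ex) as [delta Hdelta].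
  destruct (compactness_value_1d (- L) L delta) as [d Hd].
  exists (/ d). split; [apply Rinv_0_lt_compat, cond_pos|].
  intros nu Hn a S HS. apply Rnot_lt_le. intro K. apply (Hd nu Hn).
  intros [m [_ [E1 E2]]]. apply (Rlt_not_le _ _ K). apply (Hdelta m nu E1).
  eapply Rle_trans; [|exact HS]. apply Rinv_le_contravar; auto. apply cond_pos.
Qed.

End ZeroSpectrum.

(** The exact integral of the character over one cell. Keeping it exact makes the Riemann sum
    comparison valid for frequencies as large as [PI / delta], where the character is far from
    constant on a cell. *)
Definition block (nu delta : R) : C := CI (fun t => cis (nu * t)) (- (delta / 2)) (delta / 2).

Lemma riemann_sum_close u nu delta e a n : ccont u -> 0 < delta ->
  (forall s t, Rabs (s - t) <= delta / 2 -> Cmod (u s - u t) <= e) ->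
  Cmod (CI (fun t => u t * cis (nu * t))%C (a - delta / 2) (a - delta / 2 + INR n * delta)
    - block nu delta * csum n (fun k => u (a + INR k * delta)%R * cis (nu * (a + INR k * delta))))%C
  <= INR n * (delta * e).
Proof.
  intros Hu Hd H. set (F := fun t => (u t * cis (nu * t))%C).
  assert (CF : ccont F) by (apply ccont_mult; auto; apply ccont_cis).
  induction n as [|n IH].
  - simpl. replace (a - delta / 2 + 0 * delta) with (a - delta / 2) by ring.
    rewrite CI_point. replace (0 - block nu delta * 0)%C with (RtoC 0) by ring. rewrite Cmod_0; lra.
  - rewrite S_INR. simpl csum. set (c := a + INR n * delta).
    rewrite <- (CI_Chasles F _ (a - delta / 2 + INR n * delta)) by auto.
    set (A := CI F (a - delta / 2) (a - delta / 2 + INR n * delta)) in *.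
    match goal with |- Cmod (A + ?I - block nu delta * (?s + ?t)) <= _ =>
      replace (A + I - block nu delta * (s + t))%C with ((A - block nu delta * s) + (I - block nu delta * t))%C by ring end.
    eapply Rle_trans; [apply Cmod_triangle|].
    replace ((INR n + 1) * (delta * e)) with (INR n * (delta * e) + delta * e) by ring.
    apply Rplus_le_compat; [exact IH|].
    replace (a - delta / 2 + INR n * delta) with (- (delta / 2) + c) by (unfold c; ring).
    replace (a - delta / 2 + (INR n + 1) * delta) with (delta / 2 + c) by (unfold c; field).
    rewrite <- (CI_shift F) by auto. unfold block.
    replace (CI (fun t => cis (nu * t)) (- (delta / 2)) (delta / 2) * (u c * cis (nu * c)))%C
      with (CI (fun t => (u c * cis (nu * c)) * cis (nu * t))%C (- (delta / 2)) (delta / 2))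
      by (rewrite CI_scal by apply ccont_cis; ring).
    rewrite <- CI_minus by (try apply ccont_term; now apply ccont_shift).
    replace (delta * e) with ((delta / 2 - - (delta / 2)) * e) by field.
    apply CI_bound.
    + apply ccont_minus; [now apply ccont_shift|apply ccont_term].
    + lra.
    + intros t Ht. unfold F. replace (nu * (t + c)) with (nu * c + nu * t) by ring. rewrite cis_plus.
      replace (u (t + c)%R * (cis (nu * c) * cis (nu * t)) - u c * cis (nu * c) * cis (nu * t))%C
        with ((u (t + c)%R - u c) * (cis (nu * c) * cis (nu * t)))%C by ring.
      rewrite !Cmod_mult, !Cmod_cis, !Rmult_1_r. apply H.
      replace (t + c - c) with t by ring. apply Rabs_le; lra.
Qed.

Lemma cos_lower x : 1 - x * x / 2 <= cos x.
Proof.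
  replace x with (2 * (x / 2)) at 3 by field. rewrite cos_2a_sin.
  pose proof (Rabs_sin_le (x / 2)) as H. apply Rsqr_le_abs_1 in H. unfold Rsqr in H. lra.
Qed.

(** Integrating [1 - x * x / 2 <= cos x] gives [delta * (1 - (nu * delta) ^ 2 / 24)], and [PI <= 4]
    makes the bracket at least [1 / 3]. *)
Lemma block_lower nu delta : 0 < delta -> Rabs nu * delta <= PI -> delta / 3 <= Cmod (block nu delta).
Proof.
  intros Hd Hn. eapply Rle_trans; [|apply re_le_Cmod]. eapply Rle_trans; [|apply Rle_abs].
  assert (I : is_RInt (fun t => 1 - nu * t * (nu * t) / 2) (- (delta / 2)) (delta / 2)
     (delta - nu * nu * (delta * delta * delta) / 24)).
  { replace (delta - nu * nu * (delta * delta * delta) / 24) with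
      (minus (delta / 2 - nu * nu * ((delta / 2) ^ 3) / 6) (- (delta / 2) - nu * nu * ((- (delta / 2)) ^ 3) / 6))
      by (unfold minus, plus, opp; simpl; field).
    apply (@is_RInt_derive R_CompleteNormedModule (fun t => t - nu * nu * (t ^ 3) / 6)).
    - intros x _. auto_derive; auto. field.
    - intros x _. apply (@ex_derive_continuous R_AbsRing R_NormedModule). auto_derive; auto. }
  assert (Le : delta - nu * nu * (delta * delta * delta) / 24 <= Re (block nu delta)).
  { unfold block. rewrite Re_CI by apply ccont_cis. rewrite <- (is_RInt_unique _ _ _ _ I).
    apply RInt_le.
    - lra.
    - eexists; exact I.
    - apply (@ex_RInt_continuous R_CompleteNormedModule); intros t _; apply (ccont_cis nu t).
    - intros x _. simpl. apply cos_lower. }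
  eapply Rle_trans; [|exact Le].
  assert (Q : (Rabs nu * delta) * (Rabs nu * delta) <= 16).
  { pose proof PI_4. pose proof (Rabs_pos nu). assert (0 <= Rabs nu * delta) by nra. nra. }
  replace (nu * nu * (delta * delta * delta)) with (delta * ((Rabs nu * delta) * (Rabs nu * delta))).
  - nra.
  - assert (Rabs nu * Rabs nu = nu * nu) by (rewrite <- Rabs_mult; apply Rabs_pos_eq, Rle_0_sqr).
    replace (Rabs nu * delta * (Rabs nu * delta)) with ((Rabs nu * Rabs nu) * (delta * delta)) by ring.
    rewrite H; ring.
Qed.

(** On samples of step [delta] every angle [theta] is realised by a frequency in
    [[-PI / delta, PI / delta]], so [windows_small] is uniform in [theta]. The window integral and
    the Riemann error each contribute [eta / 6], and dividing by the block costs a factor 3. *)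
Lemma samples_trig_small D u B : ap_system D -> controls D u -> ccont u -> cbounded B u ->
  (forall nu, is_umean (fun t => u t * cis (nu * t))%C 0) ->
  forall eta, 0 < eta -> exists d1, 0 < d1 /\ forall delta, 0 < delta <= d1 ->
    exists N0, forall N, (N0 <= N)%nat -> forall theta,
      Cmod (trig N (fun k => u (INR k * delta)%R) theta) <= eta * INR N.
Proof.
  intros HD Hc Hu HB H0 eta He.
  destruct (ap_unif_cont D u HD Hc Hu (eta / 6)) as [rho [Pr Kr]]; [lra|].
  exists rho; split; auto. intros delta Hd.
  destruct (windows_small u B Hu HB H0 (PI / delta) (eta / 6)) as [T [PT KT]]; [lra|].
  destruct (enough_multiples T delta) as [N0 HN0]; [lra|].
  exists N0. intros N HN theta.
  assert (HNT := HN0 N HN).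
  destruct (cis_bounded_arg theta) as [y [Hy Ey]].
  set (nu := y / delta).
  assert (Hnu : - (PI / delta) <= nu <= PI / delta).
  { unfold nu. replace (- (PI / delta)) with ((- PI) / delta) by (field; lra).
    assert (0 < / delta) by (apply Rinv_0_lt_compat; lra).
    unfold Rdiv; split; apply Rmult_le_compat_r; lra. }
  pose proof (riemann_sum_close u nu delta (eta / 6) 0 N Hu (proj1 Hd)) as R.
  assert (R' : Cmod (CI (fun t => u t * cis (nu * t))%C (0 - delta / 2) (0 - delta / 2 + INR N * delta)
    - block nu delta * trig N (fun k => u (INR k * delta)%R) theta)%C <= INR N * (delta * (eta / 6))).
  { replace (trig N (fun k => u (INR k * delta)%R) theta) with
      (csum N (fun k => u (0 + INR k * delta)%R * cis (nu * (0 + INR k * delta))))%C.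
    - apply R. intros s t Hst. apply Kr. lra.
    - unfold trig. apply csum_ext. intros k _. rewrite Rplus_0_l. f_equal.
      rewrite <- (cis_pow theta), Ey, cis_pow. f_equal. unfold nu; field; lra. }
  pose proof (KT nu Hnu (0 - delta / 2) (INR N * delta) HNT) as W. unfold win in W.
  set (I := CI (fun t => u t * cis (nu * t))%C (0 - delta / 2) (0 - delta / 2 + INR N * delta)) in *.
  set (U := trig N (fun k => u (INR k * delta)%R) theta) in *.
  assert (BL : delta / 3 <= Cmod (block nu delta)).
  { apply block_lower; [lra|]. unfold nu. rewrite Rabs_div by lra. rewrite (Rabs_pos_eq delta) by lra.
    replace (Rabs y / delta * delta) with (Rabs y) by (field; lra). apply Rabs_le; lra. }
  pose proof (Cmod_le_sub (block nu delta * U) I) as X. rewrite Cmod_minus_sym in X.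
  rewrite Cmod_mult in X.
  pose proof (Cmod_ge_0 U). pose proof (pos_INR N).
  assert (delta / 3 * Cmod U <= Cmod (block nu delta) * Cmod U) by (now apply Rmult_le_compat_r).
  apply Rmult_le_reg_l with (delta / 3); [lra|]. lra.
Qed.

Lemma Re_win_mult F c a n L : ccont F -> (forall a, c <= Re (win F a L)) ->
  INR n * c <= Re (win F a (INR n * L)).
Proof.
  intros HF H. induction n as [|n IH].
  - unfold win; change (INR 0) with 0. replace (a + 0 * L) with a by ring. rewrite CI_point. unfold Re, RtoC; simpl; lra.
  - rewrite S_INR. unfold win. rewrite <- (CI_Chasles F a (a + INR n * L)) by auto.
    replace (a + (INR n + 1) * L) with (a + INR n * L + L) by ring.
    specialize (H (a + INR n * L)). unfold win in *.
    change (Re (CI F a (a + INR n * L) + CI F (a + INR n * L) (a + INR n * L + L))) with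
     (Re (CI F a (a + INR n * L)) + Re (CI F (a + INR n * L) (a + INR n * L + L))). lra.
Qed.

Lemma Re_CI_lower F a b c : ccont F -> a <= b -> (forall t, a <= t <= b -> c <= Re (F t)) ->
  (b - a) * c <= Re (CI F a b).
Proof.
  intros HF Hab H. rewrite Re_CI by auto.
  replace ((b - a) * c) with (RInt (fun _ => c) a b) by (rewrite RInt_const; reflexivity).
  apply RInt_le; auto.
  - apply ex_RInt_const.
  - apply (@ex_RInt_continuous R_CompleteNormedModule); intros t _; apply (HF t).
  - intros x Hx; apply H; lra.
Qed.

(** The positive value at [t0] recurs, up to half its size and on an interval of length [rho], in
    every window of length [l + rho]. *)
Lemma positive_mean D g m t0 : ap_system D -> controls D g -> ccont g ->
  (forall t, 0 <= Re (g t)) -> 0 < Re (g t0) -> is_umean g m -> 0 < Re m.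
Proof.
  intros HD Hc Hg Hpos Ht0 Hm. set (c := Re (g t0) / 2). assert (Pc : 0 < c) by (unfold c; lra).
  destruct (ap_unif_cont D g HD Hc Hg (c / 2)) as [rho [Pr Kr]]; [lra|].
  destruct (Hc (c / 2)) as [eta [Pe Ke]]; [lra|].
  destruct (proj1 HD eta Pe) as [l [Pl Kl]].
  set (L := l + rho).
  assert (Win : forall a, rho * c <= Re (win g a L)).
  { intro a. destruct (Kl (a - t0)) as [tau [Ht Dt]]. set (b := t0 + tau).
    assert (Hab : a <= b <= a + l) by (unfold b; lra).
    unfold win. rewrite <- (CI_Chasles g a b) by auto. rewrite <- (CI_Chasles g b (b + rho)) by auto.
    change (Re (CI g a b + (CI g b (b + rho) + CI g (b + rho) (a + L)))) with
      (Re (CI g a b) + (Re (CI g b (b + rho)) + Re (CI g (b + rho) (a + L)))).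
    assert (A1 : (b - a) * 0 <= Re (CI g a b)) by (apply Re_CI_lower; auto; lra).
    assert (A2 : (a + L - (b + rho)) * 0 <= Re (CI g (b + rho) (a + L)))
      by (apply Re_CI_lower; auto; unfold L; lra).
    assert (A3 : (b + rho - b) * c <= Re (CI g b (b + rho))).
    { apply Re_CI_lower; auto; [lra|]. intros t Htb.
      assert (E1 := Kr t b ltac:(apply Rabs_le; lra)). assert (E2 := Ke tau Dt t0).
      fold b in E2.
      apply (Rle_trans _ _ _ (re_le_Cmod _)), Rabs_le_between in E1.
      apply (Rle_trans _ _ _ (re_le_Cmod _)), Rabs_le_between in E2.
      change (Re (g t - g b)) with (Re (g t) - Re (g b)) in E1.
      change (Re (g b - g t0)) with (Re (g b) - Re (g t0)) in E2. unfold c in *; lra. }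
    lra. }
  assert (PL : 0 < L) by (unfold L; lra).
  set (k := rho * c / L). assert (Pk : 0 < k) by (apply Rdiv_lt_0_compat; nra).
  destruct (Hm (k / 2)) as [S0 [PS KS]]; [lra|].
  destruct (enough_multiples S0 L PL) as [n Hn].
  assert (HS : S0 <= INR (S n) * L) by (apply Hn; lia).
  specialize (KS 0 _ HS).
  pose proof (Re_win_mult g (rho * c) 0 (S n) L Hg Win) as W.
  assert (PN : 0 < INR (S n)) by (apply lt_0_INR; lia).
  assert (E : k <= Re (avg g 0 (INR (S n) * L))).
  { unfold avg. rewrite Re_scal. apply Rmult_le_reg_l with (INR (S n) * L); [nra|].
    rewrite <- Rmult_assoc, Rinv_r, Rmult_1_l by nra. unfold k.
    replace (INR (S n) * L * (rho * c / L)) with (INR (S n) * (rho * c)) by (field; lra). exact W. }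
  apply (Rle_trans _ _ _ (re_le_Cmod _)), Rabs_le_between in KS.
  change (Re (avg g 0 (INR (S n) * L) - m)) with (Re (avg g 0 (INR (S n) * L)) - Re m) in KS. lra.
Qed.

Lemma sampled_mean D g m : ap_system D -> controls D g -> ccont g -> is_umean g m -> 0 < Re m ->
  exists d1, 0 < d1 /\ forall delta, 0 < delta <= d1 -> exists N0, forall N, (N0 <= N)%nat ->
    Re m / 2 * INR N <= rsum N (fun k => Re (g (INR k * delta))).
Proof.
  intros HD Hc Hg Hm Pm. set (e := Re m / 4).
  destruct (ap_unif_cont D g HD Hc Hg e) as [rho [Pr Kr]]; [unfold e; lra|].
  exists rho; split; auto. intros delta Hd.
  destruct (Hm e) as [T [PT KT]]; [unfold e; lra|].
  destruct (enough_multiples T delta) as [N0 HN0]; [lra|].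
  exists (S N0). intros N HN.
  assert (PN : 0 < INR N) by (apply lt_0_INR; lia).
  assert (HNT : T <= INR N * delta) by (apply HN0; lia).
  (* At frequency 0 the block is [delta], so the comparison becomes an ordinary Riemann sum. *)
  pose proof (riemann_sum_close g 0 delta e 0 N Hg (proj1 Hd)
    ltac:(intros s t Hst; apply Kr; lra)) as R.
  specialize (KT (0 - delta / 2) _ HNT). unfold avg, win in KT.
  rewrite (CI_ext (fun t => g t * cis (0 * t))%C g) in R
    by (intro t; rewrite Rmult_0_l, cis_0; ring).
  assert (Bl : block 0 delta = RtoC delta).
  { unfold block. rewrite (CI_ext _ (fun _ => RtoC 1)) by (intro; now rewrite Rmult_0_l, cis_0).
    rewrite CI_const, Cmult_1_r. f_equal; field. }
  rewrite Bl in R.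
  rewrite (csum_ext _ _ (fun k => g (INR k * delta)%R)) in R
    by (intros k _; rewrite Rmult_0_l, cis_0, Rplus_0_l; ring).
  set (I := CI g (0 - delta / 2) (0 - delta / 2 + INR N * delta)) in *.
  set (Sg := csum N (fun k => g (INR k * delta)%R)) in *.
  replace (rsum N (fun k => Re (g (INR k * delta)))) with (Re Sg) by (unfold Sg; apply Re_csum).
  apply (Rle_trans _ _ _ (re_le_Cmod _)), Rabs_le_between in R.
  apply (Rle_trans _ _ _ (re_le_Cmod _)), Rabs_le_between in KT.
  change (Re (I - RtoC delta * Sg)) with (Re I - Re (RtoC delta * Sg)%C) in R.
  change (Re (RtoC (/ (INR N * delta)) * I - m)) with (Re (RtoC (/ (INR N * delta)) * I)%C - Re m) in KT.
  rewrite Re_scal in R. rewrite Re_scal in KT.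
  assert (P : 0 < INR N * delta) by nra.
  assert (Y : INR N * delta * (Re m - e) <= Re I).
  { apply Rmult_le_reg_l with (/ (INR N * delta)); [now apply Rinv_0_lt_compat|].
    rewrite <- Rmult_assoc, Rinv_l, Rmult_1_l by lra. lra. }
  apply Rmult_le_reg_l with delta; [lra|]. unfold e in *. nra.
Qed.

(** * The uniqueness theorem *)

(** [d y] is the supremum over [t] of the distance between [u (t + y)] and [u t]. The last property
    makes [d] almost periodic with the almost periods of [u], so that a cutoff built from it has a
    mean. *)
Lemma ap_translation_distance D u B : ap_system D -> controls D u -> ccont u -> cbounded B u ->
  exists d : R -> R,
    (forall y t, Cmod (u (t + y)%R - u t) <= d y) /\ d 0 = 0 /\
    (forall eps, 0 < eps -> exists rho, 0 < rho /\ forall y, Rabs y <= rho -> d y <= eps) /\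
    (forall eps, 0 < eps -> exists eta, 0 < eta /\ forall tau, D eta tau -> d tau <= eps) /\
    (forall y z, Rabs (d (y + z) - d y) <= d z).
Proof.
  intros HD Hc Hu HB.
  assert (Ex : forall y, exists r, is_lub (fun x => exists t, x = Cmod (u (t + y)%R - u t)) r).
  { intro y. destruct (completeness (fun x => exists t, x = Cmod (u (t + y)%R - u t))) as [r Hr].
    - exists (B + B). intros x [t ->]. eapply Rle_trans; [apply Cmod_triangle_minus|].
      pose proof (HB (t + y)); pose proof (HB t); lra.
    - eexists; exists 0; reflexivity.
    - now exists r. }
  destruct (function_choice _ Ex) as [d Hd].
  assert (Up : forall y t, Cmod (u (t + y)%R - u t) <= d y)
    by (intros y t; apply (proj1 (Hd y)); now exists t).
  assert (Low : forall y M, (forall t, Cmod (u (t + y)%R - u t) <= M) -> d y <= M)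
    by (intros y M H; apply (proj2 (Hd y)); intros x [t ->]; auto).
  exists d. split; [exact Up|]. split; [|split; [|split]].
  - apply Rle_antisym.
    + apply Low. intro t. rewrite Rplus_0_r.
      replace (u t - u t)%C with (RtoC 0) by ring. rewrite Cmod_0; lra.
    + eapply Rle_trans; [apply Cmod_ge_0|apply (Up 0 0)].
  - intros eps He. destruct (ap_unif_cont D u HD Hc Hu eps He) as [rho [Pr Kr]].
    exists rho; split; auto. intros y Hy. apply Low. intro t. apply Kr.
    replace (t + y - t) with y by ring; auto.
  - intros eps He. destruct (Hc eps He) as [eta [Pe Ke]]. exists eta; split; auto.
  - intros y z. apply Rabs_le. split.
    + assert (d y <= d (y + z) + d z); [|lra]. apply Low. intro t.
      pose proof (Up (y + z) t) as E1. pose proof (Up z (t + y)) as E2.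
      replace (t + (y + z)) with (t + y + z) in E1 by ring.
      rewrite Cmod_minus_sym in E2.
      pose proof (Cmod_dist_triangle (u (t + y)%R) (u (t + y + z)%R) (u t)). lra.
    + assert (d (y + z) <= d y + d z); [|lra]. apply Low. intro t.
      pose proof (Up y t) as E1. pose proof (Up z (t + y)) as E2.
      replace (t + (y + z)) with (t + y + z) by ring.
      pose proof (Cmod_dist_triangle (u (t + y + z)%R) (u (t + y)%R) (u t)). lra.
Qed.

Lemma controls_conj D u : controls D u -> controls D (fun t => Cconj (u t)).
Proof.
  intros H eps He. destruct (H eps He) as [eta [P K]]. exists eta; split; auto.
  intros tau Ht t.
  replace (Cconj (u (t + tau)%R) - Cconj (u t))%C with (Cconj (u (t + tau)%R - u t)).
  - rewrite Cmod_conj; auto.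
  - unfold Cconj, Cminus, Cplus, Copp; simpl; f_equal; ring.
Qed.

Lemma hat_lip e a b : Rabs (Rmax 0 (e - a) - Rmax 0 (e - b)) <= Rabs (a - b).
Proof.
  unfold Rmax, Rabs. repeat destruct (Rle_dec _ _); repeat destruct (Rcase_abs _); lra.
Qed.

Lemma correlation_lower n (psi : nat -> R) (w : nat -> C) (u : nat -> C) e :
  (forall x, (x < n)%nat -> 0 <= psi x) ->
  (forall x t, (x < n)%nat -> (t < n)%nat -> 0 < psi x ->
     Cmod (w t) * Cmod (w t) - e <= Re (Cconj (w t) * u (x + t)%nat)%C) ->
  rsum n psi * (rsum n (fun t => Cmod (w t) * Cmod (w t)) - INR n * e)
  <= Re (csum n (fun x => csum n (fun t => RtoC (psi x) * Cconj (w t) * u (x + t)%nat)))%C.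
Proof.
  intros Hp H. rewrite Re_csum.
  set (Q := rsum n (fun t => Cmod (w t) * Cmod (w t)) - INR n * e).
  rewrite Rmult_comm, <- rsum_scal. apply rsum_le. intros x Hx.
  rewrite Re_csum.
  replace (Q * psi x) with (rsum n (fun t => psi x * (Cmod (w t) * Cmod (w t) - e))).
  - apply rsum_le. intros t Ht. rewrite <- Cmult_assoc, Re_scal.
    destruct (Rle_lt_or_eq_dec _ _ (Hp x Hx)) as [P|P].
    + apply Rmult_le_compat_l; auto.
    + rewrite <- P; lra.
  - rewrite rsum_scal. unfold Q, Rminus.
    rewrite (rsum_plus n (fun t => Cmod (w t) * Cmod (w t)) (fun _ => - e)), rsum_const. ring.
Qed.

(* If all mean Fourier coefficients vanish then, by compactness,
   the trigonometric sums of finely sampled values of [u] are uniformly small, so [u] does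
   not correlate with its translates on average; but it does correlate with its translates
   by almost periods, which have positive density. *)
Theorem ap_uniqueness D u B : ap_system D -> controls D u -> ccont u -> cbounded B u ->
  (forall nu, is_umean (fun t => u t * cis (nu * t))%C 0) -> forall t, u t = RtoC 0.
Proof.
  intros HD Hc Hu HB H0 t0. apply NNPP. intro Hne.
  assert (B0 : 0 <= B) by (eapply Rle_trans; [apply Cmod_ge_0|apply (HB 0)]).
  set (g := fun t => (u t * Cconj (u t))%C).
  assert (Cg : ccont g) by (apply ccont_mult; auto; now apply ccont_conj).
  assert (Cjg : controls D g).
  { apply (controls_mult D B B); auto; [|now apply controls_conj].
    intro t; rewrite Cmod_conj; auto. }
  assert (Reg : forall t, Re (g t) = Cmod (u t) * Cmod (u t))
    by (intro t; unfold g; rewrite Cmult_conj_mod; reflexivity).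
  destruct (umean_exists D g (B * B)) as [m1 Hm1]; auto.
  { intro t. unfold g. rewrite Cmod_mult, Cmod_conj.
    apply Rmult_le_compat; auto; apply Cmod_ge_0. }
  assert (P1 : 0 < Re m1).
  { apply (positive_mean D g m1 t0); auto.
    - intro t; rewrite Reg; pose proof (Cmod_ge_0 (u t)); nra.
    - rewrite Reg. apply Cmod_gt_0 in Hne. nra. }
  (* Translates within [e] lose at most [B * e <= Re m1 / 8] of correlation, which keeps at least
     half of the sampled mean [Re m1 / 2] of the squared modulus. *)
  set (e := Re m1 / (8 * (B + 1))).
  assert (Pe : 0 < e) by (apply Rdiv_lt_0_compat; lra).
  assert (Be : B * e <= Re m1 / 8).
  { unfold e. replace (B * (Re m1 / (8 * (B + 1)))) with (Re m1 / 8 * (B / (B + 1))) by (field; lra).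
    assert (B / (B + 1) <= 1); [|nra].
    apply Rmult_le_reg_r with (B + 1); [lra|]. unfold Rdiv; rewrite Rmult_assoc, Rinv_l by lra. lra. }
  destruct (ap_translation_distance D u B HD Hc Hu HB) as [d [D1 [D2 [D3 [D4 D5]]]]].
  (* A continuous substitute for the indicator of the [e]-almost periods; its positive mean
     expresses that these have positive density. *)
  set (psi := fun y => Rmax 0 (e - d y)).
  assert (Pp : forall y, 0 <= psi y) by (intro; apply Rmax_l).
  assert (Pe2 : forall y, psi y <= e).
  { intro y. apply Rmax_lub; [lra|]. pose proof (Rle_trans _ _ _ (Cmod_ge_0 _) (D1 y 0)). lra. }
  set (G := fun y => RtoC (psi y)).
  assert (Gd : forall y z, Cmod (G (y + z)%R - G y) <= d z).
  { intros y z. unfold G. rewrite <- RtoC_minus, Cmod_R.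
    eapply Rle_trans; [apply hat_lip|apply D5]. }
  assert (CG : ccont G).
  { apply ccont_eps. intros t eps He. destruct (D3 (eps / 2)) as [rho [Pr Kr]]; [lra|].
    exists rho; split; auto. intros s Hs. specialize (Gd t (s - t)).
    replace (t + (s - t)) with s in Gd by ring. specialize (Kr (s - t) ltac:(lra)). lra. }
  assert (CjG : controls D G).
  { intros eps He. destruct (D4 eps He) as [eta [Q K]]. exists eta; split; auto.
    intros tau Ht t. eapply Rle_trans; [apply Gd|auto]. }
  destruct (umean_exists D G e) as [m2 Hm2]; auto.
  { intro t. unfold G. rewrite Cmod_R, Rabs_pos_eq; auto. }
  assert (P2 : 0 < Re m2).
  { apply (positive_mean D G m2 0); auto.
    unfold G, psi. rewrite D2, Rminus_0_r, Rmax_right by lra. exact Pe. }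
  (* The correlation is at least [Re m1 * Re m2 / 8] times [N ^ 2], while the trilinear bound allows
     [eta * (e * e + B * B)] times [N ^ 2], which this choice keeps below [Re m1 * Re m2 / 16]. *)
  set (eta := Re m1 * Re m2 / (16 * (e * e + B * B + 1))).
  assert (Peta : 0 < eta) by (apply Rdiv_lt_0_compat; nra).
  destruct (sampled_mean D g m1) as [d1 [Q1 K1]]; auto.
  destruct (sampled_mean D G m2) as [d2 [Q2 K2]]; auto.
  destruct (samples_trig_small D u B HD Hc Hu HB H0 eta Peta) as [d3 [Q3 K3]].
  set (delta := Rmin d1 (Rmin d2 d3)).
  assert (Pd : 0 < delta) by (repeat apply Rmin_pos; auto).
  assert (L1 : delta <= d1) by apply Rmin_l.
  assert (L2 : delta <= d2) by (eapply Rle_trans; [apply Rmin_r|apply Rmin_l]).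
  assert (L3 : delta <= d3) by (eapply Rle_trans; [apply Rmin_r|apply Rmin_r]).
  destruct (K1 delta (conj Pd L1)) as [N1 M1]. destruct (K2 delta (conj Pd L2)) as [N2 M2].
  destruct (K3 delta (conj Pd L3)) as [N3 M3].
  set (N := (N1 + N2 + N3 + 1)%nat).
  specialize (M1 N ltac:(lia)). specialize (M2 N ltac:(lia)). specialize (M3 (2 * N)%nat ltac:(lia)).
  assert (PN : 0 < INR N) by (apply lt_0_INR; lia).
  set (uu := fun k => u (INR k * delta)%R).
  set (ps := fun k => psi (INR k * delta)).
  assert (Low := correlation_lower N ps uu uu (B * e)).
  assert (Up := trilinear_bound N (fun x => RtoC (ps x)) (fun t => Cconj (uu t)) uu (eta * INR (2 * N))
    ltac:(apply Rmult_le_pos; [lra|apply pos_INR]) M3).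
  assert (X1 : rsum N ps * (rsum N (fun t => Cmod (uu t) * Cmod (uu t)) - INR N * (B * e))
    <= eta * INR (2 * N) * (INR N * (e * e) + INR N * (B * B)) / 2).
  { eapply Rle_trans; [apply Low|].
    - intros x _; apply Pp.
    - intros x t _ _ Hx. unfold uu.
      assert (Hdx : d (INR x * delta) < e).
      { unfold ps, psi, Rmax in Hx. destruct (Rle_dec 0 (e - d (INR x * delta))); lra. }
      rewrite plus_INR. replace ((INR x + INR t) * delta) with (INR t * delta + INR x * delta) by ring.
      set (a := u (INR t * delta)). set (b := u (INR t * delta + INR x * delta)%R).
      assert (Eab : Cmod (b - a) <= e) by (eapply Rle_trans; [apply D1|lra]).
      replace (Cconj a * b)%C with (a * Cconj a + Cconj a * (b - a))%C by ring.
      rewrite Cmult_conj_mod.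
      change (Re (RtoC (Cmod a * Cmod a) + Cconj a * (b - a))) with
        (Cmod a * Cmod a + Re (Cconj a * (b - a))%C).
      pose proof (re_le_Cmod (Cconj a * (b - a))) as E. rewrite Cmod_mult, Cmod_conj in E.
      apply Rabs_le_between in E.
      assert (Cmod a * Cmod (b - a) <= B * e)
        by (apply Rmult_le_compat; [apply Cmod_ge_0|apply Cmod_ge_0|apply HB|exact Eab]).
      lra.
    - eapply Rle_trans; [apply Rle_abs|]. eapply Rle_trans; [apply re_le_Cmod|].
      eapply Rle_trans; [exact Up|]. unfold Rdiv. apply Rmult_le_compat_r; [lra|].
      apply Rmult_le_compat_l; [apply Rmult_le_pos; [lra|apply pos_INR]|].
      rewrite <- !rsum_const. apply Rplus_le_compat; apply rsum_le; intros k _.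
      + rewrite Cmod_R, Rabs_pos_eq by apply Pp. apply Rmult_le_compat; try apply Pp; apply Pe2.
      + rewrite Cmod_conj. apply Rmult_le_compat; try apply Cmod_ge_0; apply HB. }
  assert (X2 : Re m1 / 2 * INR N <= rsum N (fun t => Cmod (uu t) * Cmod (uu t))).
  { eapply Rle_trans; [exact M1|]. right. apply rsum_ext. intros k _. apply Reg. }
  assert (X3 : Re m2 / 2 * INR N <= rsum N ps) by exact M2.
  assert (X4 : (Re m2 / 2 * INR N) * (Re m1 / 4 * INR N)
     <= eta * INR (2 * N) * (INR N * (e * e) + INR N * (B * B)) / 2).
  { eapply Rle_trans; [|exact X1].
    apply Rmult_le_compat; auto; try nra. }
  rewrite mult_INR in X4. simpl (INR 2) in X4.
  set (K := e * e + B * B + 1) in *.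
  assert (PK : 1 <= K) by (unfold K; nra).
  assert (Ee : eta * K = Re m1 * Re m2 / 16) by (unfold eta; field; lra).
  replace (eta * ((1 + 1) * INR N) * (INR N * (e * e) + INR N * (B * B)) / 2)
    with (eta * (K - 1) * (INR N * INR N)) in X4 by (unfold K; field).
  assert (PNN : 0 < INR N * INR N) by nra.
  assert (X5 : Re m1 * Re m2 / 8 * (INR N * INR N) <= eta * (K - 1) * (INR N * INR N)) by lra.
  apply Rmult_le_reg_r in X5; [|exact PNN]. nra.
Qed.

(** * Fejer products and Kronecker's theorem *)

Definition inj_below (N : nat) (lam : nat -> R) : Prop :=
  forall i j, (i < N)%nat -> (j < N)%nat -> lam i = lam j -> i = j.

Lemma Qcomb_seq (q : nat -> Q) (lam : nat -> R) N :
  Qcomb (map (fun i => (q i, lam i)) (seq 0 N)) = rsum N (fun i => Q2R (q i) * lam i).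
Proof.
  assert (App : forall l1 l2, Qcomb (l1 ++ l2) = Qcomb l1 + Qcomb l2).
  { intros l1 l2; unfold Qcomb. rewrite map_app, fold_right_app.
    induction (map (fun p : Q * R => Q2R (fst p) * snd p) l1) as [|x l IH]; simpl; [ring|].
    rewrite IH; ring. }
  induction N as [|N IH]; [reflexivity|].
  rewrite seq_S, map_app, App, IH. unfold Qcomb; simpl. ring.
Qed.

Lemma Qlin_indep_seq L lam N q : Qlin_indep L -> inj_below N lam ->
  (forall i, (i < N)%nat -> L (lam i)) -> rsum N (fun i => Q2R (q i) * lam i) = 0 ->
  forall i, (i < N)%nat -> (q i == 0)%Q.
Proof.
  intros HL Hi HLi H0 i Hlt.
  apply (HL (map (fun i => (q i, lam i)) (seq 0 N))) with (p := (q i, lam i)).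
  - intros p Hp. apply in_map_iff in Hp. destruct Hp as [j [<- Hj]]. apply in_seq in Hj.
    simpl; apply HLi; lia.
  - rewrite map_map. simpl. apply NoDup_map_NoDup_ForallPairs; [|apply seq_NoDup].
    intros a b Ha Hb E. apply in_seq in Ha. apply in_seq in Hb. apply Hi; auto; lia.
  - now rewrite Qcomb_seq.
  - apply (in_map (fun i => (q i, lam i))). apply in_seq; lia.
Qed.

Lemma Q2R_inject_Z z : Q2R (inject_Z z) = IZR z.
Proof. unfold Q2R, inject_Z; simpl. field. Qed.

Lemma Zlin_indep_seq L lam N (c : nat -> Z) : Qlin_indep L -> inj_below N lam ->
  (forall i, (i < N)%nat -> L (lam i)) -> rsum N (fun i => IZR (c i) * lam i) = 0 ->
  forall i, (i < N)%nat -> c i = 0%Z.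
Proof.
  intros HL Hi HLi H0 i Hlt.
  assert (E : (inject_Z (c i) == 0)%Q).
  { apply (Qlin_indep_seq L lam N (fun i => inject_Z (c i))); auto.
    rewrite <- H0. apply rsum_ext. intros; now rewrite Q2R_inject_Z. }
  apply inject_Z_injective. exact E.
Qed.

Lemma Qlin_indep_nonzero L x : Qlin_indep L -> L x -> x <> 0.
Proof.
  intros HL Hx ->.
  assert (E := Zlin_indep_seq L (fun _ => 0) 1 (fun _ => 1%Z) HL).
  specialize (E ltac:(intros i j Hi Hj _; lia) ltac:(intros; exact Hx)).
  specialize (E ltac:(simpl; ring) 0%nat ltac:(lia)). discriminate.
Qed.

Lemma rsum_update N (f : nat -> R) i0 x : (i0 < N)%nat ->
  rsum N (fun i => f i - (if Nat.eq_dec i i0 then x else 0)) = rsum N f - x.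
Proof.
  induction N as [|N IH]; intro H; [lia|]. simpl.
  destruct (Nat.eq_dec N i0) as [->|Hn].
  - replace (rsum i0 (fun i => f i - (if Nat.eq_dec i i0 then x else 0))) with (rsum i0 f); [ring|].
    apply rsum_ext. intros k Hk. destruct (Nat.eq_dec k i0); [lia|ring].
  - rewrite IH by lia. ring.
Qed.

(** Determines which integer combinations of independent frequencies can meet the spectrum: the
    trivial one and single frequencies with coefficient 1. *)
Lemma comb_in_basis L lam N (c : nat -> Z) mu : Qlin_indep L -> inj_below N lam ->
  (forall i, (i < N)%nat -> L (lam i)) -> rsum N (fun i => IZR (c i) * lam i) = mu ->
  L mu \/ mu = 0 ->
  (forall i, (i < N)%nat -> c i = 0%Z) \/
  exists i0, (i0 < N)%nat /\ lam i0 = mu /\ c i0 = 1%Z /\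
    forall i, (i < N)%nat -> i <> i0 -> c i = 0%Z.
Proof.
  intros HL Hi HLi Hmu [Lmu|Z0].
  2:{ left. apply (Zlin_indep_seq L lam N c); auto. now rewrite Hmu. }
  right. destruct (classic (exists i0, (i0 < N)%nat /\ lam i0 = mu)) as [[i0 [H1 H2]]|Hno].
  - exists i0. split; auto. split; auto.
    assert (E := Zlin_indep_seq L lam N (fun i => (c i - (if Nat.eq_dec i i0 then 1 else 0))%Z) HL Hi HLi).
    assert (Hs : rsum N (fun i => IZR (c i - (if Nat.eq_dec i i0 then 1 else 0)) * lam i) = 0).
    { rewrite (rsum_ext _ _ (fun i => IZR (c i) * lam i - (if Nat.eq_dec i i0 then mu else 0))).
      - rewrite rsum_update, Hmu by auto. ring.
      - intros k Hk. rewrite minus_IZR. destruct (Nat.eq_dec k i0) as [->|]; [rewrite H2|]; ring. }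
    specialize (E Hs). split.
    + specialize (E i0 H1). simpl in E. destruct (Nat.eq_dec i0 i0); [lia|congruence].
    + intros i Hlt Hne. specialize (E i Hlt). simpl in E. destruct (Nat.eq_dec i i0); [congruence|lia].
  - exfalso.
    (* Here [mu] lies in [L] but is not among the listed frequencies. Appending it with coefficient
       -1 gives a nontrivial vanishing relation. *)
    assert (E := Zlin_indep_seq L (fun i => if Nat.eq_dec i N then mu else lam i) (S N)
      (fun i => if Nat.eq_dec i N then (-1)%Z else c i) HL).
    assert (A1 : inj_below (S N) (fun i => if Nat.eq_dec i N then mu else lam i)).
    { intros i j Hi' Hj'. destruct (Nat.eq_dec i N), (Nat.eq_dec j N); intro H; subst; auto.
      - exfalso; apply Hno. exists j; split; auto; lia.
      - exfalso; apply Hno. exists i; split; auto; lia.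
      - apply Hi; auto; lia. }
    assert (A2 : forall i, (i < S N)%nat -> L (if Nat.eq_dec i N then mu else lam i)).
    { intros i Hlt. destruct (Nat.eq_dec i N); auto. apply HLi; lia. }
    specialize (E A1 A2).
    assert (Hs : rsum (S N) (fun i => IZR (if Nat.eq_dec i N then -1 else c i) *
       (if Nat.eq_dec i N then mu else lam i)) = 0).
    { simpl. destruct (Nat.eq_dec N N); [|congruence].
      rewrite (rsum_ext _ _ (fun i => IZR (c i) * lam i)).
      - rewrite Hmu; ring.
      - intros k Hk. destruct (Nat.eq_dec k N); [lia|auto]. }
    specialize (E Hs N ltac:(lia)). simpl in E. destruct (Nat.eq_dec N N); [discriminate|congruence].
Qed.

(** The Fejer kernel as an expanded square, [1 / n] times the squared modulus of the sum of
    [cis (i * x)] over [i < n]; the frequency [i - j] then appears explicitly. *)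
Definition fejer (n : nat) (x : R) : C :=
  (RtoC (/ INR n) * csum n (fun i => csum n (fun j => cis ((INR i - INR j) * x))))%C.

Lemma fejer_nonneg n x : (0 < n)%nat -> exists r, 0 <= r /\ fejer n x = RtoC r.
Proof.
  intro Hn. set (z := csum n (fun i => cis (INR i * x))).
  exists (/ INR n * (Cmod z * Cmod z)). split.
  - apply Rmult_le_pos; [apply Rlt_le, Rinv_0_lt_compat, lt_0_INR; auto|].
    pose proof (Cmod_ge_0 z); nra.
  - rewrite RtoC_mult, <- Cmult_conj_mod. unfold fejer. f_equal. unfold z.
    rewrite Cconj_csum, csum_mult. apply csum_ext; intros i _. apply csum_ext; intros j _.
    rewrite Cconj_cis, <- cis_plus. f_equal; ring.
Qed.

Section FejerProduct.
Variables (n : nat) (lam th : nat -> R).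
Hypothesis Hn : (0 < n)%nat.

Fixpoint fejer_prod (N : nat) (t : R) : C :=
  match N with
  | O => RtoC 1
  | S M => (fejer n (- (lam M * t) + th M) * fejer_prod M t)%C
  end.

(** The coefficient at [nu] of the product of a function with the kernels, computed formally from
    the coefficients [A] of the function. [fejer_pair_mean] identifies it with an actual mean. *)
Fixpoint fejer_pair (N : nat) (A : R -> C) (nu : R) : C :=
  match N with
  | O => A nu
  | S M => (RtoC (/ INR n) * csum n (fun i => csum n (fun j =>
      cis ((INR i - INR j) * th M) * fejer_pair M A (nu + (INR i - INR j) * lam M))))%C
  end.

Lemma fejer_prod_nonneg N t : exists r, 0 <= r /\ fejer_prod N t = RtoC r.
Proof.
  induction N as [|M [r [Hr IH]]]; simpl; [exists 1; split; auto; lra|].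
  destruct (fejer_nonneg n (- (lam M * t) + th M) Hn) as [s [Hs E]].
  exists (s * r). split; [nra|]. now rewrite E, IH, RtoC_mult.
Qed.

Lemma ccont_fejer_prod N : ccont (fejer_prod N).
Proof.
  induction N as [|M IH]; simpl; [apply ccont_const|].
  apply ccont_mult; auto. unfold fejer. apply ccont_mult; [apply ccont_const|].
  apply ccont_csum; intros i _. apply ccont_csum; intros j _.
  replace (fun t => cis ((INR i - INR j) * (- (lam M * t) + th M))) with
    (fun t => cis ((INR i - INR j) * th M) * cis ((- ((INR i - INR j) * lam M)) * t))%C.
  - apply ccont_term.
  - extensionality t. rewrite <- cis_plus. f_equal; ring.
Qed.

Lemma fejer_pair_mean F A N : ccont F ->
  (forall nu, is_umean (fun t => F t * cis (- nu * t))%C (A nu)) ->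
  forall nu, is_umean (fun t => F t * cis (- nu * t) * fejer_prod N t)%C (fejer_pair N A nu).
Proof.
  intros HF HA. induction N as [|M IH]; intro nu; simpl.
  - eapply umean_ext; [|apply HA]. intro t; simpl; ring.
  - assert (CC : forall mu, ccont (fun t => F t * cis (- mu * t) * fejer_prod M t)%C).
    { intro mu. apply ccont_mult; [|apply ccont_fejer_prod]. apply ccont_mult; auto. apply ccont_cis. }
    apply umean_ext with (fun t => RtoC (/ INR n) * csum n (fun i => csum n (fun j =>
      cis ((INR i - INR j) * th M) *
      (F t * cis (- (nu + (INR i - INR j) * lam M) * t) * fejer_prod M t))))%C.
    + intro t. unfold fejer.
      replace (F t * cis (- nu * t) * (RtoC (/ INR n) * csum n (fun i => csum n (fun j =>
         cis ((INR i - INR j) * (- (lam M * t) + th M)))) * fejer_prod M t))%C with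
        (RtoC (/ INR n) * ((F t * cis (- nu * t) * fejer_prod M t) * csum n (fun i => csum n (fun j =>
         cis ((INR i - INR j) * (- (lam M * t) + th M))))))%C by ring.
      f_equal. rewrite <- csum_scal. apply csum_ext; intros i _.
      rewrite <- csum_scal. apply csum_ext; intros j _.
      replace (- (nu + (INR i - INR j) * lam M) * t) with (- nu * t + - ((INR i - INR j) * lam M * t)) by ring.
      replace ((INR i - INR j) * (- (lam M * t) + th M)) with
        ((INR i - INR j) * th M + - ((INR i - INR j) * lam M * t)) by ring.
      rewrite !cis_plus. ring.
    + apply umean_scal.
      * apply ccont_csum; intros i _; apply ccont_csum; intros j _.
        apply ccont_mult; auto; apply ccont_const.
      * apply umean_csum; intros i _.
        -- apply ccont_csum; intros j _. apply ccont_mult; auto; apply ccont_const.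
        -- apply umean_csum; intros j _.
           ++ apply ccont_mult; auto; apply ccont_const.
           ++ apply umean_scal; auto.
Qed.

Definition lattice (N : nat) (x : R) : Prop :=
  exists c : nat -> Z, x = rsum N (fun i => IZR (c i) * lam i).

Lemma lattice_S N x k : lattice N x -> lattice (S N) (IZR k * lam N + x).
Proof.
  intros [c ->]. exists (fun i => if Nat.eq_dec i N then k else c i). simpl.
  destruct (Nat.eq_dec N N); [|congruence].
  rewrite (rsum_ext _ (fun i => IZR (if Nat.eq_dec i N then k else c i) * lam i)
    (fun i => IZR (c i) * lam i)); [ring|].
  intros i Hi. destruct (Nat.eq_dec i N); [lia|auto].
Qed.

Lemma lattice_0 N : lattice N 0.
Proof.
  exists (fun _ => 0%Z). induction N as [|N IH]; simpl; auto. rewrite <- IH; ring.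
Qed.

Lemma INR_minus_IZR i j : INR i - INR j = IZR (Z.of_nat i - Z.of_nat j).
Proof. now rewrite minus_IZR, <- !INR_IZR_INZ. Qed.

Lemma fejer_pair_zero N A nu : (forall x, lattice N x -> A (nu + x) = RtoC 0) ->
  fejer_pair N A nu = RtoC 0.
Proof.
  revert nu. induction N as [|M IH]; intros nu H; simpl.
  - rewrite <- (Rplus_0_r nu). apply H, lattice_0.
  - rewrite csum_zero; [ring|]. intros i _. apply csum_zero. intros j _.
    rewrite IH; [ring|]. intros x Hx. rewrite INR_minus_IZR, Rplus_assoc.
    apply H. now apply lattice_S.
Qed.

Lemma csum_diag (c : C) (m : nat) :
  csum m (fun i => csum m (fun j => if Nat.eq_dec i j then c else RtoC 0)) = (RtoC (INR m) * c)%C.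
Proof.
  rewrite (csum_ext m _ (fun _ => c)).
  - induction m as [|m IH]; [simpl; ring|]. rewrite S_INR. simpl. rewrite IH, RtoC_plus. ring.
  - intros i Hi. rewrite (csum_single m _ i Hi).
    + destruct (Nat.eq_dec i i); congruence.
    + intros j _ Hj. destruct (Nat.eq_dec i j); congruence.
Qed.

(** Among [S m] indices there are [m] pairs with [i = S j]. This count produces the factor [1 - / n]
    in the Fejer mean. *)
Lemma csum_subdiag (c : C) (m : nat) :
  csum (S m) (fun i => csum (S m) (fun j => if Nat.eq_dec i (S j) then c else RtoC 0))
  = (RtoC (INR m) * c)%C.
Proof.
  assert (Row0 : forall p, csum p (fun j => if Nat.eq_dec 0 (S j) then c else RtoC 0) = RtoC 0)
    by (intro p; apply csum_zero; intros j _; destruct (Nat.eq_dec 0 (S j)); [lia|auto]).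
  assert (RowS : forall p i, (i < p)%nat -> csum p (fun j => if Nat.eq_dec (S i) (S j) then c else RtoC 0) = c).
  { intros p i Hi. rewrite (csum_single p _ i Hi).
    - destruct (Nat.eq_dec (S i) (S i)); congruence.
    - intros j _ Hj. destruct (Nat.eq_dec (S i) (S j)); [congruence|auto]. }
  assert (K : forall p q, (p <= S q)%nat -> csum p (fun i => csum (S q) (fun j => if Nat.eq_dec i (S j) then c else RtoC 0))
     = (RtoC (INR (pred p)) * c)%C).
  { intros p q. induction p as [|p IH]; intro Hp; [simpl; ring|].
    change (csum (S p) ?f) with (csum p f + f p)%C. rewrite IH by lia.
    destruct p as [|p]; [rewrite Row0; simpl; ring|].
    rewrite RowS by lia. simpl pred. rewrite S_INR, RtoC_plus. ring. }
  now rewrite K.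
Qed.

(** The arithmetic input of the kernel computation: a combination whose last nonzero coefficient is
    [k] at [lam M] is nonzero, and it meets the support of [A] only when it is [lam M] itself. *)
Definition generic (N : nat) (A : R -> C) : Prop :=
  forall M, (M < N)%nat -> forall k x, lattice M x ->
    (k <> 0)%Z -> IZR k * lam M + x <> 0 /\
    (A (IZR k * lam M + x) <> RtoC 0 -> k = 1%Z /\ x = 0).

(** At each stage only the diagonal terms survive, and they contribute [n / n]. For constant
    functions this is the normalisation of the kernel product; at a frequency [lam M] it shows that
    the earlier kernels preserve its coefficient. *)
Lemma fejer_pair_iso N A nu :
  (forall M k x, (M < N)%nat -> lattice M x -> (k <> 0)%Z -> A (nu + (IZR k * lam M + x)) = RtoC 0) ->
  fejer_pair N A nu = A nu.
Proof.
  induction N as [|M IH]; intro H; simpl; auto.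
  rewrite (csum_ext n _ (fun i => csum n (fun j => if Nat.eq_dec i j then A nu else RtoC 0))).
  - rewrite csum_diag, Cmult_assoc, <- RtoC_mult, Rinv_l, Cmult_1_l; auto.
    apply not_0_INR; lia.
  - intros i _. apply csum_ext; intros j _. destruct (Nat.eq_dec i j) as [->|Hij].
    + replace ((INR j - INR j) * th M) with 0 by ring.
      replace (nu + (INR j - INR j) * lam M) with nu by ring.
      rewrite cis_0, IH; [ring|]. intros M' k x HM. apply H; lia.
    + rewrite fejer_pair_zero; [ring|]. intros x Hx. rewrite INR_minus_IZR, Rplus_assoc.
      apply H; auto. lia.
Qed.

(** In each new kernel the diagonal reproduces the previous value, the pairs with [i = S j] pick out
    the coefficient at [lam M] with phase [th M], and all other frequencies miss the spectrum. *)
Lemma fejer_pair_linear N A : generic N A ->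
  fejer_pair N A 0 = (A 0%R + RtoC (1 - / INR n) * csum N (fun i => cis (th i) * A (lam i)))%C.
Proof.
  destruct n as [|p] eqn:En; [lia|]. rewrite <- En in *.
  intros HG. assert (HN : forall N', (N' <= N)%nat -> fejer_pair N' A 0
    = (A 0%R + RtoC (1 - / INR n) * csum N' (fun i => cis (th i) * A (lam i)))%C); [|now apply HN].
  induction N' as [|M IH]; intro HM; simpl; [ring|].
  specialize (IH ltac:(lia)).
  set (P0 := fejer_pair M A 0) in *. set (P1 := (cis (th M) * A (lam M))%C).
  rewrite (csum_ext n _ (fun i => csum n (fun j => if Nat.eq_dec i j then P0 else RtoC 0)
     + csum n (fun j => if Nat.eq_dec i (S j) then P1 else RtoC 0))%C).
  - rewrite csum_plus, csum_diag. rewrite En. rewrite csum_subdiag. rewrite <- En.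
    rewrite IH. assert (X : INR p = INR n - 1) by (rewrite En, S_INR; ring). rewrite X.
    assert (Nz : INR n <> 0) by (apply not_0_INR; lia).
    rewrite !RtoC_minus. rewrite (RtoC_inv _ Nz). 
    assert (NzC : RtoC (INR n) <> RtoC 0) by (intro Hc; apply Nz; now apply RtoC_inj).
    field. exact NzC.
  - intros i _. rewrite <- csum_plus. apply csum_ext; intros j _.
    assert (Far : (Z.of_nat i - Z.of_nat j <> 0)%Z -> (Z.of_nat i - Z.of_nat j <> 1)%Z ->
      fejer_pair M A (0 + (INR i - INR j) * lam M) = RtoC 0).
    { intros H0 H1. apply fejer_pair_zero. intros x Hx. rewrite INR_minus_IZR, Rplus_0_l.
      apply NNPP. intro Hc. destruct (proj2 (HG M ltac:(lia) _ x Hx H0) Hc). tauto. }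
    destruct (Nat.eq_dec i j) as [->|Hij].
    + destruct (Nat.eq_dec j (S j)) as [Hj|_]; [lia|].
      replace ((INR j - INR j) * th M) with 0 by ring.
      replace (0 + (INR j - INR j) * lam M) with 0 by ring.
      rewrite cis_0. fold P0. ring.
    + destruct (Nat.eq_dec i (S j)) as [->|Hs].
      * replace (INR (S j) - INR j) with 1 by (rewrite S_INR; ring).
        rewrite !Rmult_1_l, Rplus_0_l. unfold P1. rewrite fejer_pair_iso; [ring|].
        (* A surviving term would be [lam M] plus a nontrivial combination of earlier frequencies.
           Genericity at [M] forces that combination to be 0, and genericity at [M'] forbids it. *)
        intros M' k x HM' Hx Hk. apply NNPP. intro Hc.
        assert (HL : lattice M (IZR k * lam M' + x)).
        { assert (Grow : forall q y, lattice q y -> forall r, lattice (q + r) y).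
          { intros q y Hy r. induction r as [|r IHr]; [now rewrite Nat.add_0_r|].
            rewrite Nat.add_succ_r. replace y with (IZR 0 * lam (q + r)%nat + y) by ring.
            now apply lattice_S. }
          replace M with (S M' + (M - S M'))%nat by lia. apply Grow. now apply lattice_S. }
        replace (lam M) with (IZR 1 * lam M) in Hc by ring.
        destruct (proj2 (HG M ltac:(lia) 1%Z _ HL ltac:(lia)) Hc) as [_ E].
        exact (proj1 (HG M' ltac:(lia) k x Hx Hk) E).
      * rewrite Far by lia. ring.
Qed.

(** The product of kernels is nonnegative, so multiplying [Re (F t) <= s] by it and taking means
    preserves the inequality; the kernel product itself has mean 1. *)
Lemma fejer_bound_n F A N s : ccont F -> generic N A ->
  (forall nu, is_umean (fun t => F t * cis (- nu * t))%C (A nu)) ->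
  (forall t, Re (F t) <= s) ->
  Re (A 0%R + RtoC (1 - / INR n) * csum N (fun i => cis (th i) * A (lam i)))%C <= s.
Proof.
  intros HF HG HA Hs. rewrite <- fejer_pair_linear by auto.
  pose (A1 := fun nu => if Req_EM_T nu 0 then RtoC s else RtoC 0).
  assert (HA1 : forall nu, is_umean (fun t => RtoC s * cis (- nu * t))%C (A1 nu)).
  { intro nu. unfold A1. pose proof (umean_term (RtoC s) (- nu)) as H.
    destruct (Req_EM_T (- nu) 0), (Req_EM_T nu 0); auto; exfalso; lra. }
  assert (E1 : fejer_pair N A1 0 = RtoC s).
  { rewrite fejer_pair_iso; unfold A1.
    - destruct (Req_EM_T 0 0); congruence.
    - intros M k x HM Hx Hk. destruct (Req_EM_T _ 0) as [E|]; auto.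
      rewrite Rplus_0_l in E. now destruct (proj1 (HG M HM k x Hx Hk)). }
  assert (M1 := fejer_pair_mean F A N HF HA 0).
  assert (M2 := fejer_pair_mean (fun _ => RtoC s) A1 N (ccont_const _) HA1 0).
  rewrite E1 in M2.
  change s with (Re (RtoC s)). eapply umean_Re_le; [| |exact M1|exact M2|].
  - apply ccont_mult; [|apply ccont_fejer_prod]. apply ccont_mult; auto. apply ccont_cis.
  - apply ccont_mult; [|apply ccont_fejer_prod]. apply ccont_mult; [apply ccont_const|apply ccont_cis].
  - intro t. cbv beta. replace (- 0 * t) with 0 by ring. rewrite cis_0, !Cmult_1_r.
    destruct (fejer_prod_nonneg N t) as [r [Hr ->]].
    rewrite !(Cmult_comm _ (RtoC r)), !Re_scal. apply Rmult_le_compat_l; auto.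
Qed.

End FejerProduct.

(** The coefficient at index [M] is [k <> 0], so in [comb_in_basis] the distinguished index must be
    [M]. *)
Lemma generic_of_indep L lam N A : Qlin_indep L -> inj_below N lam ->
  (forall i, (i < N)%nat -> L (lam i)) -> (forall nu, A nu <> RtoC 0 -> L nu \/ nu = 0) ->
  generic lam N A.
Proof.
  intros HL Hi HLi HA M HM k x [c ->] Hk.
  set (c' := fun i => if Nat.eq_dec i M then k else c i).
  assert (Es : rsum (S M) (fun i => IZR (c' i) * lam i)
    = IZR k * lam M + rsum M (fun i => IZR (c i) * lam i)).
  { simpl. unfold c' at 2. destruct (Nat.eq_dec M M); [|congruence].
    rewrite (rsum_ext M _ (fun i => IZR (c i) * lam i)); [ring|].
    intros i Hlt. unfold c'. destruct (Nat.eq_dec i M); [lia|auto]. }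
  assert (Hi' : inj_below (S M) lam) by (intros i j H1 H2; apply Hi; lia).
  assert (HLi' : forall i, (i < S M)%nat -> L (lam i)) by (intros i H1; apply HLi; lia).
  assert (C' : c' M = k) by (unfold c'; destruct (Nat.eq_dec M M); congruence).
  rewrite <- Es.
  assert (Key : L (rsum (S M) (fun i => IZR (c' i) * lam i)) \/ rsum (S M) (fun i => IZR (c' i) * lam i) = 0 ->
    rsum (S M) (fun i => IZR (c' i) * lam i) <> 0 /\ k = 1%Z /\ rsum M (fun i => IZR (c i) * lam i) = 0).
  { intro H. destruct (comb_in_basis L lam (S M) c' _ HL Hi' HLi' eq_refl H) as [Z|[i0 [H1 [H2 [H3 H4]]]]].
    - exfalso; apply Hk. rewrite <- C'. apply Z; lia.
    - assert (i0 = M).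
      { apply NNPP; intro Hne. apply Hk. rewrite <- C'. apply H4; lia. }
      subst i0. split; [|split].
      + rewrite <- H2. apply (Qlin_indep_nonzero L); auto.
      + congruence.
      + transitivity (rsum M (fun _ => 0)).
        * apply rsum_ext. intros i Hlt. specialize (H4 i ltac:(lia) ltac:(lia)).
          unfold c' in H4. destruct (Nat.eq_dec i M); [lia|]. rewrite H4; ring.
        * rewrite rsum_const; ring. }
  split.
  - intro E. destruct (Key (or_intror E)) as [Hx _]. auto.
  - intro H. destruct (Key (HA _ H)) as [_ K]. exact K.
Qed.

Lemma le_of_le_shrink a r s : (forall n, (0 < n)%nat -> a + (1 - / INR n) * r <= s) -> a + r <= s.
Proof.
  intro H. apply Rnot_lt_le. intro K.
  pose proof (H 1%nat ltac:(lia)) as H1. simpl in H1. rewrite Rinv_1 in H1.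
  assert (Pr : 0 < r) by lra.
  destruct (nfloor_ex (r / (a + r - s))) as [n [_ Hn]].
  { apply Rlt_le, Rdiv_lt_0_compat; lra. }
  specialize (H (S n) ltac:(lia)). rewrite S_INR in H.
  pose proof (pos_INR n) as Pn.
  assert (X : r < (INR n + 1) * (a + r - s)).
  { apply Rmult_lt_reg_r with (/ (a + r - s)); [apply Rinv_0_lt_compat; lra|].
    replace ((INR n + 1) * (a + r - s) * / (a + r - s)) with (INR n + 1) by (field; lra). exact Hn. }
  assert (Y : / (INR n + 1) * r < a + r - s).
  { apply Rmult_lt_reg_l with (INR n + 1); [lra|]. rewrite <- Rmult_assoc, Rinv_r by lra. lra. }
  lra.
Qed.

Section IndependentFrequencies.
Variables (L : R -> Prop) (N : nat) (lam : nat -> R).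
Hypotheses (HL : Qlin_indep L) (Hi : inj_below N lam) (HLi : forall i, (i < N)%nat -> L (lam i)).

Lemma independent_phase_bound F A th s : ccont F ->
  (forall nu, A nu <> RtoC 0 -> L nu \/ nu = 0) ->
  (forall nu, is_umean (fun t => F t * cis (- nu * t))%C (A nu)) ->
  (forall t, Re (F t) <= s) ->
  Re (A 0) + Re (csum N (fun i => cis (th i) * A (lam i)))%C <= s.
Proof.
  intros HF HA0 HA Hs. apply le_of_le_shrink. intros n Hn.
  rewrite <- Re_scal.
  apply (fejer_bound_n n lam th Hn F A N s HF); auto.
  now apply (generic_of_indep L).
Qed.

Lemma independent_sup_bound F A s : ccont F ->
  (forall nu, A nu <> RtoC 0 -> L nu \/ nu = 0) ->
  (forall nu, is_umean (fun t => F t * cis (- nu * t))%C (A nu)) ->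
  (forall t, Re (F t) <= s) ->
  Re (A 0) + rsum N (fun i => Cmod (A (lam i))) <= s.
Proof.
  intros HF HA0 HA Hs.
  destruct (function_choice _ (fun i => Re_align (A (lam i)))) as [th Hth].
  pose proof (independent_phase_bound F A th s HF HA0 HA Hs) as H.
  rewrite Re_csum in H. erewrite (rsum_ext N) in H; [exact H|]. intros; apply Hth.
Qed.

(** The sum of the characters rotated by [- th i] has real parts with supremum at least [N] by
    [independent_sup_bound]. Near this value each of its [N] terms must be near 1. *)
Lemma kronecker th eps : 0 < eps ->
  exists t, forall i, (i < N)%nat -> Cmod (cis (lam i * t) - cis (th i)) <= eps.
Proof.
  (* A real part above [1 - e] makes the squared distance [2 - 2 * Re] smaller than
     [2 * e = eps ^ 2]. *)
  intro He. set (e := eps * eps / 2).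
  assert (Pe : 0 < e) by (unfold e; nra).
  pose (F := fun t => csum N (fun i => (cis (- th i) * cis (lam i * t))%C)).
  pose (A := fun nu => csum N (fun i => if Req_EM_T (lam i - nu) 0 then cis (- th i) else RtoC 0)).
  assert (HF : ccont F) by (apply ccont_csum; intros; apply ccont_term).
  assert (HA : forall nu, is_umean (fun t => F t * cis (- nu * t))%C (A nu)).
  { intro nu. apply umean_ext with (fun t => csum N (fun i => cis (- th i) * cis ((lam i - nu) * t)))%C.
    - intro t. unfold F. rewrite <- csum_scal_r. apply csum_ext; intros i _.
      replace ((lam i - nu) * t) with (lam i * t + - nu * t) by ring. rewrite cis_plus; ring.
    - apply umean_csum; intros i _; [apply ccont_term|apply umean_term]. }
  assert (HA0 : forall nu, A nu <> RtoC 0 -> L nu \/ nu = 0).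
  { intros nu H. left. apply NNPP. intro Hn. apply H. unfold A. apply csum_zero. intros i Hlt.
    destruct (Req_EM_T (lam i - nu) 0) as [E|]; auto. exfalso; apply Hn.
    replace nu with (lam i) by lra. auto. }
  assert (A0 : A 0 = RtoC 0).
  { unfold A. apply csum_zero. intros i Hlt. destruct (Req_EM_T (lam i - 0) 0) as [E|]; auto.
    exfalso. apply (Qlin_indep_nonzero L (lam i) HL); auto. lra. }
  assert (Ai : forall i, (i < N)%nat -> A (lam i) = cis (- th i)).
  { intros i Hlt. unfold A. rewrite (csum_single N _ i Hlt).
    - destruct (Req_EM_T (lam i - lam i) 0); [auto|exfalso; lra].
    - intros j Hj Hne. destruct (Req_EM_T (lam j - lam i) 0); auto. exfalso. apply Hne, Hi; auto; lra. }
  assert (Ex : exists t, INR N - e < Re (F t)).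
  { apply NNPP. intro Hno.
    assert (Hs : forall t, Re (F t) <= INR N - e).
    { intro t. apply Rnot_lt_le. intro K; apply Hno; now exists t. }
    pose proof (independent_sup_bound F A (INR N - e) HF HA0 HA Hs) as K.
    rewrite A0 in K. rewrite (rsum_ext N _ (fun _ => 1)) in K
      by (intros i Hlt; rewrite Ai, Cmod_cis by auto; auto).
    rewrite rsum_const in K. unfold Re, RtoC in K; simpl in K. lra. }
  destruct Ex as [t Ht]. exists t. intros i Hlt.
  assert (Each : 1 - e < Re (cis (lam i * t - th i))).
  { unfold F in Ht. rewrite Re_csum in Ht.
    assert (Bd : forall k, Re (cis (- th k) * cis (lam k * t))%C <= 1).
    { intro k. eapply Rle_trans; [apply Rle_abs|]. eapply Rle_trans; [apply re_le_Cmod|].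
      rewrite Cmod_mult, !Cmod_cis; lra. }
    set (f := fun k => Re (cis (- th k) * cis (lam k * t))%C) in *.
    replace (cis (lam i * t - th i)) with (cis (- th i) * cis (lam i * t))%C
      by (rewrite <- cis_plus; f_equal; ring).
    fold (f i).
    pose proof (rsum_update N f i (f i) Hlt) as U.
    assert (Up : rsum N (fun k => f k - (if Nat.eq_dec k i then f i else 0)) <= 
       rsum N (fun k => 1 - (if Nat.eq_dec k i then 1 else 0))).
    { apply rsum_le. intros k _. specialize (Bd k). fold (f k) in Bd.
      destruct (Nat.eq_dec k i) as [->|]; lra. }
    rewrite (rsum_update N (fun _ => 1) i 1 Hlt), rsum_const in Up. lra. }
  assert (Sq : Cmod (cis (lam i * t) - cis (th i)) * Cmod (cis (lam i * t) - cis (th i))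
     = 2 - 2 * Re (cis (lam i * t - th i))).
  { replace (cis (lam i * t)) with (cis (th i) * cis (lam i * t - th i))%C
      by (rewrite <- cis_plus; f_equal; ring).
    set (y := lam i * t - th i).
    replace (cis (th i) * cis y - cis (th i))%C with (cis (th i) * (cis y - 1))%C by ring.
    rewrite Cmod_mult, Cmod_cis, Rmult_1_l.
    change (Cmod (cis y - 1) * Cmod (cis y - 1)) with (Re (RtoC (Cmod (cis y - 1) * Cmod (cis y - 1)))).
    rewrite <- Cmult_conj_mod. unfold cis, Cconj, Cmult, Cminus, Cplus, Copp, RtoC, Re; simpl.
    pose proof (sin2_cos2 y) as E. unfold Rsqr in E. lra. }
  pose proof (Cmod_ge_0 (cis (lam i * t) - cis (th i))) as P0.
  apply Rnot_lt_le. intro K. unfold e in *. nra.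
Qed.

End IndependentFrequencies.

(** * Absolutely convergent series *)

Definition is_cser (u : nat -> C) (l : C) : Prop :=
  forall eps, 0 < eps -> exists N0, forall N, (N0 <= N)%nat -> Cmod (csum N u - l) <= eps.

(** Made total by choice; the value has meaning once convergence is known, usually from a summable
    majorant. *)
Definition cser (u : nat -> C) : C := epsilon (inhabits (RtoC 0)) (is_cser u).

Definition summable (r : nat -> R) : Prop := exists M, forall N, rsum N r <= M.

Lemma rsum_mono r : (forall k, 0 <= r k) -> forall N p, rsum N r <= rsum (N + p) r.
Proof.
  intros H N p; induction p as [|p IH]; [rewrite Nat.add_0_r; lra|].
  rewrite Nat.add_succ_r; simpl. specialize (H (N + p)%nat); lra.
Qed.

Lemma summable_tail r : (forall k, 0 <= r k) -> summable r ->
  forall eps, 0 < eps -> exists N0, forall N, rsum N r <= rsum N0 r + eps.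
Proof.
  intros Hp [M HM] eps He.
  destruct (completeness (fun x => exists N, x = rsum N r)) as [s [U Lu]].
  - exists M. intros x [N ->]; auto.
  - exists (rsum 0 r), 0%nat; auto.
  - apply NNPP. intro Hn.
    assert (s <= s - eps); [|lra]. apply Lu. intros x [N ->].
    apply Rnot_lt_le. intro K. apply Hn. exists N. intro N'.
    assert (rsum N' r <= s) by (apply U; now exists N'). lra.
Qed.

Lemma csum_diff_le u r N p : (forall k, Cmod (u k) <= r k) ->
  Cmod (csum (N + p) u - csum N u) <= rsum (N + p) r - rsum N r.
Proof.
  intro H. induction p as [|p IH].
  - rewrite Nat.add_0_r. replace (csum N u - csum N u)%C with (RtoC 0) by ring. rewrite Cmod_0; lra.
  - rewrite Nat.add_succ_r; simpl. specialize (H (N + p)%nat).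
    replace (csum (N + p) u + u (N + p)%nat - csum N u)%C
      with ((csum (N + p) u - csum N u) + u (N + p)%nat)%C by ring.
    eapply Rle_trans; [apply Cmod_triangle|]. lra.
Qed.

Lemma nonneg_of_dom (u : nat -> C) r : (forall k, Cmod (u k) <= r k) -> forall k, 0 <= r k.
Proof. intros H k; eapply Rle_trans; [apply Cmod_ge_0|apply H]. Qed.

Lemma is_cser_exists u r : (forall k, Cmod (u k) <= r k) -> summable r -> exists l, is_cser u l.
Proof.
  intros H Hs. apply C_seq_cauchy. intros eps He.
  destruct (summable_tail r (nonneg_of_dom u r H) Hs (eps / 2)) as [N0 K]; [lra|].
  exists N0. intros n m Hn Hm.
  assert (E : forall q, (N0 <= q)%nat -> Cmod (csum q u - csum N0 u) <= eps / 2).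
  { intros q Hq. replace q with (N0 + (q - N0))%nat by lia.
    eapply Rle_trans; [apply (csum_diff_le u r); auto|]. specialize (K (N0 + (q - N0))%nat). lra. }
  assert (E1 := E n Hn). assert (E2 := E m Hm). rewrite Cmod_minus_sym in E2.
  pose proof (Cmod_dist_triangle (csum n u) (csum N0 u) (csum m u)). lra.
Qed.

Lemma cser_correct u r : (forall k, Cmod (u k) <= r k) -> summable r -> is_cser u (cser u).
Proof.
  intros H Hs. unfold cser. apply epsilon_spec. eapply is_cser_exists; eauto.
Qed.

Lemma is_cser_unique u l l' : is_cser u l -> is_cser u l' -> l = l'.
Proof.
  intros H H'. apply Cmod_close_eq. intros eps He.
  destruct (H (eps / 2)) as [N1 K1]; [lra|]. destruct (H' (eps / 2)) as [N2 K2]; [lra|].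
  specialize (K1 (N1 + N2)%nat ltac:(lia)). specialize (K2 (N1 + N2)%nat ltac:(lia)).
  rewrite Cmod_minus_sym in K1.
  pose proof (Cmod_dist_triangle l (csum (N1 + N2) u) l'). lra.
Qed.

Lemma is_cser_plus u v l m : is_cser u l -> is_cser v m -> is_cser (fun k => u k + v k)%C (l + m).
Proof.
  intros H H' eps He.
  destruct (H (eps / 2)) as [N1 K1]; [lra|]. destruct (H' (eps / 2)) as [N2 K2]; [lra|].
  exists (N1 + N2)%nat. intros N HN. rewrite csum_plus.
  specialize (K1 N ltac:(lia)). specialize (K2 N ltac:(lia)).
  replace (csum N u + csum N v - (l + m))%C with ((csum N u - l) + (csum N v - m))%C by ring.
  eapply Rle_trans; [apply Cmod_triangle|]. lra.
Qed.

Lemma is_cser_scal c u l : is_cser u l -> is_cser (fun k => c * u k)%C (c * l).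
Proof.
  intros H eps He. pose proof (Cmod_ge_0 c) as Pc.
  destruct (H (eps / (Cmod c + 1))) as [N0 K]; [apply Rdiv_lt_0_compat; lra|].
  exists N0. intros N HN. specialize (K N HN). rewrite csum_scal.
  replace (c * csum N u - c * l)%C with (c * (csum N u - l))%C by ring. rewrite Cmod_mult.
  assert (E : eps = (Cmod c + 1) * (eps / (Cmod c + 1))) by (field; lra).
  pose proof (Cmod_ge_0 (csum N u - l)). nra.
Qed.

Lemma is_cser_bound u l M : is_cser u l -> (forall N, rsum N (fun k => Cmod (u k)) <= M) -> Cmod l <= M.
Proof.
  intros H HM. apply Rnot_lt_le. intro K.
  destruct (H ((Cmod l - M) / 2)) as [N0 K0]; [lra|]. specialize (K0 N0 (Nat.le_refl _)).
  rewrite Cmod_minus_sym in K0.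
  pose proof (Cmod_le_sub l (csum N0 u)). pose proof (Cmod_csum N0 u). specialize (HM N0). lra.
Qed.

Lemma cser_tail u r N0 eps : (forall k, Cmod (u k) <= r k) -> summable r ->
  (forall N, rsum N r <= rsum N0 r + eps) -> forall N, (N0 <= N)%nat -> Cmod (cser u - csum N u) <= eps.
Proof.
  intros H Hs Ht N HN. pose proof (cser_correct u r H Hs) as Hc.
  apply Rnot_lt_le. intro K. set (e := (Cmod (cser u - csum N u) - eps) / 2).
  destruct (Hc e) as [N1 K1]; [unfold e; lra|].
  specialize (K1 (N + N1)%nat ltac:(lia)). rewrite Cmod_minus_sym in K1.
  pose proof (csum_diff_le u r N N1 H) as D.
  pose proof (Ht (N + N1)%nat) as T.
  pose proof (rsum_mono r (nonneg_of_dom u r H) N0 (N - N0)) as Mo.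
  replace (N0 + (N - N0))%nat with N in Mo by lia.
  pose proof (Cmod_dist_triangle (cser u) (csum (N + N1) u) (csum N u)). unfold e in *. lra.
Qed.

Lemma umean_uniform_limit F m : ccont F ->
  (forall eps, 0 < eps -> exists G, ccont G /\ is_umean G m /\ forall t, Cmod (F t - G t) <= eps) ->
  is_umean F m.
Proof.
  intros HF H eps He. destruct (H (eps / 2)) as [G [HG [Hm Hd]]]; [lra|].
  destruct (Hm (eps / 2)) as [S0 [P K]]; [lra|]. exists S0; split; auto.
  intros a S HS. specialize (K a S HS).
  pose proof (avg_bound (fun t => F t - G t)%C (eps / 2) a S (ccont_minus _ _ HF HG) Hd ltac:(lra)) as E.
  replace (avg F a S - m)%C with (avg (fun t => F t - G t) a S + (avg G a S - m))%C.
  - eapply Rle_trans; [apply Cmod_triangle|]. lra.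
  - unfold avg, win. rewrite CI_minus by auto. ring.
Qed.

Lemma ccont_uniform_limit F :
  (forall eps, 0 < eps -> exists G, ccont G /\ forall t, Cmod (F t - G t) <= eps) -> ccont F.
Proof.
  intro H. apply ccont_eps. intros t eps He.
  destruct (H (eps / 4)) as [G [HG Hd]]; [lra|].
  destruct (proj1 (ccont_eps G) HG t (eps / 4)) as [d [Pd K]]; [lra|].
  exists d; split; auto. intros s Hs. specialize (K s Hs).
  pose proof (Hd s) as E1. pose proof (Hd t) as E2. rewrite Cmod_minus_sym in E2.
  pose proof (Cmod_dist_triangle (F s) (G s) (F t)).
  pose proof (Cmod_dist_triangle (G s) (G t) (F t)). lra.
Qed.

(** The system [D] may change with the tolerance: better partial sums involve more characters and
    hence smaller systems of almost periods. *)
Lemma ap_uniform_limit F :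
  (forall eps, 0 < eps -> exists D G, ap_system D /\ controls D G /\ forall t, Cmod (F t - G t) <= eps) ->
  ap_system (periods_of F).
Proof.
  intro H. apply periods_of_system. intros eps He.
  destruct (H (eps / 3)) as [D [G [HD [HG Hd]]]]; [lra|].
  destruct (HG (eps / 3)) as [eta [Pe Ke]]; [lra|].
  destruct (proj1 HD eta Pe) as [l [Pl Kl]]. exists l; split; auto. intro x.
  destruct (Kl x) as [tau [Ht Dt]]. exists tau; split; auto. intro t.
  specialize (Ke tau Dt t). pose proof (Hd (t + tau)) as E1. pose proof (Hd t) as E2.
  rewrite Cmod_minus_sym in E2.
  pose proof (Cmod_dist_triangle (F (t + tau)%R) (G (t + tau)%R) (F t)).
  pose proof (Cmod_dist_triangle (G (t + tau)%R) (G t) (F t)). lra.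
Qed.

(** Common almost periods of [D] and of the first [N] characters, as needed to subtract a partial
    sum from a function controlled by [D]. *)
Fixpoint add_freqs (D : R -> R -> Prop) (lam : nat -> R) (N : nat) : R -> R -> Prop :=
  match N with O => D | S M => add_freq (add_freqs D lam M) (lam M) end.

Lemma add_freqs_system D lam N : ap_system D -> ap_system (add_freqs D lam N).
Proof. induction N; simpl; auto. intro; apply add_freq_system; auto. Qed.

Lemma controls_add_freqs D lam N F : controls D F -> controls (add_freqs D lam N) F.
Proof. induction N; simpl; auto. intro; apply controls_add_freq; auto. Qed.

Lemma controls_plus D F G : ap_system D -> controls D F -> controls D G ->
  controls D (fun t => F t + G t)%C.
Proof.
  intros [_ [_ Hm]] HF HG eps He.
  destruct (HF (eps / 2)) as [d1 [P1 K1]]; [lra|]. destruct (HG (eps / 2)) as [d2 [P2 K2]]; [lra|].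
  exists (Rmin d1 d2); split; [now apply Rmin_pos|]. intros tau Ht t.
  assert (E1 := K1 tau (Hm _ _ _ (Rmin_l _ _) Ht) t).
  assert (E2 := K2 tau (Hm _ _ _ (Rmin_r _ _) Ht) t).
  replace (F (t + tau)%R + G (t + tau)%R - (F t + G t))%C
    with ((F (t + tau)%R - F t) + (G (t + tau)%R - G t))%C by ring.
  eapply Rle_trans; [apply Cmod_triangle|]. lra.
Qed.

Lemma controls_const D c : controls D (fun _ => c).
Proof.
  intros eps He; exists 1; split; [lra|]. intros tau _ t.
  replace (c - c)%C with (RtoC 0) by ring. rewrite Cmod_0; lra.
Qed.

Lemma controls_term D c nu : ap_system D -> controls (add_freq D nu) (fun t => c * cis (nu * t))%C.
Proof.
  intro HD. apply (controls_mult _ (Cmod c) 1).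
  - now apply add_freq_system.
  - intro t; lra.
  - intro t; rewrite Cmod_cis; lra.
  - apply controls_const.
  - apply controls_freq.
Qed.

Lemma controls_csum D (b : nat -> C) lam N : ap_system D ->
  controls (add_freqs D lam N) (fun t => csum N (fun j => b j * cis (lam j * t)))%C.
Proof.
  intro HD. induction N as [|N IH]; simpl; [apply controls_const|].
  apply controls_plus; [apply add_freq_system, add_freqs_system; auto| |].
  - apply controls_add_freq, IH.
  - apply controls_term, add_freqs_system, HD.
Qed.

Definition fser (b : nat -> C) (lam : nat -> R) (t : R) : C := cser (fun j => b j * cis (lam j * t))%C.

Section AbsSeries.
Variables (b : nat -> C) (lam : nat -> R).
Hypothesis Hs : summable (fun j => Cmod (b j)).

Lemma fser_dom t k : Cmod (b k * cis (lam k * t)) <= Cmod (b k).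
Proof. rewrite Cmod_mult, Cmod_cis; lra. Qed.

Lemma fser_correct t : is_cser (fun j => b j * cis (lam j * t))%C (fser b lam t).
Proof. apply (cser_correct _ (fun j => Cmod (b j))); auto. apply fser_dom. Qed.

Lemma fser_uniform eps : 0 < eps -> exists N0, forall N, (N0 <= N)%nat -> forall t,
  Cmod (fser b lam t - csum N (fun j => b j * cis (lam j * t)))%C <= eps.
Proof.
  intro He. destruct (summable_tail (fun j => Cmod (b j)) (fun k => Cmod_ge_0 _) Hs eps He) as [N0 K].
  exists N0. intros N HN t. apply (cser_tail _ (fun j => Cmod (b j)) N0); auto. apply fser_dom.
Qed.

Lemma ccont_fser : ccont (fser b lam).
Proof.
  apply ccont_uniform_limit. intros eps He. destruct (fser_uniform eps He) as [N K].
  exists (fun t => csum N (fun j => b j * cis (lam j * t)))%C. split; [|apply K; lia].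
  apply ccont_csum; intros; apply ccont_term.
Qed.

Lemma fser_bound : exists M, cbounded M (fser b lam).
Proof.
  destruct Hs as [M HM]. exists M. intro t. apply (is_cser_bound _ _ M (fser_correct t)).
  intro N. eapply Rle_trans; [|apply HM]. apply rsum_le; intros; apply fser_dom.
Qed.

(** Collects every term of frequency [nu], so that coefficients can be read off even before
    repetitions of [lam] are excluded. *)
Definition line_coef (nu : R) (N : nat) : C :=
  csum N (fun j => if Req_EM_T (lam j - nu) 0 then b j else RtoC 0).

Lemma fser_mean nu m : (exists N1, forall N, (N1 <= N)%nat -> line_coef nu N = m) ->
  is_umean (fun t => fser b lam t * cis (- nu * t))%C m.
Proof.
  intros [N1 H1]. apply umean_uniform_limit.
  - apply ccont_mult; [apply ccont_fser|apply ccont_cis].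
  - intros eps He. destruct (fser_uniform eps He) as [N0 K].
    exists (fun t => csum (N0 + N1) (fun j => b j * cis ((lam j - nu) * t)))%C.
    split; [|split].
    + apply ccont_csum; intros; apply ccont_term.
    + rewrite <- (H1 (N0 + N1)%nat) by lia. apply umean_csum; intros; [apply ccont_term|apply umean_term].
    + intro t. specialize (K (N0 + N1)%nat ltac:(lia) t).
      replace (csum (N0 + N1) (fun j => b j * cis ((lam j - nu) * t)))%C with
        (csum (N0 + N1) (fun j => b j * cis (lam j * t)) * cis (- nu * t))%C.
      * replace (fser b lam t * cis (- nu * t) - csum (N0 + N1) (fun j => b j * cis (lam j * t)) * cis (- nu * t))%C
          with ((fser b lam t - csum (N0 + N1) (fun j => b j * cis (lam j * t))) * cis (- nu * t))%C by ring.
        rewrite Cmod_mult, Cmod_cis. lra.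
      * rewrite <- csum_scal_r. apply csum_ext; intros j _.
        replace ((lam j - nu) * t) with (lam j * t + - nu * t) by ring. rewrite cis_plus; ring.
Qed.

End AbsSeries.

(* An enumeration may repeat values beyond the cardinal of the set; only the indices with
   a nonzero coefficient matter. *)
Definition inj_support (b : nat -> C) (lam : nat -> R) : Prop :=
  forall i j, b i <> RtoC 0 -> b j <> RtoC 0 -> lam i = lam j -> i = j.

Lemma line_coef_at b lam j0 : inj_support b lam -> b j0 <> RtoC 0 ->
  forall N, (S j0 <= N)%nat -> line_coef b lam (lam j0) N = b j0.
Proof.
  intros Hi Hb N HN. unfold line_coef. rewrite (csum_single N _ j0) by (try lia; intros j _ Hj;
    destruct (Req_EM_T (lam j - lam j0) 0) as [E|]; auto;
    destruct (Ceq_dec (b j) 0) as [Z|Z]; auto; exfalso; apply Hj, Hi; auto; lra).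
  destruct (Req_EM_T (lam j0 - lam j0) 0); auto. exfalso; lra.
Qed.

Lemma line_coef_off b lam nu : (forall j, b j <> RtoC 0 -> lam j <> nu) ->
  forall N, line_coef b lam nu N = RtoC 0.
Proof.
  intros H N. unfold line_coef. apply csum_zero. intros j _.
  destruct (Req_EM_T (lam j - nu) 0) as [E|]; auto.
  destruct (Ceq_dec (b j) 0) as [Z|Z]; auto. exfalso; apply (H j Z); lra.
Qed.

(** The difference of the two sides is almost periodic as a uniform limit and has all means equal to
    0, so [ap_uniqueness] applies. *)
Lemma fser_represents D F b lam a0 M : ap_system D -> controls D F -> ccont F -> cbounded M F ->
  summable (fun j => Cmod (b j)) ->
  (forall nu, exists m, is_umean (fun t => F t * cis (- nu * t))%C
      ((if Req_EM_T nu 0 then a0 else RtoC 0) + m) /\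
      exists N1, forall N, (N1 <= N)%nat -> line_coef b lam nu N = m) ->
  forall t, F t = (a0 + fser b lam t)%C.
Proof.
  intros HD Hc HF HM Hs Hmean.
  set (w := fun t => (F t - (a0 + fser b lam t))%C).
  assert (Cw : ccont w) by (apply ccont_minus; auto; apply ccont_plus; [apply ccont_const|now apply ccont_fser]).
  assert (Aw : ap_system (periods_of w)).
  { apply ap_uniform_limit. intros eps He. destruct (fser_uniform b lam Hs eps He) as [N K].
    exists (add_freqs D lam N), (fun t => F t + - (1) * (a0 + csum N (fun j => b j * cis (lam j * t))))%C.
    split; [|split].
    - now apply add_freqs_system.
    - apply controls_plus; [now apply add_freqs_system|now apply controls_add_freqs|].
      destruct (fser_bound b lam Hs) as [M' HM'].
      apply (controls_mult _ 1 (Cmod a0 + rsum N (fun j => Cmod (b j)))).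
      + now apply add_freqs_system.
      + intro t. rewrite Cmod_opp, Cmod_1; lra.
      + intro t. eapply Rle_trans; [apply Cmod_triangle|]. apply Rplus_le_compat_l.
        eapply Rle_trans; [apply Cmod_csum|]. apply rsum_le; intros; apply fser_dom.
      + apply controls_const.
      + apply controls_plus; [now apply add_freqs_system|apply controls_const|now apply controls_csum].
    - intro t. unfold w. specialize (K N (Nat.le_refl _) t). rewrite Cmod_minus_sym in K.
      match goal with |- Cmod ?z <= _ => replace z with
        (csum N (fun j => b j * cis (lam j * t)) - fser b lam t)%C by ring end. exact K. }
  destruct (fser_bound b lam Hs) as [M' HM'].
  assert (Z : forall t, w t = RtoC 0).
  { apply (ap_uniqueness (periods_of w) w (M + (Cmod a0 + M'))); auto.
    - apply controls_periods_of.
    - intro t. unfold w. eapply Rle_trans; [apply Cmod_triangle_minus|]. apply Rplus_le_compat; auto.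
      eapply Rle_trans; [apply Cmod_triangle|]. apply Rplus_le_compat; [lra|auto].
    (* The uniqueness theorem multiplies by [cis (nu * t)], the coefficients by [cis (- nu * t)];
       hence the sign change. *)
    - intro nu. destruct (Hmean (- nu)) as [m [H1 H2]].
      pose proof (fser_mean b lam Hs (- nu) m H2) as H3. rewrite Ropp_involutive in *.
      pose proof (umean_term a0 nu) as H4.
      apply umean_ext with (fun t => F t * cis (nu * t) + - (1) * (a0 * cis (nu * t) + fser b lam t * cis (nu * t)))%C.
      { intro t. unfold w. ring. }
      replace (RtoC 0) with (((if Req_EM_T (- nu) 0 then a0 else 0) + m)
         + - (1) * ((if Req_EM_T nu 0 then a0 else 0) + m))%C at 1.
      + assert (CFt : forall G, ccont G -> ccont (fun t => G t * cis (nu * t))%C)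
          by (intros; apply ccont_mult; auto; apply ccont_cis).
        assert (CS : ccont (fun t => a0 * cis (nu * t) + fser b lam t * cis (nu * t))%C).
        { apply ccont_plus; [apply ccont_term|apply CFt, ccont_fser; auto]. }
        apply umean_plus; [auto|apply ccont_mult; auto; apply ccont_const|exact H1|].
        apply umean_scal; auto. apply umean_plus; auto.
        * apply ccont_term.
        * apply CFt, ccont_fser; auto.
      + destruct (Req_EM_T nu 0), (Req_EM_T (- nu) 0); try (exfalso; lra); ring. }
  intro t. specialize (Z t). unfold w in Z.
  replace (F t) with ((F t - (a0 + fser b lam t)) + (a0 + fser b lam t))%C by ring. rewrite Z; ring.
Qed.

(** * Moments and Taylor expansions of exponential series *)

(** The same induction by derivatives as for [exp_taylor], along the segment from 0 to [x]. *)
Lemma pow_fact_le_exp n x : 0 <= x -> x ^ n / INR (fact n) <= exp x.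
Proof.
  revert x. induction n as [|n IH]; intros x Hx.
  - simpl. unfold Rdiv. rewrite Rinv_1, Rmult_1_r. rewrite <- exp_0.
    destruct Hx as [Hx|<-]; [left; now apply exp_increasing|lra].
  - pose (h := fun t => (t * x) ^ S n / INR (fact (S n)) - exp (t * x)).
    pose (h' := fun t => x * ((t * x) ^ n / INR (fact n)) - x * exp (t * x)).
    assert (K : h 1 <= h 0).
    { apply nonincreasing_01 with h'.
      - intro t. unfold h, h'. apply @is_derive_minus.
        + replace (x * ((t * x) ^ n / INR (fact n))) with (INR (S n) * x * (t * x) ^ n / INR (fact (S n))).
          * generalize (INR_fact_neq_0 (S n)). generalize (INR (fact (S n))). intros q Hq.
            auto_derive; auto. change (match n with O => 1 | S _ => INR n + 1 end) with (INR (S n)).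
            field. exact Hq.
          * rewrite fact_simpl, mult_INR. field. split; [apply INR_fact_neq_0|apply not_0_INR; lia].
        + auto_derive; auto. ring.
      - intros t Ht. unfold h'. specialize (IH (t * x) ltac:(nra)). nra. }
    unfold h in K. rewrite !Rmult_1_l, Rmult_0_l, exp_0 in K. simpl in K. rewrite Rmult_0_l in K.
    unfold Rdiv in K. rewrite Rmult_0_l in K. simpl. unfold Rdiv. lra.
Qed.

Lemma summable_le r r' : (forall k, r k <= r' k) -> summable r' -> summable r.
Proof.
  intros H [M HM]. exists M. intro N. eapply Rle_trans; [|apply HM]. apply rsum_le; auto.
Qed.

Lemma summable_scal c r : 0 <= c -> summable r -> summable (fun k => c * r k).
Proof.
  intros Hc [M HM]. exists (c * M). intro N. rewrite rsum_scal. now apply Rmult_le_compat_l.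
Qed.

Lemma summable_plus r r' : summable r -> summable r' -> summable (fun k => r k + r' k).
Proof.
  intros [M HM] [M' HM']. exists (M + M'). intro N. rewrite rsum_plus.
  specialize (HM N); specialize (HM' N); lra.
Qed.

Lemma cser_ext u v : (forall k, u k = v k) -> cser u = cser v.
Proof. intro H. f_equal. extensionality k; apply H. Qed.

Lemma is_cser_eq u r l : (forall k, Cmod (u k) <= r k) -> summable r -> is_cser u l -> cser u = l.
Proof. intros H Hs Hl. apply (is_cser_unique u); auto. now apply (cser_correct u r). Qed.

(** The [i]-th derivative of [eser b lam] at 0, written as a power moment. *)
Definition mom (b : nat -> C) (lam : nat -> R) (i : nat) : C :=
  cser (fun j => b j * RtoC (lam j ^ i))%C.

Definition eser (b : nat -> C) (lam : nat -> R) (z : C) : C :=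
  cser (fun j => b j * Cexp (RtoC (lam j) * z))%C.

(** Absolute convergence of the exponential series on both lines [Re z = d] and [Re z = - d]; it
    bounds all moments as well. *)
Definition exp_summable (d : R) (b : nat -> C) (lam : nat -> R) : Prop :=
  summable (fun j => Cmod (b j) * exp (d * Rabs (lam j))).

Definition taylor (m : nat -> C) (K : nat) (z : C) : C :=
  csum K (fun k => RtoC (/ INR (fact k)) * m k * z ^ k)%C.

Lemma exp_le x y : x <= y -> exp x <= exp y.
Proof. intros [H| ->]; [left; now apply exp_increasing|lra]. Qed.

Section Taylor.
Variables (b : nat -> C) (lam : nat -> R) (d : R).
Hypotheses (Hd : 0 < d) (Hs : exp_summable d b lam).

Lemma mom_dom i k : Cmod (b k * RtoC (lam k ^ i)) <=
  INR (fact i) / d ^ i * (Cmod (b k) * exp (d * Rabs (lam k))).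
Proof.
  rewrite Cmod_mult, Cmod_R, <- RPow_abs.
  assert (E := pow_fact_le_exp i (d * Rabs (lam k)) ltac:(pose proof (Rabs_pos (lam k)); nra)).
  rewrite Rpow_mult_distr in E.
  assert (Pd : 0 < d ^ i) by now apply pow_lt. pose proof (INR_fact_lt_0 i) as Pf.
  assert (F : Rabs (lam k) ^ i <= INR (fact i) / d ^ i * exp (d * Rabs (lam k))).
  { replace (Rabs (lam k) ^ i) with (INR (fact i) / d ^ i * (d ^ i * Rabs (lam k) ^ i / INR (fact i)))
      by (field; lra).
    apply Rmult_le_compat_l; auto. apply Rlt_le, Rdiv_lt_0_compat; auto. }
  replace (INR (fact i) / d ^ i * (Cmod (b k) * exp (d * Rabs (lam k)))) with
    (Cmod (b k) * (INR (fact i) / d ^ i * exp (d * Rabs (lam k)))) by ring.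
  apply Rmult_le_compat_l; auto. apply Cmod_ge_0.
Qed.

Lemma mom_summable i : summable (fun k => INR (fact i) / d ^ i * (Cmod (b k) * exp (d * Rabs (lam k)))).
Proof.
  apply summable_scal; auto. apply Rlt_le, Rdiv_lt_0_compat; [apply INR_fact_lt_0|now apply pow_lt].
Qed.

Lemma mom_correct i : is_cser (fun j => b j * RtoC (lam j ^ i))%C (mom b lam i).
Proof. apply (cser_correct _ _ (mom_dom i) (mom_summable i)). Qed.

Lemma eser_dom z k : Cmod z <= d ->
  Cmod (b k * Cexp (RtoC (lam k) * z)) <= Cmod (b k) * exp (d * Rabs (lam k)).
Proof.
  intro Hz. rewrite Cmod_mult, Cmod_Cexp. apply Rmult_le_compat_l; [apply Cmod_ge_0|].
  apply exp_le. eapply Rle_trans; [apply Rle_abs|]. eapply Rle_trans; [apply re_le_Cmod|].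
  rewrite Cmod_mult, Cmod_R. pose proof (Rabs_pos (lam k)). nra.
Qed.

Lemma eser_correct z : Cmod z <= d ->
  is_cser (fun j => b j * Cexp (RtoC (lam j) * z))%C (eser b lam z).
Proof. intro Hz. apply (cser_correct _ _ (fun k => eser_dom z k Hz) Hs). Qed.

Lemma taylor_is_cser K z :
  is_cser (fun j => b j * exp_poly K (RtoC (lam j) * z))%C (taylor (mom b lam) K z).
Proof.
  induction K as [|K IH].
  - intros eps He. exists 0%nat. intros N _. simpl. rewrite csum_zero by (intros; ring).
    replace (taylor (mom b lam) 0 z) with (RtoC 0) by reflexivity.
    replace (0 - 0)%C with (RtoC 0) by ring. rewrite Cmod_0; lra.
  - unfold taylor; simpl. fold (taylor (mom b lam) K z).
    replace (fun j => b j * (exp_poly K (RtoC (lam j) * z) + RtoC (/ INR (fact K)) * (RtoC (lam j) * z) ^ K))%C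
     with (fun j => b j * exp_poly K (RtoC (lam j) * z)
       + (RtoC (/ INR (fact K)) * z ^ K) * (b j * RtoC (lam j ^ K)))%C.
    + apply is_cser_plus; [exact IH|].
      replace (RtoC (/ INR (fact K)) * mom b lam K * z ^ K)%C
        with ((RtoC (/ INR (fact K)) * z ^ K) * mom b lam K)%C by ring.
      apply is_cser_scal, mom_correct.
    + extensionality j. rewrite Cpow_mult_l, <- RtoC_pow. ring.
Qed.

(** Termwise [exp_taylor]. The weight [exp (d * Rabs (lam j))] splits into two factors with [d / 2]:
    one absorbs the power of [lam j], the other the exponential in the remainder. *)
Lemma taylor_bound : exists A, 0 <= A /\ forall K z, Cmod z <= d / 2 ->
  Cmod (eser b lam z - taylor (mom b lam) K z) <= A * (Cmod z / (d / 2)) ^ K.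
Proof.
  destruct Hs as [A HA]. exists A. split.
  { specialize (HA 0%nat). exact HA. }
  intros K z Hz. set (r := d / 2) in *. assert (Pr : 0 < r) by (unfold r; lra).
  pose proof (Cmod_ge_0 z) as Pz.
  assert (Pq : 0 <= (Cmod z / r) ^ K).
  { apply pow_le. apply Rmult_le_pos; auto. apply Rlt_le, Rinv_0_lt_compat; auto. }
  apply (is_cser_bound (fun j => b j * Cexp (RtoC (lam j) * z) + - (1) * (b j * exp_poly K (RtoC (lam j) * z)))%C).
  - replace (eser b lam z - taylor (mom b lam) K z)%C
      with (eser b lam z + - (1) * taylor (mom b lam) K z)%C by ring.
    apply is_cser_plus; [apply eser_correct; unfold r in *; lra|].
    apply is_cser_scal, taylor_is_cser.
  - intro N. apply Rle_trans with (rsum N (fun j => (Cmod z / r) ^ K * (Cmod (b j) * exp (d * Rabs (lam j))))).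
    + apply rsum_le. intros k _.
      replace (b k * Cexp (RtoC (lam k) * z) + - (1) * (b k * exp_poly K (RtoC (lam k) * z)))%C
        with (b k * (Cexp (RtoC (lam k) * z) - exp_poly K (RtoC (lam k) * z)))%C by ring.
      rewrite Cmod_mult.
      replace ((Cmod z / r) ^ K * (Cmod (b k) * exp (d * Rabs (lam k)))) with
        (Cmod (b k) * ((Cmod z / r) ^ K * exp (d * Rabs (lam k)))) by ring.
      apply Rmult_le_compat_l; [apply Cmod_ge_0|].
      eapply Rle_trans; [apply exp_taylor|]. rewrite Cmod_mult, Cmod_R.
      set (x := Rabs (lam k)). assert (Px : 0 <= x) by apply Rabs_pos.
      replace (x * Cmod z) with ((Cmod z / r) * (r * x)) at 1 by (field; lra).
      rewrite Rpow_mult_distr.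
      replace (d * x) with (r * x + r * x) by (unfold r; field). rewrite exp_plus.
      replace ((Cmod z / r) ^ K * (r * x) ^ K / INR (fact K) * exp (x * Cmod z)) with
        ((Cmod z / r) ^ K * ((r * x) ^ K / INR (fact K) * exp (x * Cmod z)))
        by (field; apply INR_fact_neq_0).
      apply Rmult_le_compat_l; auto.
      apply Rmult_le_compat.
      * apply Rmult_le_pos; [apply pow_le; nra|apply Rlt_le, Rinv_0_lt_compat, INR_fact_lt_0].
      * left; apply exp_pos.
      * apply pow_fact_le_exp; nra.
      * apply exp_le. nra.
    + rewrite rsum_scal, Rmult_comm. apply Rmult_le_compat_r; auto.
Qed.

Lemma taylor_zero K z : (forall i, (i < K)%nat -> mom b lam i = RtoC 0) ->
  taylor (mom b lam) K z = RtoC 0.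
Proof. intro H. apply csum_zero. intros k Hk. rewrite H by auto. ring. Qed.

Lemma eser_zero_of_mom z : Cmod z <= d / 4 -> (forall i, mom b lam i = RtoC 0) -> eser b lam z = RtoC 0.
Proof.
  intros Hz H. destruct taylor_bound as [A [PA HA]].
  apply Cmod_small_eq. intros eps He.
  destruct (pow_lt_1_zero (/ 2) ltac:(rewrite Rabs_pos_eq; lra) (eps / (A + 1))
    ltac:(apply Rdiv_lt_0_compat; lra)) as [K HK].
  specialize (HK K (Nat.le_refl _)). rewrite Rabs_pos_eq in HK by (apply pow_le; lra).
  specialize (HA K z ltac:(lra)). rewrite taylor_zero in HA by auto.
  replace (eser b lam z - 0)%C with (eser b lam z) in HA by ring.
  eapply Rle_trans; [exact HA|].
  assert (Q : (Cmod z / (d / 2)) ^ K <= (/ 2) ^ K).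
  (* The radius [d / 4] is half of the radius in [taylor_bound], so the error decays like
     [(/ 2) ^ K]. *)
  { apply pow_incr. pose proof (Cmod_ge_0 z). split.
    - apply Rmult_le_pos; auto. apply Rlt_le, Rinv_0_lt_compat; lra.
    - apply Rmult_le_reg_r with (d / 2); [lra|]. unfold Rdiv at 1. rewrite Rmult_assoc, Rinv_l by lra. lra. }
  assert (P : 0 <= (/ 2) ^ K) by (apply pow_le; lra).
  apply Rle_trans with (A * (/ 2) ^ K); [now apply Rmult_le_compat_l|].
  assert (E : (A + 1) * (eps / (A + 1)) = eps) by (field; lra). nra.
Qed.

Lemma eser_leading k : (forall i, (i < k)%nat -> mom b lam i = RtoC 0) ->
  exists A, 0 <= A /\ forall z, Cmod z <= d / 2 ->
    Cmod (eser b lam z - RtoC (/ INR (fact k)) * mom b lam k * z ^ k) <= A * Cmod z ^ S k.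
Proof.
  intro H. destruct taylor_bound as [A [PA HA]].
  exists (A / (d / 2) ^ S k). split.
  { apply Rmult_le_pos; auto. apply Rlt_le, Rinv_0_lt_compat, pow_lt; lra. }
  intros z Hz. specialize (HA (S k) z Hz). unfold taylor in HA. simpl csum in HA.
  fold (taylor (mom b lam) k z) in HA. rewrite taylor_zero in HA by auto.
  rewrite Cplus_0_l in HA. eapply Rle_trans; [exact HA|]. right.
  unfold Rdiv at 1. rewrite Rpow_mult_distr, pow_inv. unfold Rdiv. ring.
Qed.

End Taylor.

(** Half of the exponential weight pays for the factor [lam j ^ i]; the other half remains. *)
Lemma exp_summable_pow d b lam i : 0 < d -> exp_summable d b lam ->
  exp_summable (d / 2) (fun j => b j * RtoC (lam j ^ i))%C lam.
Proof.
  intros Hd Hs.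
  apply summable_le with (fun k => INR (fact i) / (d / 2) ^ i * (Cmod (b k) * exp (d * Rabs (lam k)))).
  - intro k. 
    pose proof (mom_dom (fun _ => RtoC 1) lam (d / 2) ltac:(lra) i k) as E.
    rewrite Cmult_1_l, Cmod_1, Rmult_1_l in E. rewrite Cmod_mult.
    replace (exp (d * Rabs (lam k))) with (exp (d / 2 * Rabs (lam k)) * exp (d / 2 * Rabs (lam k)))
      by (rewrite <- exp_plus; f_equal; field).
    pose proof (exp_pos (d / 2 * Rabs (lam k))) as Pe. pose proof (Cmod_ge_0 (b k)) as Pb.
    replace (INR (fact i) / (d / 2) ^ i * (Cmod (b k) * (exp (d / 2 * Rabs (lam k)) * exp (d / 2 * Rabs (lam k)))))
      with (Cmod (b k) * (INR (fact i) / (d / 2) ^ i * exp (d / 2 * Rabs (lam k))) * exp (d / 2 * Rabs (lam k))) by ring.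
    apply Rmult_le_compat_r; [lra|]. now apply Rmult_le_compat_l.
  - apply summable_scal; auto. apply Rlt_le, Rdiv_lt_0_compat; [apply INR_fact_lt_0|apply pow_lt; lra].
Qed.

(** The coefficients after moving the base point up by [t]. Their moduli are unchanged, so the
    radius of the expansion does not shrink. *)
Definition vshift (b : nat -> C) (lam : nat -> R) (t : R) : nat -> C :=
  fun j => (b j * cis (lam j * t))%C.

Lemma exp_summable_vshift d b lam t : exp_summable d b lam -> exp_summable d (vshift b lam t) lam.
Proof.
  apply summable_le. intro k. unfold vshift. rewrite Cmod_mult, Cmod_cis. lra.
Qed.

Lemma Cexp_vert lam t : Cexp (RtoC lam * (Ci * RtoC t)) = cis (lam * t).
Proof.
  rewrite <- Cexp_Ci. f_equal. rewrite RtoC_mult. ring.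
Qed.

(** The [i]-th moment at height [t] is the exponential series with coefficients [b j * lam j ^ i],
    whose own moments are those of [b] of order at least [i]. The bound [d / 8] is a quarter of the
    remaining weight [d / 2]. *)
Lemma mom_vshift_step d b lam t : 0 < d -> exp_summable d b lam -> Rabs t <= d / 8 ->
  (forall i, (1 <= i)%nat -> mom b lam i = RtoC 0) ->
  forall i, (1 <= i)%nat -> mom (vshift b lam t) lam i = RtoC 0.
Proof.
  intros Hd Hs Ht H i Hi.
  set (bi := fun j => (b j * RtoC (lam j ^ i))%C).
  assert (E : mom (vshift b lam t) lam i = eser bi lam (Ci * RtoC t)).
  { apply cser_ext. intro k. unfold vshift, bi. rewrite Cexp_vert. ring. }
  rewrite E. apply (eser_zero_of_mom bi lam (d / 2)).
  - lra.
  - now apply exp_summable_pow.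
  - rewrite Cmod_mult, Cmod_Ci, Cmod_R. lra.
  - intro k. rewrite <- (H (i + k)%nat) by lia. apply cser_ext. intro j. unfold bi.
    rewrite pow_add, RtoC_mult. ring.
Qed.

(** Analytic continuation along the whole vertical line in steps of length at most [d / 8], the
    radius being the same at every height. *)
Lemma mom_vshift_all d b lam : 0 < d -> exp_summable d b lam ->
  (forall i, (1 <= i)%nat -> mom b lam i = RtoC 0) ->
  forall t i, (1 <= i)%nat -> mom (vshift b lam t) lam i = RtoC 0.
Proof.
  intros Hd Hs H.
  assert (Key : forall n t, Rabs t <= INR n * (d / 8) ->
    forall i, (1 <= i)%nat -> mom (vshift b lam t) lam i = RtoC 0).
  { induction n as [|n IH]; intros t Ht.
    - simpl in Ht. assert (t = 0) as ->.
      { pose proof (Rabs_pos t). apply Rabs_eq_0. lra. }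
      apply (mom_vshift_step d); auto. rewrite Rabs_R0; lra.
    - rewrite S_INR in Ht. pose proof (pos_INR n) as Pn.
      set (q := INR n + 1). assert (Pq : 0 < q) by (unfold q; lra).
      set (t1 := t * (INR n / q)). set (t2 := t * (1 / q)).
      assert (T1 : Rabs t1 <= INR n * (d / 8)).
      { unfold t1. rewrite Rabs_mult, (Rabs_pos_eq (INR n / q))
          by (apply Rmult_le_pos; [lra|apply Rlt_le, Rinv_0_lt_compat; lra]).
        apply Rle_trans with (q * (d / 8) * (INR n / q)).
        - apply Rmult_le_compat_r; [apply Rmult_le_pos; [lra|apply Rlt_le, Rinv_0_lt_compat; lra]|exact Ht].
        - right; field; lra. }
      assert (T2 : Rabs t2 <= d / 8).
      { unfold t2. rewrite Rabs_mult, (Rabs_pos_eq (1 / q))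
          by (apply Rmult_le_pos; [lra|apply Rlt_le, Rinv_0_lt_compat; lra]).
        apply Rle_trans with (q * (d / 8) * (1 / q)).
        - apply Rmult_le_compat_r; [apply Rmult_le_pos; [lra|apply Rlt_le, Rinv_0_lt_compat; lra]|exact Ht].
        - right; field; lra. }
      intros i Hi.
      rewrite <- (mom_vshift_step d (vshift b lam t1) lam t2 Hd (exp_summable_vshift _ _ _ _ Hs) T2 (IH t1 T1) i Hi).
      apply cser_ext. intro k. unfold vshift.
      replace (lam k * t) with (lam k * t1 + lam k * t2) by (unfold t1, t2, q; field; unfold q in Pq; lra).
      rewrite cis_plus. ring. }
  intro t. destruct (enough_multiples (Rabs t) (d / 8)) as [n Hn]; [lra|].
  apply (Key n), Hn. lia.
Qed.

Lemma mom1_vshift b lam t : mom (vshift b lam t) lam 1 = fser (fun j => b j * RtoC (lam j))%C lam t.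
Proof. apply cser_ext. intro k. unfold vshift. rewrite pow_1. ring. Qed.

(** The identity theorem at 0: if [i] were the first order with a nonzero moment, the leading term
    would dominate the remainder at a small [x > 0]. *)
Lemma mom_zero_of_line d b lam : 0 < d -> exp_summable d b lam ->
  (exists x0, 0 < x0 /\ forall x, 0 < x < x0 -> eser b lam (RtoC x) = RtoC 0) ->
  forall i, mom b lam i = RtoC 0.
Proof.
  intros Hd Hs [x0 [Px0 H]].
  induction i as [i IH] using (well_founded_induction Wf_nat.lt_wf).
  destruct (eser_leading b lam d Hd Hs i IH) as [A [PA HA]].
  apply NNPP. intro Hne. apply Cmod_gt_0 in Hne.
  set (m := / INR (fact i) * Cmod (mom b lam i)).
  assert (Pf : 0 < / INR (fact i)) by (apply Rinv_0_lt_compat, INR_fact_lt_0).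
  assert (Pm : 0 < m) by (apply Rmult_lt_0_compat; auto).
  set (x := Rmin (x0 / 2) (Rmin (d / 2) (m / (2 * (A + 1))))).
  assert (Pmm : 0 < m / (2 * (A + 1))) by (apply Rdiv_lt_0_compat; lra).
  assert (Px : 0 < x) by (repeat apply Rmin_pos; lra).
  assert (L1 : x <= x0 / 2) by apply Rmin_l.
  assert (L2 : x <= d / 2) by (eapply Rle_trans; [apply Rmin_r|apply Rmin_l]).
  assert (L3 : x <= m / (2 * (A + 1))) by (eapply Rle_trans; [apply Rmin_r|apply Rmin_r]).
  assert (Cx : Cmod (RtoC x) = x) by (rewrite Cmod_R, Rabs_pos_eq; lra).
  specialize (HA (RtoC x) ltac:(rewrite Cx; lra)). rewrite H in HA by lra.
  replace (0 - RtoC (/ INR (fact i)) * mom b lam i * RtoC x ^ i)%C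
    with (- (RtoC (/ INR (fact i)) * mom b lam i * RtoC x ^ i))%C in HA by ring.
  rewrite Cmod_opp, !Cmod_mult, Cmod_pow, Cx, Cmod_R, Rabs_pos_eq in HA by lra.
  fold m in HA. simpl in HA.
  assert (Pxi : 0 < x ^ i) by now apply pow_lt.
  assert (E : m * x ^ i <= A * x * x ^ i) by lra.
  apply Rmult_le_reg_r in E; [|exact Pxi].
  assert (F : (A + 1) * (m / (2 * (A + 1))) = m / 2) by (field; lra). nra.
Qed.

(** * Hurwitz' theorem *)

(** A leading term of finite order [k] at [P], excluding local constancy. It provides the
    continuity, isolation and descent that Hurwitz' argument uses. *)
Definition has_order (f : C -> C) (P : C) : Prop :=
  exists (k : nat) (m : C) (A r : R), (1 <= k)%nat /\ m <> RtoC 0 /\ 0 <= A /\ 0 < r /\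
    forall z, Cmod z <= r -> Cmod (f (P + z) - f P - m * z ^ k)%C <= A * Cmod z ^ S k.

Lemma pow_le_self x k : (1 <= k)%nat -> 0 <= x <= 1 -> x ^ k <= x.
Proof.
  intros Hk Hx. destruct k as [|k]; [lia|]. simpl.
  assert (x ^ k <= 1) by (rewrite <- (pow1 k); apply pow_incr; lra).
  assert (0 <= x ^ k) by (apply pow_le; lra). nra.
Qed.

Lemma has_order_continuous f P : has_order f P -> forall eps, 0 < eps ->
  exists d, 0 < d /\ forall z, Cmod z < d -> Cmod (f (P + z)%C - f P) <= eps.
Proof.
  intros [k [m [A [r [Hk [Hm [PA [Pr H]]]]]]]] eps He.
  set (B := Cmod m + A + 1). assert (PB : 0 < B) by (unfold B; pose proof (Cmod_ge_0 m); lra).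
  exists (Rmin r (Rmin 1 (eps / B))). split.
  { repeat apply Rmin_pos; try lra. now apply Rdiv_lt_0_compat. }
  intros z Hz.
  assert (L1 : Cmod z < r) by (eapply Rlt_le_trans; [exact Hz|apply Rmin_l]).
  assert (L2 : Cmod z < 1) by (eapply Rlt_le_trans; [exact Hz|eapply Rle_trans; [apply Rmin_r|apply Rmin_l]]).
  assert (L3 : Cmod z < eps / B) by (eapply Rlt_le_trans; [exact Hz|eapply Rle_trans; [apply Rmin_r|apply Rmin_r]]).
  specialize (H z ltac:(lra)). pose proof (Cmod_ge_0 z) as Pz.
  replace (f (P + z)%C - f P)%C with ((f (P + z)%C - f P - m * z ^ k) + m * z ^ k)%C by ring.
  eapply Rle_trans; [apply Cmod_triangle|]. rewrite Cmod_mult, Cmod_pow.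
  pose proof (pow_le_self (Cmod z) k Hk ltac:(lra)) as E1.
  pose proof (pow_le_self (Cmod z) (S k) ltac:(lia) ltac:(lra)) as E2.
  pose proof (Cmod_ge_0 m) as Pm.
  assert (E3 : B * (eps / B) = eps) by (field; lra).
  assert (A * Cmod z ^ S k <= A * Cmod z) by (now apply Rmult_le_compat_l).
  assert (Cmod m * Cmod z ^ k <= Cmod m * Cmod z) by (now apply Rmult_le_compat_l).
  unfold B in *. nra.
Qed.

Lemma has_order_isolated f P : has_order f P -> exists r0, 0 < r0 /\ forall r, 0 < r <= r0 ->
  exists q, 0 < q /\ forall z, r <= Cmod z <= 2 * r -> q <= Cmod (f (P + z)%C - f P).
Proof.
  intros [k [m [A [rho [Hk [Hm [PA [Pr H]]]]]]]]. apply Cmod_gt_0 in Hm.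
  exists (Rmin (rho / 2) (Cmod m / (4 * (A + 1)))). split.
  { apply Rmin_pos; [lra|]. apply Rdiv_lt_0_compat; lra. }
  intros r [Pr0 Hr].
  assert (L1 : r <= rho / 2) by (eapply Rle_trans; [exact Hr|apply Rmin_l]).
  assert (L2 : r <= Cmod m / (4 * (A + 1))) by (eapply Rle_trans; [exact Hr|apply Rmin_r]).
  assert (L3 : A * (2 * r) <= Cmod m / 2).
  { assert (E : (A + 1) * (Cmod m / (4 * (A + 1))) = Cmod m / 4) by (field; lra). nra. }
  assert (Pk : 0 < r ^ k) by now apply pow_lt.
  exists (Cmod m / 2 * r ^ k). split; [nra|]. intros z Hz.
  specialize (H z ltac:(lra)).
  pose proof (Cmod_le_sub (m * z ^ k) (f (P + z)%C - f P)) as E.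
  rewrite (Cmod_minus_sym (m * z ^ k)), Cmod_mult, Cmod_pow in E. simpl in H.
  assert (Q : r ^ k <= Cmod z ^ k) by (apply pow_incr; lra).
  assert (A * (Cmod z * Cmod z ^ k) <= Cmod m / 2 * Cmod z ^ k).
  { rewrite <- Rmult_assoc. apply Rmult_le_compat_r; [lra|]. nra. }
  assert (Cmod m / 2 * r ^ k <= Cmod m / 2 * Cmod z ^ k) by (apply Rmult_le_compat_l; lra).
  lra.
Qed.

(** The minimum modulus principle: a suitable direction makes the leading term point from [f P]
    towards [w]. *)
Lemma has_order_decrease f P w : has_order f P -> f P <> w -> forall eps, 0 < eps ->
  exists z, Cmod z < eps /\ Cmod (f (P + z)%C - w) < Cmod (f P - w).
Proof.
  intros [k [m [A [rho [Hk [Hm [PA [Pr H]]]]]]]] Hw eps He. apply Cmod_gt_0 in Hm.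
  set (g := (f P - w)%C).
  assert (Pg : 0 < Cmod g).
  { apply Cmod_gt_0. intro E. apply Hw. now apply Ceq_minus. }
  destruct (polar m) as [a Ha]. destruct (polar g) as [b Hb].
  (* [r <= 1] and [r <= Cmod g / Cmod m] keep the leading term from overshooting ([s <= 1]); the
     last bound makes the remainder smaller than the leading term. *)
  set (r := Rmin (Rmin (eps / 2) rho) (Rmin (Rmin 1 (Cmod g / Cmod m)) (Cmod m / (2 * (A + 1))))).
  assert (Pq : 0 < Cmod g / Cmod m) by (now apply Rdiv_lt_0_compat).
  assert (Pq2 : 0 < Cmod m / (2 * (A + 1))) by (apply Rdiv_lt_0_compat; lra).
  assert (Prr : 0 < r) by (repeat apply Rmin_pos; lra).
  assert (M1 : r <= Rmin (eps / 2) rho) by apply Rmin_l.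
  assert (M2 : r <= Rmin (Rmin 1 (Cmod g / Cmod m)) (Cmod m / (2 * (A + 1)))) by apply Rmin_r.
  assert (L1 : r <= eps / 2) by (eapply Rle_trans; [exact M1|apply Rmin_l]).
  assert (L2 : r <= rho) by (eapply Rle_trans; [exact M1|apply Rmin_r]).
  assert (M3 : r <= Rmin 1 (Cmod g / Cmod m)) by (eapply Rle_trans; [exact M2|apply Rmin_l]).
  assert (L5 : r <= Cmod m / (2 * (A + 1))) by (eapply Rle_trans; [exact M2|apply Rmin_r]).
  assert (L3 : r <= 1) by (eapply Rle_trans; [exact M3|apply Rmin_l]).
  assert (L4 : r <= Cmod g / Cmod m) by (eapply Rle_trans; [exact M3|apply Rmin_r]).
  assert (Nk : 0 < INR k) by (apply lt_0_INR; lia).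
  (* This angle gives [m * z ^ k] the argument [b + PI], opposite to that of [g]. *)
  set (x := (b - a + PI) / INR k).
  set (z := (RtoC r * cis x)%C).
  assert (Cz : Cmod z = r) by (unfold z; rewrite Cmod_mult, Cmod_cis, Cmod_R, Rabs_pos_eq; lra).
  exists z. split; [rewrite Cz; lra|].
  specialize (H z ltac:(lra)). rewrite Cz in H.
  set (s := Cmod m * r ^ k / Cmod g).
  assert (Ez : (m * z ^ k)%C = (- (RtoC s * g))%C).
  { unfold z. rewrite Cpow_mult_l, cis_pow, <- RtoC_pow.
    unfold x. replace (INR k * ((b - a + PI) / INR k)) with (b + - a + PI) by (field; lra).
    rewrite !cis_plus. replace (cis PI) with (RtoC (- 1)).
    2:{ unfold cis, RtoC. now rewrite cos_PI, sin_PI. }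
    rewrite Ha at 1. rewrite Hb at 1.
    replace (RtoC (Cmod m) * cis a * (RtoC (r ^ k) * (cis b * cis (- a) * RtoC (- 1))))%C with
      (RtoC (Cmod m) * RtoC (r ^ k) * cis b * RtoC (- 1) * (cis a * cis (- a)))%C by ring.
    rewrite cis_opp_r.
    replace (RtoC s * (RtoC (Cmod g) * cis b))%C with (RtoC (s * Cmod g) * cis b)%C
      by (rewrite RtoC_mult; ring).
    replace (s * Cmod g) with (Cmod m * r ^ k) by (unfold s; field; lra).
    rewrite RtoC_mult. ring. }
  assert (Pk : 0 < r ^ k) by now apply pow_lt.
  assert (Ps : 0 < s) by (unfold s; apply Rdiv_lt_0_compat; nra).
  assert (S1 : s <= 1).
  { unfold s. apply Rmult_le_reg_r with (Cmod g); auto.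
    unfold Rdiv. rewrite Rmult_assoc, Rinv_l, Rmult_1_r, Rmult_1_l by lra.
    pose proof (pow_le_self r k Hk ltac:(lra)).
    assert (Cmod m * (Cmod g / Cmod m) = Cmod g) by (field; lra). nra. }
  replace (f (P + z)%C - w)%C with ((f (P + z)%C - f P - m * z ^ k) + (g + m * z ^ k))%C
    by (unfold g; ring).
  eapply Rle_lt_trans; [apply Cmod_triangle|].
  assert (Eg : Cmod (g + m * z ^ k) = (1 - s) * Cmod g).
  { rewrite Ez. replace (g + - (RtoC s * g))%C with (RtoC (1 - s) * g)%C by (rewrite RtoC_minus; ring).
    rewrite Cmod_mult, Cmod_R, Rabs_pos_eq; lra. }
  rewrite Eg. fold g.
  assert (Sg : s * Cmod g = Cmod m * r ^ k) by (unfold s; field; lra).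
  assert (A * r ^ S k < Cmod m * r ^ k); [|lra].
  simpl. rewrite <- Rmult_assoc. apply Rmult_lt_compat_r; auto.
  assert ((A + 1) * (Cmod m / (2 * (A + 1))) = Cmod m / 2) by (field; lra). nra.
Qed.

(** If the infimum [m] were not attained, each point would have a [d] that is both a radius and a
    gain, [m + d <= g] nearby. Compactness makes the gain uniform, contradicting the choice of
    [m]. *)
Lemma lsc_min_square (g : R -> R -> R) (r : R) : 0 < r -> (forall x y, 0 <= g x y) ->
  (forall x y, Rabs x <= r -> Rabs y <= r -> forall eps, 0 < eps -> exists d, 0 < d /\
     forall x' y', Rabs (x' - x) < d -> Rabs (y' - y) < d -> g x y - eps <= g x' y') ->
  exists x0 y0, Rabs x0 <= r /\ Rabs y0 <= r /\
    forall x y, Rabs x <= r -> Rabs y <= r -> g x0 y0 <= g x y.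
Proof.
  intros Pr Hp Hl.
  destruct (completeness (fun v => forall x y, Rabs x <= r -> Rabs y <= r -> v <= g x y)) as [m [U Lo]].
  { exists (g 0 0). intros v Hv. apply Hv; rewrite Rabs_R0; lra. }
  { exists 0. intros x y _ _; apply Hp. }
  assert (Hm : forall x y, Rabs x <= r -> Rabs y <= r -> m <= g x y).
  { intros x y Hx Hy. apply Lo. intros v Hv. now apply Hv. }
  apply NNPP. intro Hno.
  assert (Hgt : forall x y, Rabs x <= r -> Rabs y <= r -> m < g x y).
  { intros x y Hx Hy. destruct (Hm x y Hx Hy) as [|E]; auto. exfalso; apply Hno.
    exists x, y. split; auto. split; auto. intros x' y' Hx' Hy'. rewrite <- E; auto. }
  assert (Ex : forall x y, exists d : posreal, Rabs x <= r -> Rabs y <= r ->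
    forall x' y', Rabs (x' - x) < d -> Rabs (y' - y) < d -> m + d <= g x' y').
  { intros x y. destruct (classic (Rabs x <= r /\ Rabs y <= r)) as [[Hx Hy]|Hn].
    - specialize (Hgt x y Hx Hy). set (e := (g x y - m) / 2). assert (Pe : 0 < e) by (unfold e; lra).
      destruct (Hl x y Hx Hy e Pe) as [d [Pd K]].
      assert (Pm : 0 < Rmin d e) by now apply Rmin_pos.
      exists (mkposreal _ Pm). simpl. intros _ _ x' y' H1 H2.
      specialize (K x' y' (Rlt_le_trans _ _ _ H1 (Rmin_l _ _)) (Rlt_le_trans _ _ _ H2 (Rmin_l _ _))).
      pose proof (Rmin_r d e). unfold e in *; lra.
    - exists (mkposreal 1 Rlt_0_1). tauto. }
  destruct (function_choice _ (fun x => function_choice _ (Ex x))) as [delta Hdelta].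
  destruct (compactness_value_2d (- r) r (- r) r delta) as [d Hd]. pose proof (cond_pos d) as Pd.
  assert (m + d <= m); [|lra]. apply U. intros x y Hx Hy.
  apply Rnot_lt_le. intro K. apply Rabs_le_between in Hx. apply Rabs_le_between in Hy.
  apply (Hd x y Hx Hy). intros [u [v [Hu [Hv [E1 [E2 E3]]]]]].
  specialize (Hdelta u v (Rabs_le _ _ Hu) (Rabs_le _ _ Hv) x y E1 E2). lra.
Qed.

(* Near a zero of [f2 - w] the translates of [f1 - w] have a minimum of
   the modulus inside a small square, and such a minimum must vanish. *)
Lemma hurwitz f1 f2 s0 w r1 : 0 < r1 -> has_order f2 s0 -> f2 s0 = w ->
  (forall P, Rabs (Re P - Re s0) <= r1 -> has_order f1 P) ->
  (forall q, 0 < q -> exists tau, forall z, Rabs (Re z) <= r1 ->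
     Cmod (f1 (s0 + Ci * RtoC tau + z) - f2 (s0 + z))%C <= q) ->
  exists P, Rabs (Re P - Re s0) <= r1 /\ f1 P = w.
Proof.
  intros Pr1 H2 Hw H1 Happ.
  destruct (has_order_isolated f2 s0 H2) as [r0 [Pr0 Hiso]].
  set (r := Rmin r0 r1). assert (Pr : 0 < r) by now apply Rmin_pos.
  (* The annulus [r <= Cmod z <= 2 * r] contains the boundary of the square of half-side [r]. With
     an approximation of quality [q / 3], boundary values of the modulus are at least [2 * q / 3]
     and the value at the centre at most [q / 3]. *)
  destruct (Hiso r (conj Pr (Rmin_l _ _))) as [q [Pq Hq]]. rewrite Hw in Hq.
  assert (Lr : r <= r1) by apply Rmin_r.
  destruct (Happ (q / 3)) as [tau Ht]; [lra|].
  set (s1 := (s0 + Ci * RtoC tau)%C) in *.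
  assert (Res : forall x y, Re (s1 + (x, y))%C - Re s0 = x).
  { intros x y. unfold s1, Re, Cplus, Cmult, Ci, RtoC; simpl. ring. }
  assert (Ord : forall x y, Rabs x <= r -> has_order f1 (s1 + (x, y))%C).
  { intros x y Hx. apply H1. rewrite Res. lra. }
  destruct (lsc_min_square (fun x y => Cmod (f1 (s1 + (x, y))%C - w)) r Pr) as [x0 [y0 [Hx0 [Hy0 Hmin]]]].
  { intros; apply Cmod_ge_0. }
  { intros x y Hx Hy eps He.
    destruct (has_order_continuous f1 _ (Ord x y Hx) eps He) as [d [Pd K]].
    exists (d / 2). split; [lra|]. intros x' y' Ex Ey.
    specialize (K (x' - x, y' - y)).
    replace (s1 + (x, y) + (x' - x, y' - y)%R)%C with (s1 + (x', y'))%C in K.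
    - assert (K' : Cmod (f1 (s1 + (x', y'))%C - f1 (s1 + (x, y))%C) <= eps).
      { apply K. eapply Rle_lt_trans; [apply Cmod_le_sum|]. unfold Re, Im; simpl. lra. }
      rewrite Cmod_minus_sym in K'.
      pose proof (Cmod_dist_triangle (f1 (s1 + (x, y))%C) (f1 (s1 + (x', y'))%C) w). lra.
    - unfold s1, Cplus; simpl. f_equal; ring. }
  set (P := (s1 + (x0, y0))%C) in *.
  assert (Small : Cmod (f1 P - w) <= q / 3).
  { eapply Rle_trans; [apply (Hmin 0 0); rewrite Rabs_R0; lra|].
    specialize (Ht (0, 0)). replace (s0 + (0, 0))%C with s0 in Ht.
    - rewrite Hw in Ht. apply Ht. unfold Re; simpl. rewrite Rabs_R0; lra.
    - destruct s0; unfold Cplus; simpl; f_equal; ring. }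
  assert (Interior : Rabs x0 < r /\ Rabs y0 < r).
  { assert (Big : r <= Rmax (Rabs x0) (Rabs y0) -> False).
    { intro K. assert (Cl : r <= Cmod (x0, y0)) by (eapply Rle_trans; [exact K|exact (Rmax_Cmod (x0, y0))]).
      assert (Cu : Cmod (x0, y0) <= 2 * r).
      { eapply Rle_trans; [apply Cmod_le_sum|]. unfold Re, Im; simpl; lra. }
      specialize (Hq _ (conj Cl Cu)).
      specialize (Ht (x0, y0) ltac:(unfold Re; simpl; lra)). fold P in Ht.
      rewrite Cmod_minus_sym in Ht.
      pose proof (Cmod_dist_triangle (f2 (s0 + (x0, y0))%C) (f1 P) w). lra. }
    split; apply Rnot_le_lt; intro K; apply Big; (eapply Rle_trans; [exact K|]).
    - apply Rmax_l.
    - apply Rmax_r. }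
  exists P. split; [unfold P; rewrite Res; lra|].
  apply NNPP. intro Hne.
  destruct (has_order_decrease f1 P w (Ord x0 y0 Hx0) Hne (Rmin (r - Rabs x0) (r - Rabs y0)))
    as [z [Hz Hdec]].
  { apply Rmin_pos; lra. }
  destruct z as [zx zy].
  assert (Z1 : Rabs zx < r - Rabs x0).
  { eapply Rle_lt_trans; [apply (re_le_Cmod (zx, zy))|]. eapply Rlt_le_trans; [exact Hz|apply Rmin_l]. }
  assert (Z2 : Rabs zy < r - Rabs y0).
  { eapply Rle_lt_trans; [apply (im_le_Cmod (zx, zy))|]. eapply Rlt_le_trans; [exact Hz|apply Rmin_r]. }
  specialize (Hmin (x0 + zx) (y0 + zy)).
  replace (P + (zx, zy))%C with (s1 + (x0 + zx, y0 + zy)%R)%C in Hdec.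
  - apply (Rlt_not_le _ _ Hdec). apply Hmin.
    + pose proof (Rabs_triang x0 zx); lra.
    + pose proof (Rabs_triang y0 zy); lra.
  - unfold P, s1, Cplus; simpl. f_equal; ring.
Qed.

(** * Dirichlet series with independent exponents *)

(** The number of genuine exponents among the first [N] indices. *)
Definition effective (card : option nat) (N : nat) : nat :=
  match card with Some K => Nat.min N K | None => N end.

Lemma effective_le card N : (effective card N <= N)%nat.
Proof. destruct card; simpl; lia. Qed.

Lemma effective_lt card N j : (j < effective card N)%nat -> le_card (S j) card.
Proof. destruct card; simpl; auto; lia. Qed.

Lemma effective_ge card N j : (j < N)%nat -> (effective card N <= j)%nat -> ~ le_card (S j) card.
Proof. destruct card; simpl; lia. Qed.

(** Zero past the cardinal, so that finite and infinite exponent sets are both summed over all of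
    [nat]. *)
Definition enum_coef (card : option nat) (lam : nat -> R) (a : R -> C) (j : nat) : C :=
  if excluded_middle_informative (le_card (S j) card) then a (lam j) else RtoC 0.

(** The analytic information extracted from [AP]. The constant term [a 0] stays outside the series
    because an independent [L] cannot contain 0. In [dir_sup] the rotation by [phi] probes the
    values in every direction. *)
Record dirichlet (al be : Rbar) (f : C -> C) (L : R -> Prop) (card : option nat)
    (lam : nat -> R) (a : R -> C) : Prop := {
  dir_coef : forall nu, is_fourier_coef al be f nu (a nu);
  dir_exponent : forall nu, a nu <> RtoC 0 <-> L nu \/ nu = 0;
  dir_summable : forall sigma, in_interval al be sigma ->
    summable (fun j => Cmod (enum_coef card lam a j) * exp (lam j * sigma));
  dir_sum : forall s, in_strip al be s ->
    f s = (a 0%R + cser (fun j => enum_coef card lam a j * Cexp (RtoC (lam j) * s)))%C;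
  dir_sup : forall sigma phi m, in_interval al be sigma ->
    (forall t, Re (cis phi * f (sigma, t))%C <= m) -> forall N,
    Re (cis phi * a 0%R)%C + rsum N (fun j => Cmod (enum_coef card lam a j) * exp (lam j * sigma)) <= m
}.

Arguments dir_coef {al be f L card lam a}.
Arguments dir_exponent {al be f L card lam a}.
Arguments dir_summable {al be f L card lam a}.
Arguments dir_sum {al be f L card lam a}.
Arguments dir_sup {al be f L card lam a}.

(** Converts between the two normalisations: Fourier coefficients divide by [exp (nu * sigma)],
    coefficients along a line do not. *)
Lemma line_mean al be f nu sigma a : AP al be f -> in_interval al be sigma ->
  is_fourier_coef al be f nu a ->
  is_umean (fun t => f (sigma, t) * cis (- nu * t))%C (RtoC (exp (nu * sigma)) * a).
Proof.
  intros Hf Hs Ha. pose proof (fourier_coef_umean al be f Hf nu sigma a Hs Ha) as H.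
  apply (umean_scal (RtoC (exp (nu * sigma)))) in H; [|now apply (twist_line_cont al be)].
  eapply umean_ext; [|exact H]. intro t. simpl. rewrite twist_eq.
  rewrite Cmult_assoc, <- RtoC_mult, <- exp_plus, Rplus_opp_r, exp_0. ring.
Qed.

Lemma enumerates_inj_below card lam L N : enumerates card lam L ->
  inj_below (effective card N) lam /\ forall i, (i < effective card N)%nat -> L (lam i).
Proof.
  intros [H1 H2]; split.
  - intros i j Hi Hj. apply H2; eapply effective_lt; eauto.
  - intros i Hi. apply H1. exists i; split; auto. eapply effective_lt; eauto.
Qed.

Lemma enum_coef_zero card lam a N j : (j < N)%nat -> (effective card N <= j)%nat ->
  enum_coef card lam a j = RtoC 0.
Proof.
  intros H1 H2. unfold enum_coef. destruct (excluded_middle_informative _); auto.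
  exfalso. now apply (effective_ge card N j).
Qed.

Lemma enum_coef_nonzero card lam L a j : enumerates card lam L -> enum_coef card lam a j <> RtoC 0 ->
  enum_coef card lam a j = a (lam j) /\ L (lam j) /\ le_card (S j) card.
Proof.
  intros [H1 _]. unfold enum_coef. destruct (excluded_middle_informative _) as [H|H]; [|tauto].
  intros _. split; auto. split; auto. apply H1. now exists j.
Qed.

Lemma rsum_effective card lam a (g : nat -> R) N :
  rsum N (fun j => Cmod (enum_coef card lam a j) * g j) =
  rsum (effective card N) (fun j => Cmod (a (lam j)) * g j).
Proof.
  transitivity (rsum (effective card N) (fun j => Cmod (enum_coef card lam a j) * g j)).
  - assert (HE : forall j, (j < N)%nat -> (effective card N <= j)%nat -> Cmod (enum_coef card lam a j) * g j = 0).
    { intros j H1 H2. rewrite (enum_coef_zero card lam a N j H1 H2), Cmod_0; ring. }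
    set (r := fun j => Cmod (enum_coef card lam a j) * g j).
    assert (K : forall p, (effective card N + p <= N)%nat -> rsum (effective card N + p) r = rsum (effective card N) r).
    { induction p as [|p IH]; intro Hp; [now rewrite Nat.add_0_r|].
      rewrite Nat.add_succ_r. simpl. rewrite IH by lia. unfold r at 2; rewrite (HE (effective card N + p)%nat) by lia. ring. }
    pose proof (effective_le card N).
    specialize (K (N - effective card N)%nat ltac:(lia)).
    replace (effective card N + (N - effective card N))%nat with N in K by lia. exact K.
  - apply rsum_ext. intros j Hj. unfold enum_coef.
    destruct (excluded_middle_informative _) as [|H]; auto. exfalso; apply H. eapply effective_lt; eauto.
Qed.

Lemma dirichlet_exists al be f L card lam : Rbar_lt al be -> AP al be f -> enumerates card lam L ->
  Qlin_indep L -> (forall x, fourier_exponent al be f x <-> L x \/ x = 0) ->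
  exists a, dirichlet al be f L card lam a.
Proof.
  intros Hab Hf Hen HL Hexp.
  destruct (function_choice _ (fun nu => fourier_coef_exists al be f Hf nu Hab)) as [a Ha].
  assert (Hnz : forall nu, a nu <> RtoC 0 <-> L nu \/ nu = 0).
  { intro nu. rewrite <- Hexp. split.
    - intro H; now exists (a nu).
    - intros [b [Hb Hb0]]. now rewrite (fourier_coef_unique al be f Hf nu (a nu) b). }
  exists a.
  assert (Sup : forall sigma phi m, in_interval al be sigma ->
    (forall t, Re (cis phi * f (sigma, t))%C <= m) -> forall N,
    Re (cis phi * a 0%R)%C + rsum N (fun j => Cmod (enum_coef card lam a j) * exp (lam j * sigma)) <= m).
  { intros sigma phi m Hs Hm N.
    destruct (enumerates_inj_below card lam L N Hen) as [Hi HLi].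
    pose (A := fun nu => (cis phi * (RtoC (exp (nu * sigma)) * a nu))%C).
    pose proof (independent_sup_bound L (effective card N) lam HL Hi HLi
      (fun t => cis phi * f (sigma, t))%C A m) as B.
    rewrite rsum_effective.
    assert (CF : ccont (fun t => f (sigma, t))) by (now apply (AP_line_cont al be)).
    replace (Re (cis phi * a 0)) with (Re (A 0)).
    - rewrite (rsum_ext _ _ (fun i => Cmod (A (lam i)))).
      + apply B; auto.
        * apply ccont_mult; [apply ccont_const|exact CF].
        * intros nu H. apply Hnz. intro E. apply H. unfold A. rewrite E. ring.
        * intro nu. apply umean_ext with (fun t => cis phi * (f (sigma, t) * cis (- nu * t)))%C;
            [intro; ring|]. apply umean_scal.
          -- apply ccont_mult; [exact CF|apply ccont_cis].
          -- now apply (line_mean al be).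
      + intros k _. unfold A. rewrite !Cmod_mult, Cmod_cis, Cmod_R, Rabs_pos_eq by (left; apply exp_pos). ring.
    - unfold A. rewrite Rmult_0_l, exp_0. f_equal. ring. }
  assert (Sm : forall sigma, in_interval al be sigma ->
    summable (fun j => Cmod (enum_coef card lam a j) * exp (lam j * sigma))).
  { intros sigma Hs. destruct (AP_bounded al be f Hf sigma sigma Hs Hs (Rle_refl _)) as [M HM].
    exists (M + Cmod (a 0)). intro N.
    assert (E := Sup sigma 0 M Hs).
    assert (E1 : forall t, Re (cis 0 * f (sigma, t))%C <= M).
    { intro t. rewrite cis_0, Cmult_1_l. eapply Rle_trans; [apply Rle_abs|].
      eapply Rle_trans; [apply re_le_Cmod|]. apply HM; lra. }
    specialize (E E1 N). rewrite cis_0, Cmult_1_l in E.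
    pose proof (re_le_Cmod (a 0)) as R. apply Rabs_le_between in R. lra. }
  constructor; auto.
  intros [sigma t] Hs. change (in_interval al be sigma) in Hs.
  set (b := fun j => (enum_coef card lam a j * RtoC (exp (lam j * sigma)))%C).
  assert (Cb : forall j, Cmod (b j) = Cmod (enum_coef card lam a j) * exp (lam j * sigma)).
  { intro j. unfold b. rewrite Cmod_mult, Cmod_R, Rabs_pos_eq; auto. left; apply exp_pos. }
  assert (Hbs : summable (fun j => Cmod (b j))).
  { apply summable_le with (2 := Sm sigma Hs). intro j. rewrite Cb; lra. }
  replace (cser (fun j => enum_coef card lam a j * Cexp (RtoC (lam j) * (sigma, t)))%C) with (fser b lam t).
  2:{ apply cser_ext. intro k. unfold b. rewrite Cexp_strip. ring. }
  destruct (AP_bounded al be f Hf sigma sigma Hs Hs (Rle_refl _)) as [M HM].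
  apply (fser_represents (periods_of (fun t => f (sigma, t))) (fun t => f (sigma, t)) b lam (a 0) M).
  - now apply (AP_line_system al be).
  - apply controls_periods_of.
  - now apply (AP_line_cont al be).
  - intro u. apply HM; lra.
  - exact Hbs.
  (* The mean at [nu] is matched with the series: in [L] exactly one index contributes, and outside
     [L] none does, leaving only the constant term at [nu = 0]. *)
  - assert (Hbinj : inj_support b lam).
    { intros i j Hi Hj E. destruct Hen as [_ Hinj].
      assert (X : forall k, b k <> RtoC 0 -> le_card (S k) card).
      { intros k Hk. unfold b, enum_coef in Hk. destruct (excluded_middle_informative _); auto.
        exfalso; apply Hk; ring. }
      apply Hinj; auto. }
    assert (HbL : forall j, b j <> RtoC 0 -> L (lam j)).
    { intros j Hj. apply (enum_coef_nonzero card lam L a j Hen). intro E. apply Hj. unfold b. rewrite E; ring. }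
    intro nu. pose proof (line_mean al be f nu sigma (a nu) Hf Hs (Ha nu)) as Hm.
    destruct (classic (L nu)) as [HLnu|HnL].
    + destruct (proj1 (proj1 Hen nu) HLnu) as [j [Hj Ej]].
      assert (Bj : b j = (RtoC (exp (nu * sigma)) * a nu)%C).
      { unfold b, enum_coef. destruct (excluded_middle_informative _); [|tauto]. rewrite Ej; ring. }
      assert (Bn : b j <> RtoC 0).
      { rewrite Bj. apply Cmult_neq_0; [|apply Hnz; auto].
        apply Cmod_gt_0. rewrite Cmod_R, Rabs_pos_eq; [apply exp_pos|left; apply exp_pos]. }
      exists (b j). split.
      * destruct (Req_EM_T nu 0) as [E|_].
        { exfalso. exact (Qlin_indep_nonzero L nu HL HLnu E). }
        rewrite Cplus_0_l, Bj. exact Hm.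
      * exists (S j). intros N HN. rewrite <- Ej. now apply line_coef_at.
    + exists (RtoC 0). split.
      * rewrite Cplus_0_r. destruct (Req_EM_T nu 0) as [->|Hn0].
        -- rewrite Rmult_0_l, exp_0, Cmult_1_l in Hm. exact Hm.
        -- replace (RtoC 0) with (RtoC (exp (nu * sigma)) * a nu)%C; [exact Hm|].
           destruct (Ceq_dec (a nu) 0) as [->|Hc]; [ring|]. apply Hnz in Hc. tauto.
      * exists 0%nat. intros N _. apply line_coef_off. intros j Hj E. apply HnL. rewrite <- E. auto.
Qed.

(** According to the sign of [lam j], the weight [exp (d * Rabs (lam j))] turns [sigma] into
    [sigma + d] or [sigma - d]; both lines have summable coefficients. *)
Lemma dirichlet_dom al be f L card lam a sigma d : dirichlet al be f L card lam a ->
  in_interval al be (sigma - d) -> in_interval al be (sigma + d) -> 0 <= d ->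
  summable (fun j => Cmod (enum_coef card lam a j) * exp (lam j * sigma) * exp (d * Rabs (lam j))).
Proof.
  intros HD H1 H2 Hd.
  apply summable_le with (2 := summable_plus _ _ (dir_summable HD _ H1)
    (dir_summable HD _ H2)).
  intro k. pose proof (Cmod_ge_0 (enum_coef card lam a k)) as P.
  rewrite Rmult_assoc, <- exp_plus, <- Rmult_plus_distr_l. apply Rmult_le_compat_l; auto.
  pose proof (exp_pos (lam k * (sigma - d))). pose proof (exp_pos (lam k * (sigma + d))).
  unfold Rabs. destruct (Rcase_abs (lam k)).
  - apply Rle_trans with (exp (lam k * (sigma - d))); [|lra]. apply exp_le; lra.
  - apply Rle_trans with (exp (lam k * (sigma + d))); [|lra]. apply exp_le; lra.
Qed.

Arguments dirichlet_dom {al be f L card lam a sigma d}.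

(** Moves the origin of the expansion to [P], so that the moment results describe [f] near [P]. *)
Definition base_coef card lam a (P : C) (j : nat) : C :=
  (enum_coef card lam a j * Cexp (RtoC (lam j) * P))%C.

Lemma base_coef_mod card lam a P j :
  Cmod (base_coef card lam a P j) = Cmod (enum_coef card lam a j) * exp (lam j * Re P).
Proof.
  unfold base_coef. destruct P as [x y]. rewrite Cexp_strip, !Cmod_mult, Cmod_cis, Cmod_R, Rabs_pos_eq.
  - unfold Re; simpl. ring.
  - left; apply exp_pos.
Qed.

Lemma interval_ball_ends al be s d : (forall x, Rabs (x - s) <= d -> in_interval al be x) -> 0 <= d ->
  in_interval al be (s - d) /\ in_interval al be (s + d).
Proof.
  intros H Hd. split; apply H.
  - replace (s - d - s) with (- d) by ring. rewrite Rabs_Ropp, Rabs_pos_eq; lra.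
  - replace (s + d - s) with d by ring. rewrite Rabs_pos_eq; lra.
Qed.

Lemma base_exp_summable al be f L card lam a P d : dirichlet al be f L card lam a ->
  0 <= d -> (forall x, Rabs (x - Re P) <= d -> in_interval al be x) ->
  exp_summable d (base_coef card lam a P) lam.
Proof.
  intros HD Hd Hin. destruct (interval_ball_ends _ _ _ _ Hin Hd) as [E1 E2].
  apply summable_le with (2 := dirichlet_dom HD E1 E2 Hd).
  intro k. rewrite base_coef_mod. lra.
Qed.

Lemma dirichlet_local al be f L card lam a P d : dirichlet al be f L card lam a ->
  0 <= d -> (forall x, Rabs (x - Re P) <= d -> in_interval al be x) ->
  forall z, Rabs (Re z) <= d -> f (P + z)%C = (a 0%R + eser (base_coef card lam a P) lam z)%C.
Proof.
  intros HD Hd Hin z Hz. rewrite (dir_sum HD).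
  - f_equal. apply cser_ext. intro k. unfold base_coef.
    rewrite Cmult_plus_distr_l, Cexp_plus. ring.
  - apply Hin. change (Re (P + z)) with (Re P + Re z).
    replace (Re P + Re z - Re P) with (Re z) by ring. exact Hz.
Qed.

(** If every moment of positive order at [P] vanished, the first moment would vanish at all heights
    above and below [P]. Its mean at an exponent [nu] of [L] would then be 0, although it is a
    nonzero coefficient times [nu]. *)
Lemma dirichlet_has_order al be f L card lam a P : dirichlet al be f L card lam a ->
  enumerates card lam L -> Qlin_indep L -> in_interval al be (Re P) ->
  (exists nu, L nu) -> has_order f P.
Proof.
  intros HD Hen HL HP [nu Hnu].
  destruct (in_interval_nbhd al be (Re P) HP) as [d [Hd Hin]].
  set (b := base_coef card lam a P).
  assert (Hs : exp_summable d b lam) by (apply (base_exp_summable al be f L); auto; lra).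
  assert (Hloc : forall z, Cmod z <= d -> f (P + z)%C = (a 0%R + eser b lam z)%C).
  { intros z Hz. apply (dirichlet_local al be f L card lam a P d HD); auto; [lra|].
    eapply Rle_trans; [apply re_le_Cmod|exact Hz]. }
  assert (Ex : exists k, (1 <= k)%nat /\ mom b lam k <> RtoC 0).
  { apply NNPP. intro Hno.
    assert (Z : forall i, (1 <= i)%nat -> mom b lam i = RtoC 0).
    { intros i Hi. apply NNPP. intro Hc. apply Hno. now exists i. }
    pose proof (mom_vshift_all d b lam Hd Hs Z) as V.
    destruct (proj1 (proj1 Hen nu) Hnu) as [j [Hj Ej]].
    assert (Nn : nu <> 0) by (now apply (Qlin_indep_nonzero L)).
    set (b1 := fun j => (b j * RtoC (lam j))%C).
    assert (Hs1 : summable (fun j => Cmod (b1 j))).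
    { apply summable_le with (2 := mom_summable b lam d Hd Hs 1). intro k.
      pose proof (mom_dom b lam d Hd 1 k) as E. rewrite pow_1 in E. exact E. }
    assert (Bj : b1 j <> RtoC 0).
    { unfold b1. apply Cmult_neq_0.
      - intro E. assert (E' : Cmod (b j) = 0) by (rewrite E; apply Cmod_0).
        unfold b in E'. rewrite base_coef_mod in E'. apply Rmult_integral in E'. destruct E' as [E'|E'].
        + apply Cmod_eq_0 in E'. unfold enum_coef in E'. destruct (excluded_middle_informative _); [|tauto].
          apply (proj2 (dir_exponent HD (lam j))); auto. left. now rewrite Ej.
        + pose proof (exp_pos (lam j * Re P)); lra.
      - rewrite Ej. intro E. apply Nn. now apply RtoC_inj. }
    assert (Inj : inj_support b1 lam).
    { intros i k Hi Hk. destruct Hen as [_ Hinj].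
      assert (X : forall k, b1 k <> RtoC 0 -> le_card (S k) card).
      { intros q Hq. unfold b1, b, base_coef, enum_coef in Hq. destruct (excluded_middle_informative _); auto.
        exfalso; apply Hq; ring. }
      apply Hinj; auto. }
    pose proof (fser_mean b1 lam Hs1 (lam j) (b1 j)
      (ex_intro _ (S j) (line_coef_at b1 lam j Inj Bj))) as M.
    apply Bj. apply (umean_unique _ _ _ M).
    eapply umean_ext; [|apply (umean_const 0)]. intro t. cbv beta.
    unfold b1. rewrite <- mom1_vshift, V by lia. ring. }
  destruct Ex as [k0 Hk0].
  (* Order 0 is excluded because it carries the value of [f] at [P]; the least remaining order is
     the local order. *)
  assert (Least : exists k, (1 <= k)%nat /\ mom b lam k <> RtoC 0 /\
    forall i, (1 <= i < k)%nat -> mom b lam i = RtoC 0).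
  { clear -Hk0. revert Hk0. induction k0 as [k0 IH] using (well_founded_induction Wf_nat.lt_wf).
    intros [H1 H2]. destruct (classic (exists i, (1 <= i < k0)%nat /\ mom b lam i <> RtoC 0)) as [[i [Hi Hm]]|Hno].
    - apply (IH i); [lia|]. split; [lia|auto].
    - exists k0. split; auto. split; auto. intros i Hi. apply NNPP. intro Hc. apply Hno. now exists i. }
  destruct Least as [k [Hk [Hm Hz]]].
  destruct (taylor_bound b lam d Hd Hs) as [A [PA HA]].
  assert (E0 : eser b lam 0 = mom b lam 0).
  { apply cser_ext. intro j. simpl. rewrite Cmult_0_r.
    replace (Cexp 0) with (RtoC 1); auto.
    unfold Cexp, RtoC, Re, Im; simpl. rewrite exp_0, cos_0, sin_0. f_equal; ring. }
  exists k, (RtoC (/ INR (fact k)) * mom b lam k)%C, (A / (d / 2) ^ S k), (d / 2).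
  split; auto. split; [|split; [|split]].
  - apply Cmult_neq_0; auto. apply Cmod_gt_0.
    rewrite Cmod_R, Rabs_pos_eq; [apply Rinv_0_lt_compat, INR_fact_lt_0|].
    apply Rlt_le, Rinv_0_lt_compat, INR_fact_lt_0.
  - apply Rmult_le_pos; auto. apply Rlt_le, Rinv_0_lt_compat, pow_lt; lra.
  - lra.
  - intros z Hzz. specialize (HA (S k) z Hzz).
    assert (ET : taylor (mom b lam) (S k) z = (mom b lam 0 + RtoC (/ INR (fact k)) * mom b lam k * z ^ k)%C).
    { unfold taylor. simpl csum. f_equal. rewrite (csum_single k _ 0%nat) by (try lia;
        intros i Hi Hne; rewrite Hz by lia; ring).
      simpl. rewrite Rinv_1. ring. }
    rewrite ET in HA. rewrite Hloc by lra.
    replace (f P) with (a 0%R + mom b lam 0)%C.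
    2:{ rewrite <- E0, <- Hloc by (rewrite Cmod_0; lra). f_equal. ring. }
    match goal with |- Cmod ?u <= _ => replace u with
      (eser b lam z - (mom b lam 0 + RtoC (/ INR (fact k)) * mom b lam k * z ^ k))%C by ring end.
    eapply Rle_trans; [exact HA|]. right.
    unfold Rdiv at 1. rewrite Rpow_mult_distr, pow_inv. unfold Rdiv. ring.
Qed.

Lemma Cmod_eq_rotation (x y : C) : Cmod x = Cmod y -> exists th, y = (x * cis th)%C.
Proof.
  intro H. destruct (polar x) as [p Hp]. destruct (polar y) as [q Hq].
  exists (q - p). rewrite Hq, Hp, <- H. rewrite <- Cmult_assoc, <- cis_plus. do 2 f_equal. ring.
Qed.

(* Kronecker's theorem turns equality of the moduli of the coefficients into uniform
   approximation of [f2] by vertical translates of [f1]. *)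
Lemma dirichlet_translates al1 be1 f1 a1 al2 be2 f2 a2 L card lam P d :
  dirichlet al1 be1 f1 L card lam a1 -> dirichlet al2 be2 f2 L card lam a2 ->
  enumerates card lam L -> Qlin_indep L -> a1 0 = a2 0 -> (forall nu, Cmod (a1 nu) = Cmod (a2 nu)) ->
  0 <= d -> (forall x, Rabs (x - Re P) <= d -> in_interval al1 be1 x) ->
  (forall x, Rabs (x - Re P) <= d -> in_interval al2 be2 x) ->
  forall q, 0 < q -> exists tau, forall z, Rabs (Re z) <= d ->
    Cmod (f1 (P + Ci * RtoC tau + z) - f2 (P + z))%C <= q.
Proof.
  intros D1 D2 Hen HL H0 Hmod Hd In1 In2 q Hq.
  destruct (interval_ball_ends _ _ _ _ In1 Hd) as [E1 E2].
  set (r := fun j => Cmod (enum_coef card lam a1 j) * exp (lam j * Re P) * exp (d * Rabs (lam j))).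
  assert (Hs : summable r) by (exact (dirichlet_dom D1 E1 E2 Hd)).
  assert (Pr : forall j, 0 <= r j).
  { intro j. unfold r. apply Rmult_le_pos; [|left; apply exp_pos].
    apply Rmult_le_pos; [apply Cmod_ge_0|left; apply exp_pos]. }
  destruct (summable_tail r Pr Hs (q / 4)) as [N HN]; [lra|].
  destruct Hs as [M HM].
  assert (PM : 0 <= M) by (apply (HM 0%nat)).
  destruct (function_choice _ (fun j => Cmod_eq_rotation _ _ (Hmod (lam j)))) as [th Hth].
  destruct (enumerates_inj_below card lam L N Hen) as [Hi HLi].
  (* The first [N] terms have total weight at most [M], so this accuracy costs at most [q / 2]; each
     tail costs [q / 4]. *)
  destruct (kronecker L (effective card N) lam HL Hi HLi th (q / (2 * (M + 1)))) as [tau Htau].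
  { apply Rdiv_lt_0_compat; lra. }
  exists tau. intros z Hz.
  set (u1 := fun j => (enum_coef card lam a1 j * Cexp (RtoC (lam j) * (P + Ci * RtoC tau + z)))%C).
  set (u2 := fun j => (enum_coef card lam a2 j * Cexp (RtoC (lam j) * (P + z)))%C).
  assert (Rp : Re (P + Ci * RtoC tau + z)%C = Re P + Re z).
  { destruct P, z. unfold Re, Cplus, Cmult, Ci, RtoC; simpl. ring. }
  assert (Ez : forall j, exp (lam j * (Re P + Re z)) <= exp (lam j * Re P) * exp (d * Rabs (lam j))).
  { intro j. rewrite <- exp_plus. apply exp_le. rewrite Rmult_plus_distr_l. apply Rplus_le_compat_l.
    eapply Rle_trans; [apply Rle_abs|]. rewrite Rabs_mult, Rmult_comm.
    apply Rmult_le_compat_r; auto. apply Rabs_pos. }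
  assert (Ecoef : forall j, Cmod (enum_coef card lam a1 j) = Cmod (enum_coef card lam a2 j)).
  { intro j. unfold enum_coef. destruct (excluded_middle_informative _); auto. }
  assert (U1 : forall j, Cmod (u1 j) <= r j).
  { intro j. unfold u1. change (Cmod (base_coef card lam a1 (P + Ci * RtoC tau + z)%C j) <= r j).
    rewrite base_coef_mod, Rp. unfold r. rewrite Rmult_assoc. apply Rmult_le_compat_l; auto. apply Cmod_ge_0. }
  assert (U2 : forall j, Cmod (u2 j) <= r j).
  { intro j. unfold u2. change (Cmod (base_coef card lam a2 (P + z)%C j) <= r j).
    rewrite base_coef_mod. change (Re (P + z)%C) with (Re P + Re z). unfold r.
    rewrite Rmult_assoc, Ecoef. apply Rmult_le_compat_l; auto. apply Cmod_ge_0. }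
  assert (S1 : summable r) by (now exists M).
  assert (F1 : f1 (P + Ci * RtoC tau + z)%C = (a1 0%R + cser u1)%C).
  { apply (dir_sum D1). apply In1. rewrite Rp.
    replace (Re P + Re z - Re P) with (Re z) by ring. exact Hz. }
  assert (F2 : f2 (P + z)%C = (a2 0%R + cser u2)%C).
  { apply (dir_sum D2). apply In2. change (Re (P + z)%C) with (Re P + Re z).
    replace (Re P + Re z - Re P) with (Re z) by ring. exact Hz. }
  rewrite F1, F2, H0.
  pose proof (cser_tail u1 r N (q / 4) U1 S1 HN N (Nat.le_refl _)) as T1.
  pose proof (cser_tail u2 r N (q / 4) U2 S1 HN N (Nat.le_refl _)) as T2.
  assert (Fin : Cmod (csum N u1 - csum N u2) <= q / 2).
  { replace (csum N u1 - csum N u2)%C with (csum N (fun j => u1 j + - (1) * u2 j)%C)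
      by (rewrite csum_plus, csum_scal; ring).
    eapply Rle_trans; [apply Cmod_csum|].
    apply Rle_trans with (rsum N (fun j => q / (2 * (M + 1)) * r j)).
    - apply rsum_le. intros j Hj.
      destruct (Nat.lt_ge_cases j (effective card N)) as [Hlt|Hge].
      + assert (C1 : enum_coef card lam a1 j = a1 (lam j) /\ enum_coef card lam a2 j = a2 (lam j)).
        { unfold enum_coef. destruct (excluded_middle_informative _) as [|Hc]; auto.
          exfalso; apply Hc. eapply effective_lt; eauto. }
        destruct C1 as [C1 C2].
        replace (u1 j + - (1) * u2 j)%C with
          (base_coef card lam a1 (P + z)%C j * (cis (lam j * tau) - cis (th j)))%C.
        * rewrite Cmod_mult, base_coef_mod. change (Re (P + z)%C) with (Re P + Re z).
          rewrite Rmult_comm. apply Rmult_le_compat; try apply Cmod_ge_0.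
          -- apply Rmult_le_pos; [apply Cmod_ge_0|left; apply exp_pos].
          -- now apply Htau.
          -- unfold r. rewrite Rmult_assoc. apply Rmult_le_compat_l; auto. apply Cmod_ge_0.
        * unfold u1, u2, base_coef. rewrite C1, C2, Hth.
          replace (RtoC (lam j) * (P + Ci * RtoC tau + z))%C with
            (RtoC (lam j) * (P + z) + RtoC (lam j) * (Ci * RtoC tau))%C by ring.
          rewrite Cexp_plus, Cexp_vert. ring.
      + unfold u1, u2. rewrite !(enum_coef_zero card lam _ N j Hj Hge).
        match goal with |- Cmod ?u <= _ => replace u with (RtoC 0) by ring end.
        rewrite Cmod_0. apply Rmult_le_pos; auto. apply Rlt_le, Rdiv_lt_0_compat; lra.
    - rewrite rsum_scal. specialize (HM N).
      assert (E : q / (2 * (M + 1)) * (M + 1) = q / 2) by (field; lra).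
      assert (0 < q / (2 * (M + 1))) by (apply Rdiv_lt_0_compat; lra). nra. }
  replace (a2 0%R + cser u1 - (a2 0%R + cser u2))%C with
    ((cser u1 - csum N u1) + (csum N u1 - csum N u2) - (cser u2 - csum N u2))%C by ring.
  eapply Rle_trans; [apply Cmod_triangle_minus|].
  eapply Rle_trans; [apply Rplus_le_compat_r, Cmod_triangle|]. lra.
Qed.

Lemma dirichlet_values_transfer al1 be1 f1 a1 al2 be2 f2 a2 L card lam P d w :
  dirichlet al1 be1 f1 L card lam a1 -> dirichlet al2 be2 f2 L card lam a2 ->
  enumerates card lam L -> Qlin_indep L -> a1 0 = a2 0 -> (forall nu, Cmod (a1 nu) = Cmod (a2 nu)) ->
  0 < d -> (forall x, Rabs (x - Re P) <= d -> in_interval al1 be1 x) ->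
  (forall x, Rabs (x - Re P) <= d -> in_interval al2 be2 x) ->
  f2 P = w -> exists P', Rabs (Re P' - Re P) <= d /\ f1 P' = w.
Proof.
  intros D1 D2 Hen HL H0 Hmod Hd In1 In2 Hw.
  assert (Rz : Rabs (Re P - Re P) <= d) by (replace (Re P - Re P) with 0 by ring; rewrite Rabs_R0; lra).
  destruct (classic (exists nu, L nu)) as [Hex|Hno].
  - apply (hurwitz f1 f2 P w d Hd); auto.
    + apply (dirichlet_has_order al2 be2 f2 L card lam a2); auto.
    + intros P' HP'. apply (dirichlet_has_order al1 be1 f1 L card lam a1); auto.
    + apply (dirichlet_translates al1 be1 f1 a1 al2 be2 f2 a2 L card lam); auto. lra.
  (* Without nonzero exponents both functions equal the common constant term; there is no finite
     order and Hurwitz' argument does not apply. *)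
  - exists P. split; auto. rewrite <- Hw.
    assert (Z : forall a j, enum_coef card lam a j = RtoC 0).
    { intros a j. destruct (Ceq_dec (enum_coef card lam a j) 0) as [|Hc]; auto.
      exfalso. apply Hno. exists (lam j). now apply (enum_coef_nonzero card lam L a j Hen). }
    rewrite (dir_sum D1 P (In1 _ Rz)), (dir_sum D2 P (In2 _ Rz)), H0.
    f_equal. apply cser_ext. intro k. now rewrite !Z.
Qed.

(** * Comparison of the value sets *)

Lemma Qlinear_on_0 V psi : Qlinear_on V psi -> V 0 -> psi 0 = 0.
Proof.
  intros [_ H] H0. specialize (H 0%Q 0 H0). rewrite RMicromega.Q2R_0, !Rmult_0_l in H. exact H.
Qed.

Lemma Qspan_0 L : Qspan L 0.
Proof. exists nil. split; [intros p []|reflexivity]. Qed.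

(** Each exponent is reached by some initial segment of the enumeration, whose linear map supplies a
    rotation. At the exponent 0 linearity makes this rotation trivial. *)
Lemma star_equiv_moduli al1 be1 f1 al2 be2 f2 a1 a2 L1 L2 card1 lam1 card2 lam2 :
  Rbar_lt al1 be1 -> Rbar_lt al2 be2 -> AP al1 be1 f1 -> AP al2 be2 f2 ->
  dirichlet al1 be1 f1 L1 card1 lam1 a1 -> dirichlet al2 be2 f2 L2 card2 lam2 a2 ->
  star_equiv al1 be1 f1 al2 be2 f2 ->
  (forall nu, fourier_exponent al1 be1 f1 nu <-> fourier_exponent al2 be2 f2 nu) /\
  a1 0 = a2 0 /\ forall nu, Cmod (a1 nu) = Cmod (a2 nu).
Proof.
  intros H1 H2 A1 A2 D1 D2 [card [lam [a [b [En1 [En2 [Hc Hs]]]]]]].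
  assert (Eq : forall nu, fourier_exponent al1 be1 f1 nu <-> fourier_exponent al2 be2 f2 nu)
    by (intro nu; rewrite (proj1 En1 nu), (proj1 En2 nu); tauto).
  assert (X1 : forall nu, a1 nu <> RtoC 0 -> fourier_exponent al1 be1 f1 nu)
    by (intros nu H; exists (a1 nu); split; auto; apply D1).
  assert (X2 : forall nu, a2 nu <> RtoC 0 -> fourier_exponent al2 be2 f2 nu)
    by (intros nu H; exists (a2 nu); split; auto; apply D2).
  assert (Rot : forall nu, fourier_exponent al1 be1 f1 nu -> exists th, (nu = 0 -> th = 0) /\
    a2 nu = (a1 nu * cis th)%C).
  { intros nu Hnu. apply (proj1 En1) in Hnu. destruct Hnu as [j [Hj <-]].
    destruct (Hs (S j) ltac:(lia) Hj) as [psi [Hpsi Hab]].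
    destruct (Hc j Hj) as [Ca Cb].
    exists (psi (lam j)). split.
    - intros ->. apply (Qlinear_on_0 _ _ Hpsi), Qspan_0.
    - rewrite <- Cexp_Ci.
      rewrite (fourier_coef_unique _ _ _ A1 _ _ _ H1 (dir_coef D1 (lam j)) Ca).
      rewrite (fourier_coef_unique _ _ _ A2 _ _ _ H2 (dir_coef D2 (lam j)) Cb).
      apply Hab; lia. }
  split; auto. split.
  - assert (N1 : a1 0 <> RtoC 0) by (apply (dir_exponent D1); auto).
    destruct (Rot 0 (X1 0 N1)) as [th [T0 E]]. rewrite E, T0, cis_0 by auto. ring.
  - intro nu. destruct (classic (fourier_exponent al1 be1 f1 nu)) as [He|He].
    + destruct (Rot nu He) as [th [_ ->]]. rewrite Cmod_mult, Cmod_cis. ring.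
    + assert (Z1 : a1 nu = RtoC 0) by (apply NNPP; intro K; apply He; auto).
      assert (Z2 : a2 nu = RtoC 0) by (apply NNPP; intro K; apply He, Eq; auto).
      now rewrite Z1, Z2.
Qed.

Lemma open_ball (E : R -> Prop) x : open E -> E x -> exists d, 0 < d /\ forall y, Rabs (y - x) < d -> E y.
Proof.
  intros HE Hx. destruct (HE x Hx) as [d Hd]. exists d. split; [apply cond_pos|].
  intros y Hy. apply Hd. exact Hy.
Qed.

Lemma in_Finite_interval x d y : in_interval (Finite (x - d)) (Finite (x + d)) y <-> Rabs (y - x) < d.
Proof.
  unfold in_interval; simpl. split.
  - intros [H1 H2]. apply Rabs_lt_between. lra.
  - intro H. apply Rabs_lt_between in H. lra.
Qed.

Lemma strip_point_eta (s : C) : s = (Re s, Im s).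
Proof. destruct s; reflexivity. Qed.

Lemma values_included al1 be1 f1 a1 al2 be2 f2 a2 L card lam x d0 E w :
  dirichlet al1 be1 f1 L card lam a1 -> dirichlet al2 be2 f2 L card lam a2 ->
  enumerates card lam L -> Qlin_indep L -> a1 0 = a2 0 -> (forall nu, Cmod (a1 nu) = Cmod (a2 nu)) ->
  (forall y, Rabs (y - x) <= d0 -> in_interval al1 be1 y /\ in_interval al2 be2 y) ->
  open E -> (forall s, E s -> in_interval (Finite (x - d0)) (Finite (x + d0)) s) ->
  (exists s, E s /\ Img f2 s w) -> exists s, E s /\ Img f1 s w.
Proof.
  intros D1 D2 Hen HL H0 Hmod Hin HE HEin [s [Es [t Ht]]].
  destruct (open_ball E s HE Es) as [d [Pd Kd]].
  assert (InD : forall y, Rabs (y - Re ((s, t) : C)) <= d / 2 ->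
     in_interval al1 be1 y /\ in_interval al2 be2 y).
  { intros y Hy. apply Hin. left. apply in_Finite_interval, HEin, Kd. unfold Re in Hy; simpl in Hy. lra. }
  (* Half the radius keeps the closed neighbourhood produced by the transfer inside the open set
     [E]. *)
  destruct (dirichlet_values_transfer al1 be1 f1 a1 al2 be2 f2 a2 L card lam (s, t) (d / 2) w)
    as [P [HP Hw]]; auto; try lra.
  - intros y Hy. now apply InD.
  - intros y Hy. now apply InD.
  - exists (Re P). split.
    + apply Kd. unfold Re in HP at 2; simpl in HP. lra.
    + exists (Im P). rewrite <- strip_point_eta. auto.
Qed.

(** * Interleaving two exponential series *)

Definition mix (u v : nat -> C) (j : nat) : C :=
  if Nat.even j then u (Nat.div2 j) else v (Nat.div2 j).

(** Interleaving puts two series with unrelated enumerations into one series. An exponent may occur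
    twice, which the moment lemmas allow since they assume no injectivity. *)
Definition mixr (u v : nat -> R) (j : nat) : R :=
  if Nat.even j then u (Nat.div2 j) else v (Nat.div2 j).

Lemma mix_even u v k : mix u v (2 * k) = u k.
Proof. unfold mix. rewrite Nat.div2_double, Nat.even_mul. reflexivity. Qed.

Lemma mix_odd u v k : mix u v (S (2 * k)) = v k.
Proof. unfold mix. rewrite Nat.div2_succ_double, Nat.even_succ, Nat.odd_mul. reflexivity. Qed.

Lemma mixr_even u v k : mixr u v (2 * k) = u k.
Proof. unfold mixr. rewrite Nat.div2_double, Nat.even_mul. reflexivity. Qed.

Lemma mixr_odd u v k : mixr u v (S (2 * k)) = v k.
Proof. unfold mixr. rewrite Nat.div2_succ_double, Nat.even_succ, Nat.odd_mul. reflexivity. Qed.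

Lemma csum_mix u v N : csum (2 * N) (mix u v) = (csum N u + csum N v)%C.
Proof.
  induction N as [|N IH]; [simpl; ring|].
  replace (2 * S N)%nat with (S (S (2 * N))) by lia.
  change (csum (S (S (2 * N))) (mix u v)) with (csum (2 * N) (mix u v) + mix u v (2 * N)%nat + mix u v (S (2 * N)))%C.
  rewrite IH, mix_even, mix_odd. simpl. ring.
Qed.

Lemma rsum_mixr u v N : rsum (2 * N) (mixr u v) = rsum N u + rsum N v.
Proof.
  induction N as [|N IH]; [simpl; ring|].
  replace (2 * S N)%nat with (S (S (2 * N))) by lia.
  change (rsum (S (S (2 * N))) (mixr u v)) with (rsum (2 * N) (mixr u v) + mixr u v (2 * N)%nat + mixr u v (S (2 * N))).
  rewrite IH, mixr_even, mixr_odd. simpl. ring.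
Qed.

Lemma mixr_summable r r' : (forall k, 0 <= r k) -> (forall k, 0 <= r' k) ->
  summable r -> summable r' -> summable (mixr r r').
Proof.
  intros P P' [M HM] [M' HM']. exists (M + M'). intro N.
  assert (Pm : forall k, 0 <= mixr r r' k) by (intro k; unfold mixr; destruct (Nat.even k); auto).
  pose proof (rsum_mono (mixr r r') Pm N N) as E. replace (N + N)%nat with (2 * N)%nat in E by lia.
  rewrite rsum_mixr in E. specialize (HM N). specialize (HM' N). lra.
Qed.

Lemma cser_mix u v r r' : (forall k, Cmod (u k) <= r k) -> (forall k, Cmod (v k) <= r' k) ->
  summable r -> summable r' -> cser (mix u v) = (cser u + cser v)%C.
Proof.
  intros Hu Hv Hr Hr'.
  assert (Dm : forall k, Cmod (mix u v k) <= mixr r r' k)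
    by (intro k; unfold mix, mixr; destruct (Nat.even k); auto).
  pose proof (cser_correct _ _ Dm (mixr_summable r r' (nonneg_of_dom u r Hu) (nonneg_of_dom v r' Hv) Hr Hr')) as Cm.
  pose proof (is_cser_plus _ _ _ _ (cser_correct u r Hu Hr) (cser_correct v r' Hv Hr')) as Cp.
  apply Cmod_close_eq. intros eps He.
  destruct (Cm (eps / 2)) as [N1 K1]; [lra|]. destruct (Cp (eps / 2)) as [N2 K2]; [lra|].
  specialize (K1 (2 * (N1 + N2))%nat ltac:(lia)). specialize (K2 (N1 + N2)%nat ltac:(lia)).
  rewrite csum_mix in K1. rewrite csum_plus in K2. rewrite Cmod_minus_sym in K1.
  pose proof (Cmod_dist_triangle (cser (mix u v)) (csum (N1 + N2) u + csum (N1 + N2) v) (cser u + cser v)). lra.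
Qed.

Lemma exp_summable_mix d b b' lam lam' : exp_summable d b lam -> exp_summable d b' lam' ->
  exp_summable d (mix b b') (mixr lam lam').
Proof.
  intros H H'.
  assert (P : forall (b : nat -> C) lam k, 0 <= Cmod (b k) * exp (d * Rabs (lam k)))
    by (intros; apply Rmult_le_pos; [apply Cmod_ge_0|left; apply exp_pos]).
  apply summable_le with (2 := mixr_summable _ _ (P b lam) (P b' lam') H H').
  intro k. unfold mix, mixr. destruct (Nat.even k); lra.
Qed.

Lemma eser_mix d b b' lam lam' z : Cmod z <= d -> exp_summable d b lam -> exp_summable d b' lam' ->
  eser (mix b b') (mixr lam lam') z = (eser b lam z + eser b' lam' z)%C.
Proof.
  intros Hz H H'. unfold eser.
  rewrite <- (cser_mix _ _ _ _ (fun k => eser_dom b lam d z k Hz) (fun k => eser_dom b' lam' d z k Hz) H H').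
  apply cser_ext. intro k. unfold mix, mixr. destruct (Nat.even k); reflexivity.
Qed.

(** Vanishing on a real interval kills all moments of the mixed series, hence its first moment at
    every height. The result is an identity on a vertical line, where means separate frequencies. *)
Lemma eser_plus_zero_coefs d b b' lam lam' : 0 < d -> exp_summable d b lam -> exp_summable d b' lam' ->
  (forall x, 0 < x < d -> (eser b lam (RtoC x) + eser b' lam' (RtoC x))%C = RtoC 0) ->
  forall t, (fser (fun j => b j * RtoC (lam j)) lam t + fser (fun j => b' j * RtoC (lam' j)) lam' t)%C = RtoC 0.
Proof.
  intros Hd H H' Hz t.
  pose proof (exp_summable_mix d b b' lam lam' H H') as Hm.
  assert (Z : forall i, mom (mix b b') (mixr lam lam') i = RtoC 0).
  { apply (mom_zero_of_line d); auto. exists d. split; auto. intros x Hx.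
    rewrite (eser_mix d) by (auto; rewrite Cmod_R, Rabs_pos_eq; lra). auto. }
  pose proof (mom_vshift_all d _ _ Hd Hm (fun i _ => Z i) t 1%nat (Nat.le_refl _)) as V.
  rewrite mom1_vshift in V. rewrite <- V.
  assert (Dom : forall (c : nat -> C) mu, exp_summable d c mu -> 
    summable (fun k => INR (fact 1) / d ^ 1 * (Cmod (c k) * exp (d * Rabs (mu k)))))
    by (intros; now apply mom_summable).
  assert (Bd : forall (c : nat -> C) mu k, Cmod (c k * RtoC (mu k) * cis (mu k * t)) <=
    INR (fact 1) / d ^ 1 * (Cmod (c k) * exp (d * Rabs (mu k)))).
  { intros c mu k. rewrite Cmod_mult, Cmod_cis, Rmult_1_r.
    pose proof (mom_dom c mu d Hd 1 k) as E. rewrite pow_1 in E. exact E. }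
  unfold fser. rewrite <- (cser_mix _ _ _ _ (Bd b lam) (Bd b' lam') (Dom b lam H) (Dom b' lam' H')).
  apply cser_ext. intro k. unfold mix, mixr. destruct (Nat.even k); reflexivity.
Qed.

(** * The sum of the moduli of the coefficients on a vertical line *)

Definition mod_base card lam a sigma (j : nat) : C :=
  RtoC (Cmod (enum_coef card lam a j) * exp (lam j * sigma)).

(** Defined through a complex series so that [eser] and the moment lemmas apply to it as a function
    of [sigma]. *)
Definition mod_sum card lam a sigma : R := Re (cser (mod_base card lam a sigma)).

Lemma mod_base_mod card lam a sigma j :
  Cmod (mod_base card lam a sigma j) = Cmod (enum_coef card lam a j) * exp (lam j * sigma).
Proof.
  unfold mod_base. rewrite Cmod_R, Rabs_pos_eq; auto.
  apply Rmult_le_pos; [apply Cmod_ge_0|left; apply exp_pos].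
Qed.

Lemma is_cser_real (r : nat -> R) l : is_cser (fun j => RtoC (r j)) l -> l = RtoC (Re l).
Proof.
  intro H. apply Cmod_close_eq. intros eps He. destruct (H eps He) as [N K].
  specialize (K N (Nat.le_refl _)).
  assert (I0 : forall n, Im (csum n (fun j => RtoC (r j))) = 0).
  { induction n as [|n IH]; [reflexivity|]. simpl csum.
    change (Im (csum n (fun j => RtoC (r j))) + 0 = 0). rewrite IH; ring. }
  apply (Rle_trans _ _ _ (im_le_Cmod _)) in K.
  change (Im (csum N (fun j => RtoC (r j)) - l)) with (Im (csum N (fun j => RtoC (r j))) - Im l) in K.
  rewrite I0, Rminus_0_l, Rabs_Ropp in K.
  destruct l as [x y]. unfold Re, Im in *; simpl in *.
  replace ((x, y) - RtoC x)%C with (Ci * RtoC y)%C.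
  - rewrite Cmod_mult, Cmod_Ci, Cmod_R. lra.
  - unfold Cminus, Cplus, Copp, Cmult, Ci, RtoC; simpl; f_equal; ring.
Qed.

Section ModSum.
Variables (al be : Rbar) (f : C -> C) (L : R -> Prop) (card : option nat) (lam : nat -> R) (a : R -> C).
Hypothesis (HD : dirichlet al be f L card lam a).

Lemma mod_sum_correct sigma : in_interval al be sigma ->
  is_cser (mod_base card lam a sigma) (RtoC (mod_sum card lam a sigma)).
Proof.
  intro Hs. assert (H : is_cser (mod_base card lam a sigma) (cser (mod_base card lam a sigma))).
  { apply (cser_correct _ (fun j => Cmod (enum_coef card lam a j) * exp (lam j * sigma))).
    - intro k. rewrite mod_base_mod. lra.
    - now apply (dir_summable HD). }
  unfold mod_sum. rewrite <- (is_cser_real _ _ H). exact H.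
Qed.

Lemma mod_sum_ge sigma N : in_interval al be sigma ->
  rsum N (fun j => Cmod (enum_coef card lam a j) * exp (lam j * sigma)) <= mod_sum card lam a sigma.
Proof.
  intro Hs. pose proof (mod_sum_correct sigma Hs) as H.
  set (r := fun j => Cmod (enum_coef card lam a j) * exp (lam j * sigma)).
  assert (Pr : forall k, 0 <= r k) by (intro; apply Rmult_le_pos; [apply Cmod_ge_0|left; apply exp_pos]).
  apply Rnot_lt_le. intro K.
  destruct (H ((rsum N r - mod_sum card lam a sigma) / 2)) as [N0 K0]; [lra|].
  specialize (K0 (N + N0)%nat ltac:(lia)).
  apply (Rle_trans _ _ _ (re_le_Cmod _)) in K0.
  change (Re (csum (N + N0) (mod_base card lam a sigma) - RtoC (mod_sum card lam a sigma)))
    with (Re (csum (N + N0) (mod_base card lam a sigma)) - mod_sum card lam a sigma) in K0.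
  rewrite Re_csum in K0. change (rsum (N + N0) (fun k => Re (mod_base card lam a sigma k)))
    with (rsum (N + N0) r) in K0.
  pose proof (rsum_mono r Pr N N0). apply Rabs_le_between in K0. lra.
Qed.

Lemma mod_sum_le sigma m : in_interval al be sigma ->
  (forall N, rsum N (fun j => Cmod (enum_coef card lam a j) * exp (lam j * sigma)) <= m) ->
  mod_sum card lam a sigma <= m.
Proof.
  intros Hs Hm. eapply Rle_trans; [apply Rle_abs|]. rewrite <- Cmod_R.
  apply (is_cser_bound _ _ m (mod_sum_correct sigma Hs)).
  intro N. eapply Rle_trans; [|apply (Hm N)]. apply rsum_le. intros k _. rewrite mod_base_mod. lra.
Qed.

Lemma f_bound_mod_sum sigma t phi : in_interval al be sigma ->
  Re (cis phi * f (sigma, t))%C <= Re (cis phi * a 0%R)%C + mod_sum card lam a sigma.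
Proof.
  intro Hs. rewrite (dir_sum HD) by exact Hs.
  rewrite Cmult_plus_distr_l.
  match goal with |- Re (?u + ?v) <= _ => change (Re (u + v)) with (Re u + Re v) end.
  apply Rplus_le_compat_l. eapply Rle_trans; [apply Rle_abs|]. eapply Rle_trans; [apply re_le_Cmod|].
  rewrite Cmod_mult, Cmod_cis, Rmult_1_l.
  set (u := fun j => (enum_coef card lam a j * Cexp (RtoC (lam j) * (sigma, t)))%C).
  assert (Cu : forall j, Cmod (u j) = Cmod (enum_coef card lam a j) * exp (lam j * sigma)).
  { intro j. exact (base_coef_mod card lam a (sigma, t) j). }
  apply (is_cser_bound u).
  - apply (cser_correct _ (fun j => Cmod (enum_coef card lam a j) * exp (lam j * sigma))).
    + intro k. rewrite Cu. lra.
    + now apply (dir_summable HD).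
  - intro N. eapply Rle_trans; [|apply (mod_sum_ge sigma N Hs)]. apply rsum_le. intros k _. rewrite Cu; lra.
Qed.

Lemma mod_base_exp_summable sigma d : 0 <= d -> (forall x, Rabs (x - sigma) <= d -> in_interval al be x) ->
  exp_summable d (mod_base card lam a sigma) lam.
Proof.
  intros Hd Hin. destruct (interval_ball_ends _ _ _ _ Hin Hd) as [E1 E2].
  apply summable_le with (2 := dirichlet_dom HD E1 E2 Hd).
  intro k. rewrite mod_base_mod. lra.
Qed.

Lemma mod_sum_eser sigma x : in_interval al be (sigma + x) ->
  eser (mod_base card lam a sigma) lam (RtoC x) = RtoC (mod_sum card lam a (sigma + x)).
Proof.
  intro Hx. transitivity (cser (mod_base card lam a (sigma + x))).
  - apply cser_ext. intro k. unfold mod_base.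
    replace (Cexp (RtoC (lam k) * RtoC x)) with (RtoC (exp (lam k * x))).
    + rewrite <- RtoC_mult. f_equal. rewrite Rmult_plus_distr_l, exp_plus. ring.
    + rewrite <- RtoC_mult. unfold Cexp, RtoC, Re, Im; simpl. rewrite cos_0, sin_0. f_equal; ring.
  - pose proof (mod_sum_correct (sigma + x) Hx) as H.
    apply (is_cser_unique (mod_base card lam a (sigma + x))); auto.
    unfold cser. apply epsilon_spec. now exists (RtoC (mod_sum card lam a (sigma + x))).
Qed.

(** Taylor's bound with a single term controls the change of the sum; the upper estimate is the one
    used when suprema on nearby lines are compared. *)
Lemma mod_sum_continuous sigma eps : in_interval al be sigma -> 0 < eps ->
  exists h, 0 < h /\ forall x, Rabs (x - sigma) < h -> in_interval al be x /\
    mod_sum card lam a x <= mod_sum card lam a sigma + eps.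
Proof.
  intros Hs He. destruct (in_interval_nbhd al be sigma Hs) as [d [Hd Hin]].
  pose proof (mod_base_exp_summable sigma d (Rlt_le _ _ Hd) Hin) as Es.
  destruct (taylor_bound _ _ d Hd Es) as [A [PA HA]].
  set (h := Rmin (d / 2) (eps * (d / 2) / (A + 1))).
  assert (Ph : 0 < h) by (apply Rmin_pos; [lra|apply Rdiv_lt_0_compat; nra]).
  assert (L1 : h <= d / 2) by apply Rmin_l.
  assert (L2 : h <= eps * (d / 2) / (A + 1)) by apply Rmin_r.
  exists h. split; auto. intros x Hx. split; [apply Hin; lra|].
  set (y := x - sigma) in *.
  specialize (HA 1%nat (RtoC y) ltac:(rewrite Cmod_R; lra)).
  replace x with (sigma + y) by (unfold y; ring).
  rewrite mod_sum_eser in HA by (apply Hin; replace (sigma + y - sigma) with y by ring; lra).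
  assert (T : taylor (mom (mod_base card lam a sigma) lam) 1 (RtoC y) = RtoC (mod_sum card lam a sigma)).
  { unfold taylor. simpl csum. simpl (fact 0). simpl (RtoC y ^ 0)%C.
    replace (mom (mod_base card lam a sigma) lam 0) with (eser (mod_base card lam a sigma) lam (RtoC 0)).
    - rewrite mod_sum_eser by (rewrite Rplus_0_r; auto). rewrite Rplus_0_r.
      simpl. rewrite Rinv_1. ring.
    - apply cser_ext. intro k. simpl. rewrite Cmult_0_r. f_equal.
      unfold Cexp, RtoC, Re, Im; simpl. rewrite exp_0, cos_0, sin_0. f_equal; ring. }
  rewrite T in HA. rewrite <- RtoC_minus, Cmod_R, Cmod_R, pow_1 in HA.
  apply Rabs_le_between in HA.
  assert (A * (Rabs y / (d / 2)) <= eps); [|lra].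
  apply Rmult_le_reg_r with (d / 2); [lra|].
  replace (A * (Rabs y / (d / 2)) * (d / 2)) with (A * Rabs y) by (field; lra).
  assert (E : (A + 1) * (eps * (d / 2) / (A + 1)) = eps * (d / 2)) by (field; lra).
  pose proof (Rabs_pos y). nra.
Qed.

End ModSum.

Arguments mod_sum_le {al be f L card lam a}.
Arguments f_bound_mod_sum {al be f L card lam a}.
Arguments mod_base_exp_summable {al be f L card lam a}.
Arguments mod_sum_eser {al be f L card lam a}.
Arguments mod_sum_continuous {al be f L card lam a}.

(* Comparing the suprema of [Re (cis phi * f)] over thin strips: the values of [f1] on the
   line [sigma] are values of [f2] on nearby lines. *)
Lemma support_le al1 be1 f1 L1 card1 lam1 a1 al2 be2 f2 L2 card2 lam2 a2 (al be : Rbar) :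
  dirichlet al1 be1 f1 L1 card1 lam1 a1 -> dirichlet al2 be2 f2 L2 card2 lam2 a2 ->
  (forall sigma, in_interval al be sigma -> in_interval al1 be1 sigma /\ in_interval al2 be2 sigma) ->
  (forall E, open E -> (forall sigma, E sigma -> in_interval al be sigma) -> forall w,
     (exists sigma, E sigma /\ Img f1 sigma w) -> exists sigma, E sigma /\ Img f2 sigma w) ->
  forall sigma phi, in_interval al be sigma ->
  Re (cis phi * a1 0%R)%C + mod_sum card1 lam1 a1 sigma <= Re (cis phi * a2 0%R)%C + mod_sum card2 lam2 a2 sigma.
Proof.
  intros D1 D2 Hin HE sigma phi Hs.
  destruct (Hin sigma Hs) as [I1 I2].
  apply Rnot_lt_le. intro K.
  set (eps := (Re (cis phi * a1 0%R)%C + mod_sum card1 lam1 a1 sigma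
    - (Re (cis phi * a2 0%R)%C + mod_sum card2 lam2 a2 sigma)) / 2).
  assert (Pe : 0 < eps) by (unfold eps; lra).
  destruct (mod_sum_continuous D2 sigma eps I2 Pe) as [h [Ph Kh]].
  destruct (in_interval_nbhd al be sigma Hs) as [d [Hd Hnb]].
  set (E := fun x => Rabs (x - sigma) < Rmin h d).
  assert (PE : 0 < Rmin h d) by now apply Rmin_pos.
  assert (Eo : open E).
  { intros x Hx. unfold E in Hx.
    assert (Pq : 0 < Rmin h d - Rabs (x - sigma)) by lra.
    exists (mkposreal _ Pq). intros y Hy. unfold E.
    assert (Hy' : Rabs (y - x) < Rmin h d - Rabs (x - sigma)) by exact Hy.
    replace (y - sigma) with ((y - x) + (x - sigma)) by ring.
    pose proof (Rabs_triang (y - x) (x - sigma)). lra. }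
  assert (Ein : forall x, E x -> in_interval al be x).
  { intros x Hx. apply Hnb. left. eapply Rlt_le_trans; [exact Hx|apply Rmin_r]. }
  assert (Bd : forall t, Re (cis phi * f1 (sigma, t))%C
    <= Re (cis phi * a2 0%R)%C + mod_sum card2 lam2 a2 sigma + eps).
  { intro t. destruct (HE E Eo Ein (f1 (sigma, t))) as [s [Es [t' Et]]].
    - exists sigma. split; [|now exists t]. unfold E. replace (sigma - sigma) with 0 by ring.
      now rewrite Rabs_R0.
    - rewrite Et. destruct (Kh s) as [Js Ks]; [eapply Rlt_le_trans; [exact Es|apply Rmin_l]|].
      pose proof (f_bound_mod_sum D2 s t' phi Js). lra. }
  assert (S1 : mod_sum card1 lam1 a1 sigma <= Re (cis phi * a2 0%R)%C + mod_sum card2 lam2 a2 sigma + eps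
     - Re (cis phi * a1 0%R)%C).
  { apply (mod_sum_le D1); auto. intro N.
    pose proof (dir_sup D1 sigma phi _ I1 Bd N). lra. }
  unfold eps in *. lra.
Qed.

(** The directions 0 and [PI] give the real part and, by addition, [p = q]; the direction [PI / 2]
    then gives the imaginary part. *)
Lemma support_eq (x y : C) (p q : R) :
  (forall phi, Re (cis phi * x)%C + p = Re (cis phi * y)%C + q) -> x = y /\ p = q.
Proof.
  intro H. pose proof (H 0) as H0. pose proof (H (PI / 2)) as H1. pose proof (H PI) as H2.
  destruct x as [x1 x2], y as [y1 y2]. unfold cis, Re, Cmult in *; simpl in *.
  rewrite cos_0, sin_0 in H0. rewrite cos_PI2, sin_PI2 in H1. rewrite cos_PI, sin_PI in H2.
  split; [f_equal; lra|lra].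
Qed.

Lemma mod_base_inj card lam a L sigma : enumerates card lam L ->
  inj_support (fun j => mod_base card lam a sigma j * RtoC (lam j))%C lam.
Proof.
  intros [_ Hinj] i k Hi Hk. 
  assert (X : forall k, (mod_base card lam a sigma k * RtoC (lam k))%C <> RtoC 0 -> le_card (S k) card).
  { intros q Hq. unfold mod_base, enum_coef in Hq. destruct (excluded_middle_informative _); auto.
    exfalso; apply Hq. rewrite Cmod_0, Rmult_0_l. ring. }
  apply Hinj; auto.
Qed.

Lemma mod_base_at card lam a L sigma nu : enumerates card lam L -> Qlin_indep L -> L nu -> a nu <> RtoC 0 ->
  exists j, lam j = nu /\ mod_base card lam a sigma j = RtoC (Cmod (a nu) * exp (nu * sigma)) /\
    (mod_base card lam a sigma j * RtoC (lam j))%C <> RtoC 0.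
Proof.
  intros Hen HL Hnu Ha. destruct (proj1 (proj1 Hen nu) Hnu) as [j [Hj Ej]].
  assert (E : mod_base card lam a sigma j = RtoC (Cmod (a nu) * exp (nu * sigma))).
  { unfold mod_base, enum_coef. destruct (excluded_middle_informative _); [|tauto]. now rewrite Ej. }
  exists j. split; auto. split; auto. rewrite E, Ej. apply Cmult_neq_0.
  - intro K. apply RtoC_inj in K. apply Cmod_gt_0 in Ha. pose proof (exp_pos (nu * sigma)). nra.
  - intro K. apply RtoC_inj in K. now apply (Qlin_indep_nonzero L nu).
Qed.

Lemma mod_base_L card lam a L sigma j : enumerates card lam L ->
  (mod_base card lam a sigma j * RtoC (lam j))%C <> RtoC 0 -> L (lam j).
Proof.
  intros Hen H. apply (enum_coef_nonzero card lam L a j Hen). intro K. apply H.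
  unfold mod_base. rewrite K, Cmod_0, Rmult_0_l. ring.
Qed.

(** The difference of the two sums is one exponential series vanishing on an interval. Its
    derivative continued to the vertical line vanishes too, and the mean at [nu] compares the two
    coefficients, both multiplied by [nu <> 0]. *)
Lemma equal_mod_sums al1 be1 f1 L1 card1 lam1 a1 al2 be2 f2 L2 card2 lam2 a2 sigma d :
  dirichlet al1 be1 f1 L1 card1 lam1 a1 -> dirichlet al2 be2 f2 L2 card2 lam2 a2 ->
  enumerates card1 lam1 L1 -> enumerates card2 lam2 L2 -> Qlin_indep L1 -> Qlin_indep L2 ->
  0 < d -> (forall x, Rabs (x - sigma) <= d -> in_interval al1 be1 x /\ in_interval al2 be2 x /\
     mod_sum card1 lam1 a1 x = mod_sum card2 lam2 a2 x) ->
  forall nu, L1 nu -> L2 nu /\ Cmod (a1 nu) = Cmod (a2 nu).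
Proof.
  intros D1 D2 En1 En2 HL1 HL2 Hd Hx nu Hnu.
  set (b1 := mod_base card1 lam1 a1 sigma).
  set (b2 := fun j => (- mod_base card2 lam2 a2 sigma j)%C).
  assert (S1 : exp_summable d b1 lam1).
  { apply (mod_base_exp_summable D1); [lra|]. intros x Hxx; apply (Hx x Hxx). }
  assert (S2' : exp_summable d (mod_base card2 lam2 a2 sigma) lam2).
  { apply (mod_base_exp_summable D2); [lra|]. intros x Hxx; apply (Hx x Hxx). }
  assert (S2 : exp_summable d b2 lam2).
  { apply summable_le with (2 := S2'). intro k. unfold b2. rewrite Cmod_opp. lra. }
  assert (Sm1 : forall (c : nat -> C) mu, exp_summable d c mu -> summable (fun j => Cmod (c j * RtoC (mu j)))).
  { intros c mu Hc. apply summable_le with (2 := mom_summable c mu d Hd Hc 1). intro k.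
    pose proof (mom_dom c mu d Hd 1 k) as E. rewrite pow_1 in E. exact E. }
  assert (Z : forall x, 0 < x < d -> (eser b1 lam1 (RtoC x) + eser b2 lam2 (RtoC x))%C = RtoC 0).
  { intros x Hxd. destruct (Hx (sigma + x)) as [I1 [I2 Em]].
    { replace (sigma + x - sigma) with x by ring. rewrite Rabs_pos_eq; lra. }
    unfold b1. rewrite (mod_sum_eser D1) by auto.
    assert (E2 : eser b2 lam2 (RtoC x) = (- (1) * RtoC (mod_sum card2 lam2 a2 (sigma + x)))%C).
    { rewrite <- (mod_sum_eser D2) by auto.
      apply (is_cser_eq _ _ _ (fun k => eser_dom b2 lam2 d (RtoC x) k
        ltac:(rewrite Cmod_R, Rabs_pos_eq; lra)) S2).
      replace (fun j => b2 j * Cexp (RtoC (lam2 j) * RtoC x))%C with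
        (fun j => - (1) * (mod_base card2 lam2 a2 sigma j * Cexp (RtoC (lam2 j) * RtoC x)))%C
        by (extensionality j; unfold b2; ring).
      apply is_cser_scal. apply (eser_correct _ _ d); auto. rewrite Cmod_R, Rabs_pos_eq; lra. }
    rewrite E2, Em. ring. }
  pose proof (eser_plus_zero_coefs d b1 b2 lam1 lam2 Hd S1 S2 Z) as V.
  set (g1 := fun j => (b1 j * RtoC (lam1 j))%C) in *.
  set (g2 := fun j => (b2 j * RtoC (lam2 j))%C) in *.
  assert (N1 : a1 nu <> RtoC 0) by (apply (dir_exponent D1); auto).
  destruct (mod_base_at card1 lam1 a1 L1 sigma nu En1 HL1 Hnu N1) as [j [Ej [Bj Gj]]].
  fold b1 in Bj, Gj. fold (g1 j) in Gj.
  pose proof (fser_mean g1 lam1 (Sm1 b1 lam1 S1) (lam1 j) (g1 j) (ex_intro _ (S j)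
    (line_coef_at g1 lam1 j (mod_base_inj card1 lam1 a1 L1 sigma En1) Gj))) as M1.
  rewrite Ej in M1.
  assert (G2 : forall k, g2 k = (- (mod_base card2 lam2 a2 sigma k * RtoC (lam2 k)))%C)
    by (intro k; unfold g2, b2; ring).
  assert (G2nz : forall k, g2 k <> RtoC 0 -> (mod_base card2 lam2 a2 sigma k * RtoC (lam2 k))%C <> RtoC 0).
  { intros k Hk E. apply Hk. rewrite G2, E. ring. }
  assert (Inj2 : inj_support g2 lam2).
  { intros i k Hi Hk. apply (mod_base_inj card2 lam2 a2 L2 sigma En2); auto. }
  assert (CC : forall (g : nat -> C) mu, summable (fun j => Cmod (g j)) -> ccont (fun t => fser g mu t * cis (- nu * t))%C).
  { intros. apply ccont_mult; [now apply ccont_fser|apply ccont_cis]. }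
  (* If [nu] were outside [L2], then [m2] would be 0 and the nonzero coefficient [g1 j] would
     vanish; inside [L2] the relation gives equality of moduli. *)
  assert (Sum0 : forall m2, is_umean (fun t => fser g2 lam2 t * cis (- nu * t))%C m2 -> (g1 j + m2)%C = RtoC 0).
  { intros m2 M2. apply (umean_unique (fun t => fser g1 lam1 t * cis (- nu * t) + fser g2 lam2 t * cis (- nu * t))%C).
    - apply umean_plus; auto; apply CC; [exact (Sm1 b1 lam1 S1)|exact (Sm1 b2 lam2 S2)].
    - eapply umean_ext; [|apply (umean_const 0)]. intro t. cbv beta.
      rewrite <- Cmult_plus_distr_r, V. ring. }
  assert (HL2nu : L2 nu).
  { apply NNPP. intro Hno. apply Gj.
    rewrite <- (Sum0 (RtoC 0)); [ring|].
    apply (fser_mean g2 lam2 (Sm1 b2 lam2 S2)). exists 0%nat. intros N _. apply line_coef_off.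
    intros k Hk E. apply Hno. rewrite <- E. apply (mod_base_L card2 lam2 a2 L2 sigma k En2). auto. }
  split; auto.
  assert (N2 : a2 nu <> RtoC 0) by (apply (dir_exponent D2); auto).
  destruct (mod_base_at card2 lam2 a2 L2 sigma nu En2 HL2 HL2nu N2) as [k [Ek [Bk Gk]]].
  assert (Gk2 : g2 k <> RtoC 0).
  { rewrite G2. intro E. apply Gk. replace (mod_base card2 lam2 a2 sigma k * RtoC (lam2 k))%C
      with (- - (mod_base card2 lam2 a2 sigma k * RtoC (lam2 k)))%C by ring. rewrite E; ring. }
  pose proof (fser_mean g2 lam2 (Sm1 b2 lam2 S2) (lam2 k) (g2 k) (ex_intro _ (S k)
    (line_coef_at g2 lam2 k Inj2 Gk2))) as M2.
  rewrite Ek in M2. specialize (Sum0 _ M2).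
  rewrite G2 in Sum0. unfold g1 in Sum0. rewrite Bj, Bk, Ej, Ek in Sum0.
  rewrite <- !RtoC_mult, <- RtoC_opp, <- RtoC_plus in Sum0. apply RtoC_inj in Sum0.
  assert (Nn : nu <> 0) by (now apply (Qlin_indep_nonzero L1)).
  pose proof (exp_pos (nu * sigma)) as Pe.
  assert (F : (Cmod (a1 nu) - Cmod (a2 nu)) * (exp (nu * sigma) * nu) = 0) by lra.
  apply Rmult_integral in F. destruct F as [F|F]; [lra|].
  apply Rmult_integral in F. destruct F; [lra|tauto].
Qed.

(** * The theorem *)

Lemma rsum_S_front n f : rsum (S n) f = f 0%nat + rsum n (fun i => f (S i)).
Proof. induction n as [|n IH]; simpl; [ring|]. simpl in IH. rewrite IH. ring. Qed.

(** * Rational coordinates and linear phase maps *)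

Definition represents (n : nat) (mu : nat -> R) (q : nat -> Q) (x : R) : Prop :=
  x = rsum n (fun i => Q2R (q i) * mu i).

Lemma represents_plus n mu q q' x y : represents n mu q x -> represents n mu q' y ->
  represents n mu (fun i => (q i + q' i)%Q) (x + y).
Proof.
  intros -> ->. unfold represents. rewrite <- rsum_plus. apply rsum_ext. intros i _.
  rewrite Q2R_plus. ring.
Qed.

Lemma represents_scal n mu q c x : represents n mu q x ->
  represents n mu (fun i => (c * q i)%Q) (Q2R c * x).
Proof.
  intros ->. unfold represents. rewrite <- rsum_scal. apply rsum_ext. intros i _.
  rewrite Q2R_mult. ring.
Qed.

Lemma rsum_single n f k : (k < n)%nat -> (forall j, (j < n)%nat -> j <> k -> f j = 0) -> rsum n f = f k.
Proof.
  induction n as [|n IH]; intros Hk H; [lia|]. simpl.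
  destruct (Nat.eq_dec k n) as [->|Hn].
  - rewrite (rsum_ext n f (fun _ => 0)) by (intros j Hj; apply H; lia).
    rewrite rsum_const. ring.
  - rewrite IH, (H n) by (try lia; intros; apply H; lia). ring.
Qed.

Definition unitq (k i : nat) : Q := if Nat.eq_dec i k then 1%Q else 0%Q.

Lemma represents_unit n mu k : (k < n)%nat -> represents n mu (unitq k) (mu k).
Proof.
  intro Hk. unfold represents. rewrite (rsum_single n _ k Hk).
  - unfold unitq. destruct (Nat.eq_dec k k); [|congruence]. rewrite RMicromega.Q2R_1. ring.
  - intros j _ Hj. unfold unitq. destruct (Nat.eq_dec j k); [congruence|]. rewrite RMicromega.Q2R_0. ring.
Qed.

Lemma Qspan_represents n mu x : Qspan (first_terms mu n) x -> exists q, represents n mu q x.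
Proof.
  intros [l [Hl ->]]. induction l as [|[c y] l IH].
  - exists (fun _ => 0%Q). unfold represents, Qcomb; simpl.
    rewrite (rsum_ext n _ (fun _ => 0)) by (intros; rewrite RMicromega.Q2R_0; ring).
    rewrite rsum_const. ring.
  - destruct IH as [q Hq]; [intros p Hp; apply Hl; now right|].
    destruct (Hl (c, y) (or_introl eq_refl)) as [j [Hj Ej]]. simpl in Ej. subst y.
    exists (fun i => (c * unitq j i + q i)%Q).
    change (Qcomb ((c, mu j) :: l)) with (Q2R c * mu j + Qcomb l).
    apply represents_plus; auto. apply represents_scal. now apply represents_unit.
Qed.

(** The full set of Fourier exponents is [L] together with 0; placing 0 first shifts the given
    enumeration by one. *)
Definition prefix0 (lam : nat -> R) (j : nat) : R := match j with O => 0 | S i => lam i end.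

Definition card_S (card : option nat) : option nat :=
  match card with Some K => Some (S K) | None => None end.

Lemma le_card_S n card : le_card (S n) (card_S card) <-> le_card n card.
Proof. destruct card; simpl; [lia|tauto]. Qed.

Lemma enumerates_prefix0 card lam L L' : enumerates card lam L -> ~ L 0 ->
  (forall x, L' x <-> L x \/ x = 0) -> enumerates (card_S card) (prefix0 lam) L'.
Proof.
  intros [H1 H2] H0 HL'. split.
  - intro x. rewrite HL'. split.
    + intros [Hx| ->].
      * apply H1 in Hx. destruct Hx as [j [Hj E]]. exists (S j). split; auto. now apply le_card_S.
      * exists 0%nat. split; auto. destruct card; simpl; auto; lia.
    + intros [[|j] [Hj E]]; simpl in E; [right; auto|].
      left. apply H1. exists j. split; auto. now apply (proj1 (le_card_S _ _)).
  - assert (X : forall j, le_card (S (S j)) (card_S card) -> lam j <> 0).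
    { intros j Hj E. apply H0. apply H1. exists j. split; auto. now apply (proj1 (le_card_S _ _)). }
    intros [|i] [|j] Hi Hj E; simpl in E; auto.
    + exfalso. now apply (X j).
    + exfalso. now apply (X i).
    + f_equal. apply H2; auto; now apply (proj1 (le_card_S _ _)).
Qed.

Section Phase.
Variables (L : R -> Prop) (card : option nat) (lam : nat -> R) (theta : R -> R).
Hypotheses (Hen : enumerates card lam L) (HL : Qlin_indep L) (H0 : theta 0 = 0).

Definition phase_of (n : nat) (q : nat -> Q) : R :=
  rsum n (fun i => Q2R (q i) * theta (prefix0 lam i)).

(* The coefficient of the exponent [0] is not determined, but [theta 0 = 0]. *)
Lemma phase_of_unique n q q' x : le_card n (card_S card) ->
  represents n (prefix0 lam) q x -> represents n (prefix0 lam) q' x -> phase_of n q = phase_of n q'.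
Proof.
  intros Hn Hq Hq'. destruct n as [|n]; [reflexivity|]. apply (proj1 (le_card_S _ _)) in Hn.
  unfold represents in *. unfold phase_of. rewrite rsum_S_front in Hq. rewrite rsum_S_front in Hq'.
  rewrite !rsum_S_front. simpl in *. rewrite H0, !Rmult_0_r, !Rplus_0_l in *.
  assert (Lt : forall i, (i < n)%nat -> le_card (S i) card).
  { intros i Hi. destruct card; simpl in *; auto; lia. }
  assert (Z : forall i, (i < n)%nat -> (q (S i) - q' (S i) == 0)%Q).
  { apply (Qlin_indep_seq L lam n (fun i => (q (S i) - q' (S i))%Q)); auto.
    - intros i j Hi Hj. apply (proj2 Hen); auto.
    - intros i Hi. apply (proj1 Hen). exists i; auto.
    - rewrite (rsum_ext n _ (fun i => Q2R (q (S i)) * lam i + -1 * (Q2R (q' (S i)) * lam i))).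
      + rewrite rsum_plus, rsum_scal. lra.
      + intros i _. rewrite Q2R_minus. ring. }
  apply rsum_ext. intros i Hi. f_equal. apply Qreals.Qeq_eqR.
  specialize (Z i Hi). rewrite <- (Qplus_0_l (q' (S i))), <- Z. ring.
Qed.

(** Uses arbitrary rational coordinates of [x]; on the span the result does not depend on them, by
    [phase_of_unique], and off the span it is irrelevant to [Qlinear_on]. *)
Definition phase_map (n : nat) (x : R) : R :=
  phase_of n (epsilon (inhabits (fun _ => 0%Q)) (fun q => represents n (prefix0 lam) q x)).

Lemma phase_map_eq n q x : le_card n (card_S card) -> represents n (prefix0 lam) q x ->
  phase_map n x = phase_of n q.
Proof.
  intros Hn Hq. apply (phase_of_unique n _ _ x Hn); auto.
  apply epsilon_spec. now exists q.
Qed.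

Lemma phase_map_linear n : le_card n (card_S card) ->
  Qlinear_on (Qspan (first_terms (prefix0 lam) n)) (phase_map n).
Proof.
  intro Hn. split.
  - intros x y Hx Hy. destruct (Qspan_represents _ _ _ Hx) as [q Hq].
    destruct (Qspan_represents _ _ _ Hy) as [q' Hq'].
    rewrite (phase_map_eq n q x), (phase_map_eq n q' y) by auto.
    rewrite (phase_map_eq n _ _ Hn (represents_plus _ _ _ _ _ _ Hq Hq')).
    unfold phase_of. rewrite <- rsum_plus. apply rsum_ext. intros i _. rewrite Q2R_plus. ring.
  - intros c x Hx. destruct (Qspan_represents _ _ _ Hx) as [q Hq].
    rewrite (phase_map_eq n q x) by auto.
    rewrite (phase_map_eq n _ _ Hn (represents_scal _ _ _ c _ Hq)).
    unfold phase_of. rewrite <- rsum_scal. apply rsum_ext. intros i _. rewrite Q2R_mult. ring.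
Qed.

Lemma phase_map_at n j : le_card n (card_S card) -> (j < n)%nat ->
  phase_map n (prefix0 lam j) = theta (prefix0 lam j).
Proof.
  intros Hn Hj. rewrite (phase_map_eq n _ _ Hn (represents_unit n (prefix0 lam) j Hj)).
  (* The phase of the unit coordinates is the unit representation with the exponents replaced by
     their phases. *)
  symmetry. apply (represents_unit n (fun i => theta (prefix0 lam i)) j Hj).
Qed.

End Phase.

Theorem theorem14 (al1 be1 al2 be2 : Rbar)
    (hab1 : Rbar_lt al1 be1) (hab2 : Rbar_lt al2 be2)
    (hU : exists s : C, in_strip al1 be1 s /\ in_strip al2 be2 s)
    (L1 L2 : R -> Prop)
    (hc1 : countable_set L1) (hc2 : countable_set L2)
    (hli1 : Qlin_indep L1) (hli2 : Qlin_indep L2)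
    (f1 f2 : C -> C)
    (hf1 : AP al1 be1 f1) (hf2 : AP al2 be2 f2)
    (hexp1 : forall x : R, fourier_exponent al1 be1 f1 x <-> (L1 x \/ x = 0))
    (hexp2 : forall x : R, fourier_exponent al2 be2 f2 x <-> (L2 x \/ x = 0)) :
  star_equiv al1 be1 f1 al2 be2 f2 <->
  exists al be : Rbar,
    Rbar_lt al be /\
    (forall sigma : R, in_interval al be sigma ->
       in_interval al1 be1 sigma /\ in_interval al2 be2 sigma) /\
    forall E : R -> Prop, open E ->
      (forall sigma : R, E sigma -> in_interval al be sigma) ->
      forall w : C,
        (exists sigma : R, E sigma /\ Img f1 sigma w) <->
        (exists sigma : R, E sigma /\ Img f2 sigma w).
Proof.
  destruct hc1 as [card1 [lam1 en1]]. destruct hc2 as [card2 [lam2 en2]].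
  destruct (dirichlet_exists al1 be1 f1 L1 card1 lam1 hab1 hf1 en1 hli1 hexp1) as [a1 D1].
  destruct (dirichlet_exists al2 be2 f2 L2 card2 lam2 hab2 hf2 en2 hli2 hexp2) as [a2 D2].
  assert (Z1 : ~ L1 0) by (intro K; now apply (Qlin_indep_nonzero L1 0 hli1 K)).
  assert (Z2 : ~ L2 0) by (intro K; now apply (Qlin_indep_nonzero L2 0 hli2 K)).
  split.
  - intro Heq.
    destruct (star_equiv_moduli _ _ _ _ _ _ _ _ _ _ _ _ _ _ hab1 hab2 hf1 hf2 D1 D2 Heq)
      as [Hex [Ha0 Hmod]].
    assert (hexp2' : forall x, fourier_exponent al2 be2 f2 x <-> L1 x \/ x = 0)
      by (intro x; rewrite <- Hex; apply hexp1).
    (* The transfer of values requires one common enumeration, so [f2] is expanded again along that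
       of [L1]; its coefficients are unchanged by uniqueness. *)
    destruct (dirichlet_exists al2 be2 f2 L1 card1 lam1 hab2 hf2 en1 hli1 hexp2') as [a2' D2'].
    assert (Ea : forall nu, a2' nu = a2 nu).
    { intro nu. apply (fourier_coef_unique al2 be2 f2 hf2 nu); auto; [apply D2'|apply D2]. }
    destruct hU as [s [hs1 hs2]].
    destruct (in_interval_nbhd _ _ _ hs1) as [d1 [P1 K1]].
    destruct (in_interval_nbhd _ _ _ hs2) as [d2 [P2 K2]].
    set (d := Rmin d1 d2). assert (Pd : 0 < d) by now apply Rmin_pos.
    assert (Hin : forall y, Rabs (y - Re s) <= d -> in_interval al1 be1 y /\ in_interval al2 be2 y).
    { intros y Hy. split; [apply K1|apply K2]; (eapply Rle_trans; [exact Hy|]);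
        [apply Rmin_l|apply Rmin_r]. }
    exists (Finite (Re s - d)), (Finite (Re s + d)). split; [simpl; lra|]. split.
    + intros sigma Hs. apply in_Finite_interval in Hs. apply Hin. lra.
    + intros E HE HEin w. split.
      * apply (values_included al2 be2 f2 a2' al1 be1 f1 a1 L1 card1 lam1 (Re s) d E w); auto.
        -- now rewrite Ea.
        -- intro nu. now rewrite Ea.
        -- intros y Hy. destruct (Hin y Hy); auto.
      * apply (values_included al1 be1 f1 a1 al2 be2 f2 a2' L1 card1 lam1 (Re s) d E w); auto.
        -- now rewrite Ea.
        -- intro nu. now rewrite Ea.
  - intros [al [be [Hab [Hin HE]]]].
    assert (Sup : forall sigma, in_interval al be sigma ->
      a1 0 = a2 0 /\ mod_sum card1 lam1 a1 sigma = mod_sum card2 lam2 a2 sigma).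
    { intros sigma Hs. apply support_eq. intro phi. apply Rle_antisym.
      - apply (support_le al1 be1 f1 L1 card1 lam1 a1 al2 be2 f2 L2 card2 lam2 a2 al be); auto.
        intros E Eo Ein w. apply HE; auto.
      - apply (support_le al2 be2 f2 L2 card2 lam2 a2 al1 be1 f1 L1 card1 lam1 a1 al be); auto.
        + intros x Hx. destruct (Hin x Hx); auto.
        + intros E Eo Ein w. apply HE; auto. }
    destruct (in_interval_nonempty al be Hab) as [sigma Hs].
    destruct (in_interval_nbhd al be sigma Hs) as [d [Pd Kd]].
    destruct (Sup sigma Hs) as [Ha0 _].
    assert (Dir1 : forall nu, L1 nu -> L2 nu /\ Cmod (a1 nu) = Cmod (a2 nu)).
    { apply (equal_mod_sums al1 be1 f1 L1 card1 lam1 a1 al2 be2 f2 L2 card2 lam2 a2 sigma d); auto.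
      intros x Hx. specialize (Kd x Hx). destruct (Hin x Kd). destruct (Sup x Kd). auto. }
    assert (Dir2 : forall nu, L2 nu -> L1 nu /\ Cmod (a2 nu) = Cmod (a1 nu)).
    { apply (equal_mod_sums al2 be2 f2 L2 card2 lam2 a2 al1 be1 f1 L1 card1 lam1 a1 sigma d); auto.
      intros x Hx. specialize (Kd x Hx). destruct (Hin x Kd). destruct (Sup x Kd). auto. }
    (* The phase at 0 is prescribed to be 0, as a linear map demands; this is consistent because the
       constant terms are equal. The other phases are free by independence. *)
    assert (Th : forall nu, exists th, (nu = 0 -> th = 0) /\ (L1 nu \/ nu = 0 -> a2 nu = (a1 nu * cis th)%C)).
    { intro nu. destruct (Req_dec nu 0) as [->|Hn].
      - exists 0. split; auto. intros _. rewrite Ha0, cis_0. ring.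
      - destruct (classic (L1 nu)) as [HL|HL].
        + destruct (Cmod_eq_rotation _ _ (proj2 (Dir1 nu HL))) as [th Hth].
          exists th. split; [tauto|auto].
        + exists 0. split; auto. tauto. }
    destruct (function_choice _ Th) as [theta Hth].
    assert (T0 : theta 0 = 0) by (now apply (proj1 (Hth 0))).
    assert (hexp2' : forall x, fourier_exponent al2 be2 f2 x <-> L1 x \/ x = 0).
    { intro x. rewrite hexp2. split; intros [K|K]; auto; left; [apply Dir2|apply Dir1]; auto. }
    pose proof (enumerates_prefix0 card1 lam1 L1 _ en1 Z1 hexp1) as En1.
    pose proof (enumerates_prefix0 card1 lam1 L1 _ en1 Z1 hexp2') as En2.
    exists (card_S card1), (prefix0 lam1), (fun j => a1 (prefix0 lam1 j)), (fun j => a2 (prefix0 lam1 j)).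
    split; auto. split; auto. split.
    + intros j _. split; [apply D1|apply D2].
    + intros n _ Hn. exists (phase_map lam1 theta n). split.
      * now apply (phase_map_linear L1 card1).
      * intros j Hj. rewrite Cexp_Ci, (phase_map_at L1 card1) by auto.
        apply Hth. apply hexp1. apply (proj1 En1). exists j. split; auto.
        destruct card1; simpl in *; auto; lia.
Qed.
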